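(* Let $\Omega=\{(q_1,q_2,q_3)\in(\mathbb{R}^2)^3: q_i\neq q_j\text{ for } i\ne j\}$ with the diagonal action of $SO(2)$. Fix $q_0=(q_{10},q_{20},q_{30})\in\Omega$ such that the points $q_{10},q_{20},q_{30}\in\mathbb{R}^2$ do not lie on a common line, and choose constants $A_{ij}<0<B_{ij}$ for $1\le i<j\le 3$ such that $\|q_{i0}-q_{j0}\|=\sqrt{-3B_{ij}/A_{ij}}$ for all $1\le i<j\le3$. Let $U:\Omega\to\mathbb{R}$ be the Schwarzschild three-body potential $$U(q)=\sum_{1\le i<j\le 3}\left(\frac{A_{ij}}{\|q_i-q_j\|}+\frac{B_{ij}}{\|q_i-q_j\|^{3}}\right).$$ Write $\sigma(\nabla^2U(q_0))\cap(0,+\infty)=\{\beta_1^2,\ldots,\beta_m^2\}$ with distinct $\beta_1,\ldots,\beta_m>0$, and let $\beta_{j_0}$ be such that $\beta_j/\beta_{j_0}\notin\mathbb{N}$ for all $j\neq j_0$. Then for every open neighbourhood $V$ of the orbit $SO(2)(q_0)$ in $\Omega$ and every $\delta>0$ there exists a non-stationary periodic solution $q(t)$ of $\ddot q(t)=-\nabla U(q(t))$ whose trajectory is contained in $V$ and whose minimal period $T$ satisfies $|T-2\pi/\beta_{j_0}|<\delta$.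
   Context: The diagonal action is $\gamma(q_1,q_2,q_3)=(\gamma q_1,\gamma q_2,\gamma q_3)$, and $SO(2)(q_0)$ is the orbit of $q_0$. $\sigma(\cdot)$ denotes the spectrum of a symmetric matrix, $\nabla^2U$ the Hessian, and $\mathbb{N}=\{1,2,3,\ldots\}$. *)

(* Defs.v *)
From HB Require Import structures.
From mathcomp Require Import all_boot all_order all_algebra.
From mathcomp Require Import all_classical all_reals all_analysis.

Set Implicit Arguments.
Unset Strict Implicit.
Unset Printing Implicit Defensive.

Import Order.TTheory GRing.Theory Num.Theory.
Import numFieldNormedType.Exports.

Local Open Scope classical_set_scope.
Local Open Scope ring_scope.

(* (R^2)^3 is the space of 3 x 2 matrices: row i is the i-th point.  The
   library norm on matrices is the sup norm; it is only used here for the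
   topology and for differentiation.  Distances between points use norm2. *)
Notation config R := 'M[R]_(3, 2).

Definition norm2 (R : realType) (x : 'rV[R]_2) : R :=
  Num.sqrt (\sum_(k < 2) x 0 k ^+ 2).

Definition dist (R : realType) (q : config R) (i j : 'I_3) : R :=
  norm2 (row i q - row j q).

Definition Omega (R : realType) : set (config R) :=
  [set q | forall i j : 'I_3, i != j -> row i q != row j q].
Arguments Omega : clear implicits.

Definition collinear (R : realType) (q : config R) : Prop :=
  exists p d : 'rV[R]_2,
    d != 0 /\ forall i : 'I_3, exists t : R, row i q = p + t *: d.

Definition SO2 (R : realType) : set 'M[R]_2 :=
  [set g | g *m g^T = 1%:M /\ \det g = 1].
Arguments SO2 : clear implicits.

(* Points are row vectors, so g acts on each of them by right multiplication
   by the transpose of g. *)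
Definition act (R : realType) (g : 'M[R]_2) (q : config R) : config R :=
  q *m g^T.

Definition SO2_orbit (R : realType) (q : config R) : set (config R) :=
  [set act g q | g in SO2 R].

(* The value outside Omega is irrelevant: Omega is open and the potential is
   only differentiated at points of Omega. *)
Definition schwarzschild (R : realType) (A B : 'I_3 -> 'I_3 -> R)
    (q : config R) : R :=
  \sum_(i < 3) \sum_(j < 3 | (i < j)%N)
    (A i j / dist q i j + B i j / dist q i j ^+ 3).

Definition grad (R : realType) (U : config R -> R) (q : config R) : config R :=
  \matrix_(i < 3, k < 2) 'D_(delta_mx i k) U q.

(* The canonical basis of (R^2)^3 is indexed by 'I_(3 * 2) through mxvec. *)
Definition basis_vec (R : realType) (a : 'I_(3 * 2)) : config R :=
  vec_mx (delta_mx 0 a).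

Definition hessian (R : realType) (U : config R -> R) (q : config R) :
    'M[R]_(3 * 2) :=
  \matrix_(a, b) 'D_(basis_vec R a) ('D_(basis_vec R b) U) q.

Definition spectrum (R : realType) (n : nat) (M : 'M[R]_n) : set R :=
  [set l | eigenvalue M l].

(* Solutions of q'' = - grad U (q) on the whole time line, staying in Omega. *)
Definition newton_solution (R : realType) (U : config R -> R)
    (q : R -> config R) : Prop :=
  forall t : R,
    [/\ Omega R (q t), derivable q t 1, derivable (q^`())%classic t 1
      & (q^`()^`())%classic t = - grad U (q t)].

Definition period (R : realType) (q : R -> config R) (T : R) : Prop :=
  0 < T /\ forall t, q (t + T) = q t.

Definition minimal_period (R : realType) (q : R -> config R) (T : R) : Prop :=
  period q T /\ forall S, period q S -> T <= S.

Definition stationary (R : realType) (q : R -> config R) : Prop :=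
  forall s t, q s = q t.

(* Main.v *)
Require Import Defs.
From HB Require Import structures.
From mathcomp Require Import all_boot all_order all_algebra.
From mathcomp Require Import ring lra.
From mathcomp Require Import all_classical all_reals all_analysis.
Import Order.TTheory GRing.Theory Num.Theory.
Import numFieldNormedType.Exports.
Local Open Scope classical_set_scope.
Local Open Scope ring_scope.

Set Implicit Arguments.
Unset Strict Implicit.
Unset Printing Implicit Defensive.

(** At [q0] every pair sits at the minimum of its own potential, so the Hessian
    is positive semidefinite and, the triangle being rigid, its kernel consists
    of infinitesimal rigid motions.  The periodic orbits are brake orbits:
    solutions that are even in time and start at rest.  Such a solution has zero
    momentum and zero angular momentum, so it is periodic itself and not only
    modulo rotations.  In eigencoordinates of the Hessian, with time rescaled to
    period [2 pi], the equation is solved by a Lyapunov-Schmidt reduction: a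
    contraction yields, for each unit vector [v] of the resonant eigenspace, an
    even periodic function close to [e v cos t] with prescribed mean potential
    energy that solves the equation up to a resonant term [xi cos t] orthogonal
    to [v] and a constant force in the kernel of the Hessian.  The eigenvalue may
    be multiple, so [xi] is removed variationally: it vanishes where the mean
    kinetic energy is minimal on the unit sphere of the eigenspace.  The constant
    force vanishes because momentum and angular momentum vanish at the two brake
    times. *)

(** * Primitives of continuous functions *)

(** Prescribing the mean potential energy is what makes the variational step work. The equation
    carries a scalar factor [lam]. Along the family, the first variation of the mean kinetic energy
    is [lam] times that of the mean potential energy minus the pairing of [xi] with the variation of
    [v]. The constraint kills the first summand, so at a critical [v] the defect [xi] is
    proportional to [v], hence zero by the orthogonality already built in. Thus [lam] is a Lagrange
    multiplier; it also carries the unknown period, which tends to that of the linearisation because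
    [lam] tends to 1 with the amplitude. A minimum on a compact sphere needs only Lipschitz
    dependence on [v], so the estimates are bounds and Lipschitz bounds, and the family is never
    differentiated in [v]. On even functions of period 2 pi the operator d^2/dt^2 + w^2 fails to be
    invertible only for integer [w]; after rescaling, the assumption on the quotients of the
    frequencies leaves only [w = 1], together with [w = 0] from the kernel of the Hessian. *)

Definition is_primitive (R : realType) (F f : R -> R) : Prop :=
  forall x : R, is_derive x 1 F (f x).

Section Primitives.
Variable R : realType.
Implicit Types (F G f g : R -> R) (x y : R).

Lemma is_primitive_eq F f g : is_primitive F f -> f =1 g -> is_primitive F g.
Proof. by move=> Ff fg x; rewrite -fg; exact: Ff. Qed.

Lemma is_primitive_cst (c : R) : is_primitive (fun=> c) (fun=> 0).
Proof. by move=> x; exact: is_derive_cst. Qed.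

Lemma is_primitive_id : is_primitive (fun x => x) (fun=> 1).
Proof. by move=> x; exact: is_derive_id. Qed.

Lemma is_primitiveD F G f g : is_primitive F f -> is_primitive G g ->
  is_primitive (fun x => F x + G x) (fun x => f x + g x).
Proof. by move=> Ff Gg x; exact: is_deriveD. Qed.

Lemma is_primitiveN F f : is_primitive F f ->
  is_primitive (fun x => - F x) (fun x => - f x).
Proof. by move=> Ff x; exact: is_deriveN. Qed.

Lemma is_primitiveB F G f g : is_primitive F f -> is_primitive G g ->
  is_primitive (fun x => F x - G x) (fun x => f x - g x).
Proof. by move=> Ff Gg; apply: is_primitiveD => //; exact: is_primitiveN. Qed.

Lemma is_primitiveM F G f g : is_primitive F f -> is_primitive G g ->
  is_primitive (fun x => F x * G x) (fun x => f x * G x + F x * g x).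
Proof.
move=> Ff Gg x; have := @is_deriveM _ _ _ _ _ _ _ _ (Ff x) (Gg x).
by move=> h; apply: (is_derive_eq h); rewrite /GRing.scale/= addrC mulrC [in RHS]mulrC; ring.
Qed.

Lemma is_primitiveZ (k : R) F f : is_primitive F f ->
  is_primitive (fun x => k * F x) (fun x => k * f x).
Proof. by move=> Ff x; exact: (is_deriveZ _ (Ff x)). Qed.

Lemma is_primitive_comp F G f g : is_primitive F f -> is_primitive G g ->
  is_primitive (fun x => F (G x)) (fun x => f (G x) * g x).
Proof. by move=> Ff Gg x; exact: (is_derive1_comp (Ff _) (Gg x)). Qed.

Lemma is_primitive_continuous F f : is_primitive F f -> continuous F.
Proof.
by move=> Ff x; apply/differentiable_continuous/derivable1_diffP; have [] := Ff x.
Qed.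

Lemma is_primitive0_cst F x y : is_primitive F (fun=> 0) -> F x = F y.
Proof. exact: is_derive_0_is_cst. Qed.

Lemma is_primitive_inj F G f x0 : is_primitive F f -> is_primitive G f ->
  F x0 = G x0 -> F =1 G.
Proof.
move=> Ff Gf e x; apply/eqP; rewrite -subr_eq0; apply/eqP.
rewrite (@is_primitive0_cst (fun x => F x - G x) x x0); first by rewrite e subrr.
by apply: is_primitive_eq (is_primitiveB Ff Gf) _ => z; rewrite subrr.
Qed.

Lemma primitive_mean_value F f x y : is_primitive F f -> x <= y ->
  exists2 c, x <= c <= y & F y - F x = f c * (y - x).
Proof.
move=> Ff xy; have [| |c + ->] := @MVT_segment _ F f _ _ xy.
- by move=> z _; exact: Ff.
- by apply: continuous_subspaceT; exact: is_primitive_continuous Ff.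
- by rewrite in_itv/=; exists c.
Qed.

Lemma primitive_le F f x y B : is_primitive F f -> x <= y ->
  (forall t, x <= t <= y -> `|f t| <= B) -> `|F y - F x| <= B * (y - x).
Proof.
move=> Ff xy fB; have [c cxy ->] := primitive_mean_value Ff xy.
by rewrite normrM (ger0_norm (x := y - x)) ?subr_ge0// ler_wpM2r ?subr_ge0// fB.
Qed.

Lemma primitive_rolle F f x y : is_primitive F f -> x < y -> F x = F y ->
  exists2 c, x <= c <= y & f c = 0.
Proof.
move=> Ff xy e; have [c cxy] := primitive_mean_value Ff (ltW xy).
rewrite e subrr => /esym/eqP; rewrite mulf_eq0 subr_eq0 (gt_eqF xy) orbF => /eqP.
by exists c.
Qed.

End Primitives.

Section PrimitiveExistence.
Variable R : realType.
Implicit Types (F f : R -> R) (a x y : R).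

Lemma primitive_from f a : continuous f ->
  exists F, forall x, a < x -> is_derive x 1 F (f x).
Proof.
move=> cf; exists (fun x => \int[lebesgue_measure]_(t in `[a, x]) f t)%R => x ax.
have xu : x < x + 1 by rewrite ltrDl.
have fi : (@lebesgue_measure R).-integrable `[a, x + 1] (EFin \o f).
  apply: continuous_compact_integrable; first exact: segment_compact.
  exact: continuous_subspaceT.
have [dF eF] := continuous_FTC1_closed xu fi ax (cf x).
by apply: DeriveDef => //; rewrite -derive1E.
Qed.

Lemma zero_derive_from_cst F a x y : (forall z, a < z -> is_derive z 1 F 0) ->
  a < x -> x <= y -> F x = F y.
Proof.
move=> dF ax xy.
have [| |z _] := @MVT_segment _ F (fun=> 0) _ _ xy.
- by move=> z; rewrite in_itv/= => /andP[xz _]; apply: dF; exact: lt_trans xz.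
- apply: derivable_within_continuous => z; rewrite in_itv/= => /andP[xz _].
  by have [] := dF z (lt_le_trans ax xz).
- by rewrite mul0r => /eqP; rewrite subr_eq0 => /eqP.
Qed.

(** An integral with variable upper end is a primitive only to the right of its base point.
    Primitives based at -(n+1), all normalised to vanish at 0, agree where both are defined and are
    glued. *)
Lemma primitive_exists f : continuous f ->
  exists F, F 0 = 0 /\ is_primitive F f.
Proof.
move=> cf.
have /choice[G Gf] : forall n : nat, exists F, F 0 = 0 /\
    forall x, - n.+1%:R < x -> is_derive x 1 F (f x).
  move=> n; have [F Ff] := primitive_from (- n.+1%:R) cf.
  exists (fun x => F x - F 0); split; first by rewrite subrr.
  move=> x nx; have Fx := Ff x nx.
  have := @is_deriveB _ _ _ _ _ _ _ _ _ Fx (is_derive_cst (F 0) x 1).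
  by rewrite subr0.
have GG m n x : - m.+1%:R < x -> - n.+1%:R < x -> G m x = G n x.
  move=> mx nx; pose a := Num.max (- m.+1%:R) (- n.+1%:R) : R.
  have dD z : a < z -> is_derive z 1 (fun z => G m z - G n z) 0.
    rewrite gt_max => /andP[mz nz].
    have := @is_deriveB _ _ _ _ _ _ _ _ _ ((Gf m).2 z mz) ((Gf n).2 z nz).
    by rewrite subrr.
  have ax : a < x by rewrite gt_max mx.
  have a0 : a < 0 by rewrite gt_max !oppr_lt0 !ltr0Sn.
  apply/eqP; rewrite -subr_eq0; apply/eqP.
  have -> : G m x - G n x = G m 0 - G n 0.
    case: (leP x 0) => [x0|/ltW x0].
    - exact: (zero_derive_from_cst dD ax x0).
    - exact/esym/(zero_derive_from_cst dD a0 x0).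
  by rewrite (Gf m).1 (Gf n).1 subrr.
pose N x := Num.truncn `|x|.
have Nx x : - (N x).+1%:R < x.
  have := truncnS_gt `|x|; rewrite -/(N x) => h.
  by rewrite ltrNl (le_lt_trans _ h)// -normrN ler_norm.
exists (fun x => G (N x) x); split; first exact: (Gf _).1.
move=> x; apply: (@near_eq_is_derive _ _ _ (G (N x))); last first.
  exact: (Gf _).2.
near=> y; apply: GG; last exact: Nx.
near: y.
exact: lt_nbhsr (Nx x).
Unshelve. all: by end_near. Qed.

(** Chosen rather than written as an integral, so that it is a primitive on both sides of 0 and
    vanishes there. The zero function is the default when no primitive exists. *)
Definition prim f : R -> R :=
  xget (fun=> 0) [set F | F 0 = 0 /\ is_primitive F f].

Lemma prim_spec f : continuous f -> prim f 0 = 0 /\ is_primitive (prim f) f.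
Proof.
move=> /primitive_exists cf.
exact: (@xgetPex _ (fun=> 0) [set F | F 0 = 0 /\ is_primitive F f] cf).
Qed.

Lemma prim0 f : continuous f -> prim f 0 = 0.
Proof. by case/prim_spec. Qed.

Lemma is_primitive_prim f : continuous f -> is_primitive (prim f) f.
Proof. by case/prim_spec. Qed.

Lemma prim_unique F f : is_primitive F f -> continuous f ->
  forall x, prim f x = F x - F 0.
Proof.
move=> Ff cf; apply: (@is_primitive_inj _ _ _ _ 0 (is_primitive_prim cf)).
  by apply: is_primitive_eq (is_primitiveB Ff (is_primitive_cst (F 0))) _ => x; rewrite subr0.
by rewrite prim0// subrr.
Qed.

Lemma primD f g : continuous f -> continuous g ->
  forall x, prim (fun t => f t + g t) x = prim f x + prim g x.
Proof.
move=> cf cg x; rewrite (prim_unique (is_primitiveD (is_primitive_prim cf) (is_primitive_prim cg))).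
  by rewrite !prim0// addr0 subr0.
by move=> z; apply: continuousD; [exact: cf|exact: cg].
Qed.

Lemma primZ (k : R) f : continuous f ->
  forall x, prim (fun t => k * f t) x = k * prim f x.
Proof.
move=> cf x; rewrite (prim_unique (is_primitiveZ k (is_primitive_prim cf))).
  by rewrite prim0// mulr0 subr0.
by move=> z; apply: continuousM; [exact: cst_continuous|exact: cf].
Qed.

Lemma prim_le f x B : continuous f -> 0 <= x ->
  (forall t, `|f t| <= B) -> `|prim f x| <= B * x.
Proof.
move=> cf x0 fB; have := primitive_le (is_primitive_prim cf) x0 (fun t _ => fB t).
by rewrite prim0// !subr0.
Qed.

Lemma continuousDf f g : continuous f -> continuous g -> continuous (fun x => f x + g x).
Proof. by move=> cf cg x; apply: continuousD; [exact: cf|exact: cg]. Qed.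

Lemma continuousBf f g : continuous f -> continuous g -> continuous (fun x => f x - g x).
Proof. by move=> cf cg x; apply: continuousB; [exact: cf|exact: cg]. Qed.

Lemma continuousMf f g : continuous f -> continuous g -> continuous (fun x => f x * g x).
Proof. by move=> cf cg x; apply: continuousM; [exact: cf|exact: cg]. Qed.

Lemma continuousZf (k : R) f : continuous f -> continuous (fun x => k * f x).
Proof. by move=> cf; apply: continuousMf => // x; exact: cst_continuous. Qed.

Lemma continuous_sumf (I : finType) (P : pred I) (f : I -> R -> R) :
  (forall i, P i -> continuous (f i)) -> continuous (fun x => \sum_(i | P i) f i x).
Proof.
move=> cf.
have -> : (fun x => \sum_(i | P i) f i x) = \sum_(i | P i) f i.
  by apply/funext => x; rewrite fct_sumE.
elim/big_ind : _ => //; first by move=> x; exact: cst_continuous.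
by move=> g h cg ch x; apply: continuousD; [exact: cg|exact: ch].
Qed.

End PrimitiveExistence.

(** * Continuity, compactness and minima on row vectors *)

Section RowVectors.
Variables (R : realType) (n : nat).
Implicit Types (A : set 'rV[R]_n) (f g : 'rV[R]_n -> R).

Lemma rV_norm_le (v : 'rV[R]_n) (B : R) : 0 <= B ->
  (`|v| <= B) = [forall a, `|v 0 a| <= B].
Proof.
move=> B0; rewrite /Num.norm/= mx_normrE; apply/idP/forallP => [h a|h].
  apply: le_trans h; exact: (le_bigmax _ (fun ij : 'I_1 * 'I_n => `|v ij.1 ij.2|) (0, a)).
by apply: bigmax_le => // -[i a] _; rewrite /= (ord1 i); exact: h.
Qed.

Lemma continuous_rV_sum (F : 'I_n -> 'rV[R]_n -> R) :
  (forall a, continuous (F a)) -> continuous (fun v => \sum_a F a v).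
Proof.
move=> cF; have -> : (fun v => \sum_a F a v) = \sum_a F a.
  by apply/funext => v; rewrite fct_sumE.
elim/big_ind : _ => //; first by move=> x; exact: cst_continuous.
by move=> g h cg ch x; apply: continuousD; [exact: cg|exact: ch].
Qed.

Lemma continuous_rVM f g : continuous f -> continuous g ->
  continuous (fun v => f v * g v).
Proof.
have h (v : 'rV[R]_n) : {for v, continuous f} -> {for v, continuous g} ->
    {for v, continuous (fun v => f v * g v)} by exact: continuousM.
by move=> cf cg v; apply: h; [exact: cf|exact: cg].
Qed.

Lemma continuous_rV_square (c : 'I_n -> R) :
  continuous (fun v : 'rV[R]_n => \sum_a c a * (v 0 a * v 0 a)).
Proof.
apply: (@continuous_rV_sum (fun a v => c a * (v 0 a * v 0 a))) => a.
apply: continuous_rVM; first by move=> v; exact: cst_continuous.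
by apply: continuous_rVM; exact: coord_continuous.
Qed.

Lemma continuous_rV_dot (c : 'I_n -> R) :
  continuous (fun v : 'rV[R]_n => \sum_a v 0 a * c a).
Proof.
apply: (@continuous_rV_sum (fun a v => v 0 a * c a)) => a.
apply: continuous_rVM; first exact: coord_continuous.
by move=> v; exact: cst_continuous.
Qed.

Lemma closed_rV_eq f c : continuous f -> closed [set v | f v = c].
Proof.
by move=> cf; apply: (@preimage_closed _ _ f [set x | x = c]) => //; exact: closed_eq.
Qed.

Lemma unit_rV_compact A : closed A -> (forall v a, A v -> `|v 0 a| <= 1) -> compact A.
Proof.
move=> cA A1; apply: bounded_closed_compact => //.
exists 1; split; first exact: num_real.
move=> M M1 v Av /=; rewrite rV_norm_le ?(le_trans _ (ltW M1))//.
by apply/forallP => a; rewrite (le_trans (A1 v a Av))// ltW.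
Qed.

Lemma rV_near_dist (v : 'rV[R]_n) (d : R) : 0 < d -> \forall u \near v, `|v - u| <= d.
Proof.
move=> d0; have h : (fun u : 'rV[R]_n => u) u @[u --> v] --> v by exact: cvg_id.
by move/cvgrPdist_le : h; exact.
Qed.

(** The estimate is asked on [A] only, because the families minimised later have arbitrary values
    elsewhere; continuity is therefore used in the subspace sense. *)
Lemma rV_min_lipschitz A f (L : R) : A !=set0 -> closed A ->
  (forall v a, A v -> `|v 0 a| <= 1) -> 0 <= L ->
  (forall v v' d, A v -> A v' -> 0 <= d -> (forall a, `|v 0 a - v' 0 a| <= d) ->
     `|f v - f v'| <= L * d) ->
  exists2 c, A c & forall v, A v -> f c <= f v.
Proof.
move=> A0 cA A1 L0 fL.
have [||c + cmin] := @EVT_min_rV R n f A A0 _ _.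
- exact: unit_rV_compact.
- apply/subspace_continuousP => v Av; apply/cvgrPdist_le => e e0.
  have L1 : 0 < L + 1 by rewrite ltr_wpDl.
  have d0 : 0 < e / (L + 1) by rewrite divr_gt0.
  rewrite near_withinE; near=> u => Au.
  have uv : `|v - u| <= e / (L + 1).
    by near: u; exact: rV_near_dist.
  have := fL v u _ Av Au (ltW d0); move: uv; rewrite (rV_norm_le _ (ltW d0)) => /forallP uv h.
  apply: le_trans (h _) _; first by move=> a; have := uv a; rewrite !mxE.
  by rewrite mulrA ler_pdivrMr// mulrC ler_wpM2l ?ltW// ltrDl.
- rewrite inE => Ac; exists c => // v Av; apply: cmin; exact: mem_set.
Unshelve. all: by end_near. Qed.

End RowVectors.

(** * Even periodic functions and the resonant oscillator *)

Section EvenPeriodic.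
Variable R : realType.
Implicit Types (f g : R -> R) (t x w B : R).

(* Brake orbits correspond to functions with the two time reflections
   [t |-> - t] and [t |-> 2 pi - t]; they are determined on [0, pi]. *)
Definition even_periodic f : Prop :=
  [/\ continuous f, forall t, f (- t) = f t & forall t, f (2 * pi - t) = f t].

Lemma even_periodicP f : even_periodic f -> forall t, f (t + 2 * pi) = f t.
Proof.
by move=> [_ f0 f1] t; rewrite -f1 -[RHS]f0; congr f; ring.
Qed.

(** Remove multiples of 2 pi from |t|, then reflect at pi if necessary. The point [s] is independent
    of [f]; bounds need only be proved on [0, pi]. *)
Lemma even_periodic_reduce t : exists2 s, 0 <= s <= pi &
  forall f, even_periodic f -> f t = f s.
Proof.
have pi2 : 0 < 2 * pi :> R by rewrite mulr_gt0// pi_gt0.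
pose n := Num.truncn (`|t| / (2 * pi)); pose u := `|t| - n%:R * (2 * pi).
have t0 : 0 <= `|t| / (2 * pi) by rewrite divr_ge0// ltW.
have u0 : 0 <= u.
  by rewrite subr_ge0 -ler_pdivlMr// truncn_le.
have u1 : u <= 2 * pi.
  have := truncnS_gt (`|t| / (2 * pi)); rewrite -/n ltr_pdivrMr// -natr1 => h.
  by rewrite /u; lra.
have fu f : even_periodic f -> f t = f u.
  move=> ef.
  have fn (k : nat) x : f (x + k%:R * (2 * pi)) = f x.
    elim: k => [|k <-]; first by rewrite mul0r addr0.
    rewrite -[RHS](even_periodicP ef); congr f; rewrite -natr1; ring.
  have -> : f t = f `|t|.
    case: (leP 0 t) => [/ger0_norm ->//|/ltr0_norm ->].
    by case: ef => _ ->.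
  by rewrite -(fn n u); congr f; rewrite /u; ring.
have [up|/ltW up] := leP u pi; first by exists u => //; rewrite u0.
exists (2 * pi - u); first by apply/andP; split; lra.
by move=> f ef; rewrite fu//; case: ef => _ _ ->.
Qed.

Lemma even_periodic_cst (c : R) : even_periodic (fun=> c).
Proof. by split => // x; exact: cst_continuous. Qed.

Lemma even_periodicD f g : even_periodic f -> even_periodic g ->
  even_periodic (fun t => f t + g t).
Proof.
move=> [cf f0 f1] [cg g0 g1]; split; first exact: continuousDf.
- by move=> t; rewrite f0 g0.
- by move=> t; rewrite f1 g1.
Qed.

Lemma even_periodicM f g : even_periodic f -> even_periodic g ->
  even_periodic (fun t => f t * g t).
Proof.
move=> [cf f0 f1] [cg g0 g1]; split; first exact: continuousMf.
- by move=> t; rewrite f0 g0.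
- by move=> t; rewrite f1 g1.
Qed.

Lemma even_periodicZ (k : R) f : even_periodic f -> even_periodic (fun t => k * f t).
Proof. by apply: even_periodicM; exact: even_periodic_cst. Qed.

Lemma even_periodicB f g : even_periodic f -> even_periodic g ->
  even_periodic (fun t => f t - g t).
Proof.
move=> ef eg.
have -> : (fun t => f t - g t) = (fun t => f t + -1 * g t).
  by apply/funext => t; rewrite mulN1r.
by apply: even_periodicD => //; exact: even_periodicZ.
Qed.

Lemma even_periodic_sum (I : finType) (P : pred I) (f : I -> R -> R) :
  (forall i, P i -> even_periodic (f i)) ->
  even_periodic (fun t => \sum_(i | P i) f i t).
Proof.
move=> ef; split.
- by apply: continuous_sumf => i Pi; case: (ef i Pi).
- by move=> t; apply: eq_bigr => i Pi; case: (ef i Pi) => _ ->.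
- by move=> t; apply: eq_bigr => i Pi; case: (ef i Pi) => _ _ ->.
Qed.

Lemma even_periodic_ulim f (F : nat -> R -> R) (b : nat -> R) :
  (forall n, even_periodic (F n)) -> (forall n t, `|F n t - f t| <= b n) ->
  (forall e : R, 0 < e -> exists n, b n < e) -> even_periodic f.
Proof.
move=> eF bF b0.
have lim0 x y : (forall n, F n x = F n y) -> f x = f y.
  move=> e; apply/eqP; rewrite -subr_eq0 -normr_le0; apply/ler_addgt0Pr => d d0.
  have [n bn] := b0 (d / 2) ltac:(lra).
  have -> : f x - f y = (F n y - f y) - (F n x - f x) by rewrite e; ring.
  rewrite (le_trans (ler_normB _ _))//.
  have := bF n x; have := bF n y; lra.
split.
- move=> x; apply/cvgrPdist_lt => e e0.
  have [n bn] := b0 (e / 3) ltac:(lra).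
  have [cF _ _] := eF n.
  have /cvgrPdist_lt/(_ (e / 3) ltac:(lra)) := cF x.
  apply: filterS => y Fy.
  have -> : f x - f y = (F n y - f y) - (F n x - f x) + (F n x - F n y) by ring.
  rewrite (le_lt_trans (ler_normD _ _))//.
  have := ler_normB (F n y - f y) (F n x - f x).
  by have := bF n x; have := bF n y; lra.
- by move=> t; apply: lim0 => n; case: (eF n).
- by move=> t; apply: lim0 => n; case: (eF n).
Qed.

Lemma primB f g : continuous f -> continuous g ->
  forall x, prim (fun t => f t - g t) x = prim f x - prim g x.
Proof.
move=> cf cg x.
have -> : (fun t => f t - g t) = (fun t => f t + -1 * g t).
  by apply/funext => t; rewrite mulN1r.
by rewrite primD// ?primZ// ?mulN1r//; exact: continuousZf.
Qed.

Lemma prim_even f : continuous f -> (forall t, f (- t) = f t) ->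
  forall t, prim f (- t) = - prim f t.
Proof.
move=> cf f0 t; rewrite -[prim f (- t)]opprK; congr (- _).
have h : is_primitive (fun t => - prim f (- t)) f.
  apply: is_primitive_eq (is_primitiveN (is_primitive_comp (is_primitive_prim cf)
    (is_primitiveN (@is_primitive_id R)))) _ => x /=; rewrite f0; ring.
by rewrite [RHS](prim_unique h)// oppr0 prim0// oppr0 subr0.
Qed.

Lemma prim_odd f : continuous f -> (forall t, f (- t) = - f t) ->
  forall t, prim f (- t) = prim f t.
Proof.
move=> cf f0 t.
have h : is_primitive (fun t => prim f (- t)) f.
  apply: is_primitive_eq (is_primitive_comp (is_primitive_prim cf)
    (is_primitiveN (@is_primitive_id R))) _ => x /=; rewrite f0; ring.
by rewrite [RHS](prim_unique h)// oppr0 prim0// subr0.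
Qed.

Lemma is_primitive_sum (I : finType) (P : pred I) (F f : I -> R -> R) :
  (forall i, P i -> is_primitive (F i) (f i)) ->
  is_primitive (fun x => \sum_(i | P i) F i x) (fun x => \sum_(i | P i) f i x).
Proof.
move=> Ff x.
have -> : (fun x => \sum_(i | P i) F i x) = \sum_(i | P i) F i.
  by apply/funext => z; rewrite fct_sumE.
elim/big_ind2 : _ => //; first exact: is_derive_cst.
  by move=> G a H b Ga Hb; exact: is_deriveD.
by move=> i Pi; exact: Ff i Pi x.
Qed.

Definition half_int f : R := prim f pi.

Lemma half_intD f g : continuous f -> continuous g ->
  half_int (fun t => f t + g t) = half_int f + half_int g.
Proof. by move=> cf cg; exact: primD. Qed.

Lemma half_intB f g : continuous f -> continuous g ->
  half_int (fun t => f t - g t) = half_int f - half_int g.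
Proof. by move=> cf cg; exact: primB. Qed.

Lemma half_intZ (k : R) f : continuous f ->
  half_int (fun t => k * f t) = k * half_int f.
Proof. by move=> cf; exact: primZ. Qed.

Lemma half_int_sum (I : finType) (P : pred I) (f : I -> R -> R) :
  (forall i, P i -> continuous (f i)) ->
  half_int (fun t => \sum_(i | P i) f i t) = \sum_(i | P i) half_int (f i).
Proof.
move=> cf; rewrite /half_int.
have h := is_primitive_sum (fun i Pi => is_primitive_prim (cf i Pi)).
rewrite (prim_unique h); last exact: continuous_sumf.
by rewrite [X in _ - X]big1 ?subr0// => i Pi; rewrite prim0//; exact: cf.
Qed.

Lemma half_int_le f B : continuous f -> (forall t, 0 <= t <= pi -> `|f t| <= B) ->
  `|half_int f| <= B * pi.
Proof.
move=> cf fB; have := primitive_le (is_primitive_prim cf) (pi_ge0 R) fB.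
by rewrite prim0// !subr0.
Qed.

Lemma half_int_primitive F f : is_primitive F f -> continuous f ->
  half_int f = F pi - F 0.
Proof. by move=> Ff cf; exact: prim_unique. Qed.

Lemma even_derive0 F f : is_primitive F f -> (forall t, F (- t) = F t) -> f 0 = 0.
Proof.
move=> Ff F0.
have h := is_primitive_comp Ff (is_primitiveN (@is_primitive_id R)).
have [_ e1] := Ff 0; have [_ e2] := h 0.
have : f 0 = f (- 0) * -1.
  by rewrite -e2 -e1; congr (derive _ _ _); apply/funext => t.
by rewrite oppr0 mulrN1 => e; lra.
Qed.

(** The reflection centres 0 and pi are the brake times. Consequently all boundary terms vanish when
    integrating by parts over [0, pi]. *)
Lemma even_periodic_derive0 F f : is_primitive F f -> even_periodic F ->
  f 0 = 0 /\ f pi = 0.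
Proof.
move=> Ff [_ F0 F1]; split; first exact: even_derive0 Ff F0.
have h : is_primitive (fun t => F (pi + t)) (fun t => f (pi + t)).
  apply: is_primitive_eq (is_primitive_comp Ff (is_primitiveD (is_primitive_cst pi)
    (@is_primitive_id R))) _ => x /=; ring.
have := even_derive0 h; rewrite addr0; apply => t.
by rewrite -F1; congr F; ring.
Qed.

Lemma half_int_ibp F F1 F2 G G1 G2 : even_periodic F -> even_periodic G ->
  is_primitive F F1 -> is_primitive F1 F2 -> is_primitive G G1 -> is_primitive G1 G2 ->
  continuous F2 -> continuous G2 ->
  half_int (fun t => F2 t * G t) = half_int (fun t => F t * G2 t).
Proof.
move=> eF eG dF dF1 dG dG1 cF2 cG2.
have cF : continuous F by case: eF. have cG : continuous G by case: eG.
apply/eqP; rewrite -subr_eq0 -half_intB; try exact: continuousMf.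
have h := is_primitiveB (is_primitiveM dF1 dG) (is_primitiveM dF dG1).
rewrite (half_int_primitive (F := fun t => F1 t * G t - F t * G1 t)); first last.
- by apply: continuousBf; exact: continuousMf.
- by apply: is_primitive_eq h _ => t; ring.
have [F0 Fp] := even_periodic_derive0 dF eF.
have [G0 Gp] := even_periodic_derive0 dG eG.
by rewrite F0 Fp G0 Gp !mul0r !mulr0 !subrr.
Qed.

End EvenPeriodic.

(** * The forced oscillator on even periodic functions *)

Section Green.
Variable R : realType.
Implicit Types (f g : R -> R) (t x B : R).

Section Frequency.
Variable w : R.

Definition cosw t : R := cos (w * t).

(** The solution of s'' = - w^2 s with s(0) = 0 and s'(0) = 1. The branch w = 0 lets the kernel
    directions share all formulas with the oscillating ones. *)
Definition sinw t : R := if w == 0 then t else sin (w * t) / w.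

(* Other integers [w] are resonant as well, but never occur: see [freq_nonres]. *)
Definition resonant : bool := (w == 0) || (w == 1).

Lemma is_primitive_wM : is_primitive (fun t => w * t) (fun=> w).
Proof.
by apply: is_primitive_eq (is_primitiveZ w (@is_primitive_id R)) _ => t; rewrite mulr1.
Qed.

Lemma is_primitive_sinw : is_primitive sinw cosw.
Proof.
rewrite /sinw /cosw; case: eqVneq => [->|w0].
  by apply: is_primitive_eq (@is_primitive_id R) _ => t; rewrite mul0r cos0.
have h := is_primitive_comp (fun x => is_derive_sin x) is_primitive_wM.
have -> : (fun t => sin (w * t) / w) = (fun t => w^-1 * sin (w * t)).
  by apply/funext => t; rewrite mulrC.
by apply: is_primitive_eq (is_primitiveZ _ h) _ => t /=; field.
Qed.

Lemma is_primitive_cosw : is_primitive cosw (fun t => - (w ^+ 2 * sinw t)).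
Proof.
have h := is_primitive_comp (fun x => is_derive_cos x) is_primitive_wM.
apply: is_primitive_eq h _ => t; rewrite /sinw; case: eqVneq => [->|w0].
  by rewrite !mul0r sin0 expr0n/=; ring.
by field.
Qed.

Lemma continuous_cosw : continuous cosw.
Proof. exact: is_primitive_continuous is_primitive_cosw. Qed.

Lemma continuous_sinw : continuous sinw.
Proof. exact: is_primitive_continuous is_primitive_sinw. Qed.

Lemma cosw2_sinw2 t : cosw t ^+ 2 + w ^+ 2 * sinw t ^+ 2 = 1.
Proof.
rewrite -[RHS](cos2Dsin2 (w * t)) /cosw /sinw; case: eqVneq => [->|w0].
  by rewrite !mul0r sin0 cos0 expr0n/=; ring.
by field.
Qed.

Lemma coswN t : cosw (- t) = cosw t.
Proof. by rewrite /cosw mulrN cosN. Qed.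

Lemma sinwN t : sinw (- t) = - sinw t.
Proof. by rewrite /sinw; case: eqP => // _; rewrite mulrN sinN mulNr. Qed.

Lemma cosw_le1 t : `|cosw t| <= 1.
Proof. by rewrite ler_norml cos_geN1 cos_le1. Qed.

Lemma sinw0 : sinw 0 = 0.
Proof. by rewrite /sinw; case: eqP => // _; rewrite mulr0 sin0 mul0r. Qed.

Lemma sinw_le t : 0 <= t -> `|sinw t| <= t.
Proof.
move=> t0; have := primitive_le is_primitive_sinw t0 (fun s _ => cosw_le1 s).
by rewrite sinw0 !subr0 mul1r.
Qed.

Lemma resonant_even_periodic : resonant -> even_periodic cosw.
Proof.
move=> rw; split; [exact: continuous_cosw|exact: coswN|move=> t].
rewrite /cosw; case/orP : rw => /eqP ->; first by rewrite !mul0r.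
by rewrite !mul1r addrC -mulr_natl mulr1 -[RHS]cosN -(cosD2pi (- t)) mulr_natl.
Qed.

Lemma resonant_sin : resonant -> w ^+ 2 * sinw pi = 0.
Proof.
rewrite /sinw => /orP[/eqP ->|/eqP ->]; first by rewrite expr0n/= mul0r.
by rewrite oner_eq0 mul1r sinpi mul0r mulr0.
Qed.

Definition cosw_mass : R := if w == 0 then pi else pi / 2.

Lemma cosw_mass_gt0 : 0 < cosw_mass.
Proof. by rewrite /cosw_mass; case: ifP => _; rewrite ?divr_gt0 ?pi_gt0. Qed.

Lemma half_int_cosw2 : resonant -> half_int (fun t => cosw t * cosw t) = cosw_mass.
Proof.
have ccc := continuousMf continuous_cosw continuous_cosw.
rewrite /resonant /cosw_mass; have [w0 _|w0 /= /eqP w1] := eqVneq w 0.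
  rewrite (half_int_primitive (F := fun t => t)) ?subr0//.
  apply: is_primitive_eq (@is_primitive_id R) _ => t.
  by rewrite /cosw w0 mul0r cos0 mulr1.
rewrite (half_int_primitive (F := fun t => 2^-1 * (t + sinw t * cosw t)))//.
  have : sinw pi = 0 by have := resonant_sin; rewrite /resonant w1 eqxx orbT expr1n mul1r; apply.
  by move=> ->; rewrite sinw0; field.
have h := is_primitiveD (@is_primitive_id R)
  (is_primitiveM is_primitive_sinw is_primitive_cosw).
apply: is_primitive_eq (is_primitiveZ _ h) _ => t.
by have := cosw2_sinw2 t; rewrite w1 expr1n !mul1r => e; rewrite -[X in X + _]e; field.
Qed.

(** The Fourier coefficient along the resonant mode. The value 0 at a non-resonant frequency makes
    [cos_reduce] the identity there, so later formulas need no case distinction. *)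
Definition cos_coef f : R :=
  if resonant then half_int (fun t => cosw t * f t) / cosw_mass else 0.

Lemma cos_coefD f g : continuous f -> continuous g ->
  cos_coef (fun t => f t + g t) = cos_coef f + cos_coef g.
Proof.
move=> cf cg; rewrite /cos_coef; case: ifP => _; last by rewrite addr0.
rewrite -mulrDl -half_intD; try by apply: continuousMf => //; exact: continuous_cosw.
by congr (half_int _ / _); apply/funext => t; rewrite mulrDr.
Qed.

Lemma cos_coefZ (k : R) f : continuous f ->
  cos_coef (fun t => k * f t) = k * cos_coef f.
Proof.
move=> cf; rewrite /cos_coef; case: ifP => _; last by rewrite mulr0.
rewrite mulrA -half_intZ; last by apply: continuousMf => //; exact: continuous_cosw.
by congr (half_int _ / _); apply/funext => t; rewrite mulrCA.
Qed.

Lemma cos_coefB f g : continuous f -> continuous g ->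
  cos_coef (fun t => f t - g t) = cos_coef f - cos_coef g.
Proof.
move=> cf cg; rewrite -mulN1r -cos_coefZ// -cos_coefD//.
  by congr cos_coef; apply/funext => t; rewrite mulN1r.
exact: continuousZf.
Qed.

Lemma cos_coef_cosw : resonant -> cos_coef cosw = 1.
Proof.
by move=> rw; rewrite /cos_coef rw half_int_cosw2// divff// gt_eqF// cosw_mass_gt0.
Qed.

Lemma cos_coef_le f B : continuous f -> (forall t, 0 <= t <= pi -> `|f t| <= B) ->
  `|cos_coef f| <= 2 * B.
Proof.
move=> cf fB; have B0 : 0 <= B by apply: le_trans (fB 0 _); rewrite ?lexx ?pi_ge0.
rewrite /cos_coef; case: ifP => _; last by rewrite normr0 mulr_ge0.
rewrite normrM normfV (gtr0_norm cosw_mass_gt0) ler_pdivrMr ?cosw_mass_gt0//.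
apply: (@le_trans _ _ (B * pi)).
  apply: half_int_le; first by apply: continuousMf => //; exact: continuous_cosw.
  by move=> t tp; rewrite normrM (le_trans _ (fB t tp))// ler_piMl// cosw_le1.
have := pi_gt0 R => p0; rewrite /cosw_mass; case: ifP => _; nra.
Qed.

Definition cos_reduce f t : R := f t - cos_coef f * cosw t.

(** Variation of constants: the integral of [sinw (t - s)] against [cos_reduce f] over [0, t], split
    by the addition formula. It solves the forced equation with zero data at 0. *)
Definition green_part f t : R :=
  sinw t * prim (fun s => cosw s * cos_reduce f s) t
  - cosw t * prim (fun s => sinw s * cos_reduce f s) t.

Definition green_part' f t : R :=
  cosw t * prim (fun s => cosw s * cos_reduce f s) t
  + w ^+ 2 * (sinw t * prim (fun s => sinw s * cos_reduce f s) t).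

(** The multiple of [cosw] still free in an even solution. Without resonance it makes the derivative
    vanish at pi. At resonance that derivative already vanishes, since the resonant mode was removed
    from [f], and the freedom serves to make [cos_coef (green f)] zero. *)
Definition green_coef f : R :=
  if resonant then - cos_coef (green_part f)
  else green_part' f pi / (w ^+ 2 * sinw pi).

Definition green f t : R := green_coef f * cosw t + green_part f t.

Definition green' f t : R := - green_coef f * (w ^+ 2 * sinw t) + green_part' f t.

Hypothesis w_nonres : resonant \/ w ^+ 2 * sinw pi != 0.

Lemma cos_coef_nonres f : ~~ resonant -> cos_coef f = 0.
Proof. by rewrite /cos_coef => /negbTE ->. Qed.

Lemma even_periodic_cos_reduce f : even_periodic f -> even_periodic (cos_reduce f).
Proof.
move=> ef; have [rw|rw] := boolP resonant.
  apply: even_periodicB => //; apply: even_periodicZ.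
  exact: resonant_even_periodic.
have -> // : cos_reduce f = f.
by apply/funext => t; rewrite /cos_reduce cos_coef_nonres// mul0r subr0.
Qed.

Lemma continuous_cos_reduce f : continuous f -> continuous (cos_reduce f).
Proof.
by move=> cf; apply: continuousBf => //; apply: continuousZf; exact: continuous_cosw.
Qed.

Let ccr f : continuous f -> continuous (fun s => cosw s * cos_reduce f s).
Proof.
move=> cf; apply: continuousMf; first exact: continuous_cosw.
exact: continuous_cos_reduce.
Qed.

Let csr f : continuous f -> continuous (fun s => sinw s * cos_reduce f s).
Proof.
move=> cf; apply: continuousMf; first exact: continuous_sinw.
exact: continuous_cos_reduce.
Qed.

Lemma is_primitive_green_part f : continuous f ->
  is_primitive (green_part f) (green_part' f).
Proof.
move=> cf.
have h1 := is_primitiveM is_primitive_sinw (is_primitive_prim (ccr cf)).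
have h2 := is_primitiveM is_primitive_cosw (is_primitive_prim (csr cf)).
by apply: is_primitive_eq (is_primitiveB h1 h2) _ => t; rewrite /green_part'; ring.
Qed.

Lemma is_primitive_green_part' f : continuous f ->
  is_primitive (green_part' f) (fun t => cos_reduce f t - w ^+ 2 * green_part f t).
Proof.
move=> cf.
have h1 := is_primitiveM is_primitive_cosw (is_primitive_prim (ccr cf)).
have h2 := is_primitiveM is_primitive_sinw (is_primitive_prim (csr cf)).
apply: is_primitive_eq (is_primitiveD h1 (is_primitiveZ (w ^+ 2) h2)) _ => t.
rewrite /green_part -[X in X - _]mul1r -(cosw2_sinw2 t); ring.
Qed.

Lemma continuous_green_part f : continuous f -> continuous (green_part f).
Proof. by move/is_primitive_green_part/is_primitive_continuous. Qed.

Lemma is_primitive_green f : continuous f -> is_primitive (green f) (green' f).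
Proof.
move=> cf.
apply: is_primitive_eq (is_primitiveD (is_primitiveZ (green_coef f) is_primitive_cosw)
  (is_primitive_green_part cf)) _ => t; rewrite /green'; ring.
Qed.

Lemma is_primitive_green' f : continuous f ->
  is_primitive (green' f) (fun t => cos_reduce f t - w ^+ 2 * green f t).
Proof.
move=> cf.
apply: is_primitive_eq (is_primitiveD (is_primitiveZ (- green_coef f)
  (is_primitiveZ (w ^+ 2) is_primitive_sinw)) (is_primitive_green_part' cf)) _ => t.
rewrite /green; ring.
Qed.

Lemma half_int_cosw_reduce f : continuous f -> resonant ->
  half_int (fun t => cosw t * cos_reduce f t) = 0.
Proof.
move=> cf rw.
have ccf := continuousMf continuous_cosw cf.
have ccc := continuousMf continuous_cosw continuous_cosw.
have -> : (fun t => cosw t * cos_reduce f t) =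
    (fun t => cosw t * f t - cos_coef f * (cosw t * cosw t)).
  by apply/funext => t; rewrite /cos_reduce; ring.
rewrite half_intB//; last exact: continuousZf.
rewrite half_intZ// half_int_cosw2// /cos_coef rw divfK ?subrr//.
by rewrite gt_eqF// cosw_mass_gt0.
Qed.

Lemma green'_pi f : continuous f -> green' f pi = 0.
Proof.
move=> cf; rewrite /green'.
have [rw|rw] := boolP resonant.
  rewrite resonant_sin// mulr0 add0r /green_part' mulrA resonant_sin// mul0r addr0.
  by rewrite -/(half_int _) half_int_cosw_reduce// mulr0.
rewrite /green_coef (negbTE rw) mulNr divfK ?addNr//.
by case: w_nonres => // h; rewrite h in rw.
Qed.

(* The energy [F'^2 + w^2 F^2] is constant. *)
Lemma oscillator_unique F F1 x : is_primitive F F1 ->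
  is_primitive F1 (fun t => - (w ^+ 2 * F t)) -> F x = 0 -> F1 x = 0 ->
  forall t, F t = 0.
Proof.
move=> dF dF1 F0 F10.
pose E t := F1 t * F1 t + w ^+ 2 * (F t * F t).
have dE : is_primitive E (fun=> 0).
  apply: is_primitive_eq (is_primitiveD (is_primitiveM dF1 dF1)
    (is_primitiveZ (w ^+ 2) (is_primitiveM dF dF))) _ => t; ring.
have E0 t : E t = 0.
  by rewrite (is_primitive0_cst t x dE) /E F0 F10; ring.
have F1t t : F1 t = 0.
  have := E0 t; rewrite /E -!expr2 -exprMn => /eqP.
  by rewrite paddr_eq0 ?sqr_ge0// sqrf_eq0 => /andP[/eqP].
move=> t; rewrite -F0; apply: is_primitive0_cst.
exact: is_primitive_eq dF F1t.
Qed.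

(** Evenness is read off the formula. For the reflection at pi, the difference of [green f] and its
    reflected copy solves the homogeneous equation and has zero data at pi by [green'_pi], so it
    vanishes by uniqueness. *)
Lemma even_periodic_green f : even_periodic f -> even_periodic (green f).
Proof.
move=> ef; have [cf f0 f1] := ef; have [cr r0 r1] := even_periodic_cos_reduce ef.
split; first exact: is_primitive_continuous (is_primitive_green cf).
- move=> t; rewrite /green coswN /green_part coswN sinwN.
  rewrite (prim_even (ccr cf)); last by move=> s; rewrite coswN r0.
  rewrite (prim_odd (csr cf)); last by move=> s; rewrite sinwN r0 mulNr.
  by rewrite mulrNN.
- have h0 := is_primitiveB (is_primitive_cst (2 * pi)) (@is_primitive_id R).
  have h1 := is_primitive_comp (is_primitive_green cf) h0.
  have h2 := is_primitive_comp (is_primitive_green' cf) h0.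
  have d1 : is_primitive (fun t => green f (2 * pi - t) - green f t)
                         (fun t => - green' f (2 * pi - t) - green' f t).
    by apply: is_primitive_eq (is_primitiveB h1 (is_primitive_green cf)) _ => t; ring.
  have d2 : is_primitive (fun t => - green' f (2 * pi - t) - green' f t)
              (fun t => - (w ^+ 2 * (green f (2 * pi - t) - green f t))).
    apply: is_primitive_eq (is_primitiveB (is_primitiveN h2) (is_primitive_green' cf)) _.
    by move=> t; rewrite r1; ring.
  have e : 2 * pi - pi = pi :> R by ring.
  move=> t; apply/eqP; rewrite -subr_eq0; apply/eqP.
  apply: (oscillator_unique (x := pi) d1 d2); rewrite e ?subrr//.
  by rewrite green'_pi// oppr0 addr0.
Qed.

Lemma cos_coef_green f : continuous f -> cos_coef (green f) = 0.
Proof.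
move=> cf; have [rw|rw] := boolP resonant; last exact: cos_coef_nonres.
rewrite cos_coefD; first last.
- exact: continuous_green_part.
- by apply: continuousZf; exact: continuous_cosw.
rewrite cos_coefZ; last exact: continuous_cosw.
by rewrite cos_coef_cosw// /green_coef rw mulr1 addNr.
Qed.

Lemma cos_reduceB f g : continuous f -> continuous g ->
  cos_reduce (fun t => f t - g t) = (fun t => cos_reduce f t - cos_reduce g t).
Proof. by move=> cf cg; apply/funext => t; rewrite /cos_reduce cos_coefB//; ring. Qed.

Lemma green_partsB f g : continuous f -> continuous g ->
  (forall t, green_part (fun t => f t - g t) t = green_part f t - green_part g t) /\
  (forall t, green_part' (fun t => f t - g t) t = green_part' f t - green_part' g t).
Proof.
move=> cf cg; rewrite /green_part /green_part' cos_reduceB//.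
have -> : (fun s => cosw s * (cos_reduce f s - cos_reduce g s)) =
  (fun s => cosw s * cos_reduce f s - cosw s * cos_reduce g s).
  by apply/funext => s; rewrite mulrBr.
have -> : (fun s => sinw s * (cos_reduce f s - cos_reduce g s)) =
  (fun s => sinw s * cos_reduce f s - sinw s * cos_reduce g s).
  by apply/funext => s; rewrite mulrBr.
have e1 := primB (ccr cf) (ccr cg); have e2 := primB (csr cf) (csr cg).
by split=> t; rewrite e1 e2; ring.
Qed.

Lemma greenB f g : continuous f -> continuous g ->
  forall t, green (fun t => f t - g t) t = green f t - green g t.
Proof.
move=> cf cg t; have [e1 e2] := green_partsB cf cg; rewrite /green e1.
suff -> : green_coef (fun t => f t - g t) = green_coef f - green_coef g by ring.
rewrite /green_coef; case: ifP => _; last by rewrite e2 mulrBl.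
rewrite [X in cos_coef X](_ : _ = fun t => green_part f t - green_part g t).
  by rewrite cos_coefB; [ring|exact: continuous_green_part..].
exact/funext.
Qed.

(** The primitives in [green] may grow with t, so the bound is proved on [0, pi] and carried over by
    the symmetries. There [P] controls the particular solution, [P'] its derivative at pi, and [M]
    the reciprocal of the denominator in [green_coef]. *)
Lemma green_le : exists2 K, 0 <= K & forall f B, even_periodic f ->
  (forall t, `|f t| <= B) -> forall t, `|green f t| <= K * B.
Proof.
have p0 := pi_gt0 R.
pose M := 1 + `|(w ^+ 2 * sinw pi)^-1|.
pose P : R := 6 * pi ^+ 2; pose P' : R := 3 * pi + w ^+ 2 * (3 * pi ^+ 3).
have P0 : 0 <= P by rewrite /P mulr_ge0// exprn_ge0// ltW.
have P'0 : 0 <= P'.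
  rewrite /P'; apply: addr_ge0; first by rewrite mulr_ge0// ltW.
  by rewrite mulr_ge0 ?sqr_ge0// mulr_ge0// exprn_ge0// ltW.
exists (2 * P + P' * M + P).
  have M0 : 0 <= M by rewrite addr_ge0.
  by apply: addr_ge0 => //; apply: addr_ge0; apply: mulr_ge0.
move=> f B ef fB.
have B0 : 0 <= B by exact: le_trans (fB 0).
have [cf _ _] := ef.
have rB t : `|cos_reduce f t| <= 3 * B.
  rewrite /cos_reduce (le_trans (ler_normB _ _))//.
  have h1 := cos_coef_le cf (fun t _ => fB t); have h2 := cosw_le1 t.
  rewrite normrM; have := fB t.
  have : `|cos_coef f| * `|cosw t| <= 2 * B * 1 by apply: ler_pM.
  lra.
have C1 t : 0 <= t <= pi -> `|prim (fun s => cosw s * cos_reduce f s) t| <= 3 * B * pi.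
  move=> /andP[t0 tp]; apply: (@le_trans _ _ (3 * B * t)).
    apply: prim_le => // [|s]; first exact: ccr.
    by rewrite normrM -[leRHS]mul1r ler_pM// cosw_le1.
  by rewrite ler_wpM2l// mulr_ge0.
have C2 t : 0 <= t <= pi ->
    `|prim (fun s => sinw s * cos_reduce f s) t| <= pi * (3 * B) * pi.
  move=> /andP[t0 tp]; have := primitive_le (is_primitive_prim (csr cf)) t0.
  rewrite prim0; last exact: csr.
  rewrite !subr0 => /(_ (pi * (3 * B))) h; apply: le_trans (h _) _.
    move=> s /andP[s0 st]; rewrite normrM ler_pM//.
    by apply: le_trans (sinw_le s0) _; exact: le_trans tp.
  by rewrite ler_wpM2l// mulr_ge0// ?mulr_ge0// ltW.
have S1 t : 0 <= t <= pi -> `|sinw t| <= pi.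
  by move=> /andP[t0 tp]; exact: le_trans (sinw_le t0) tp.
have PB t : 0 <= t <= pi -> `|green_part f t| <= P * B.
  move=> tp; rewrite /green_part (le_trans (ler_normB _ _))// !normrM.
  have -> : P * B = pi * (3 * B * pi) + 1 * (pi * (3 * B) * pi) by rewrite /P; ring.
  by rewrite lerD// ler_pM// ?C1 ?C2 ?S1 ?cosw_le1.
have P'B : `|green_part' f pi| <= P' * B.
  have pp : 0 <= (pi : R) <= pi by rewrite lexx ltW.
  rewrite /green_part' (le_trans (ler_normD _ _))// !normrM.
  have -> : P' * B = 1 * (3 * B * pi) + w ^+ 2 * (pi * (pi * (3 * B) * pi)).
    by rewrite /P'; ring.
  apply: lerD; first by apply: ler_pM => //; [exact: cosw_le1|exact: C1].
  rewrite -[X in X * _ <= _]normrM -expr2 (ger0_norm (sqr_ge0 w)); apply: ler_wpM2l; first exact: sqr_ge0.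
  by apply: ler_pM => //; [exact: S1|exact: C2].
have GC : `|green_coef f| <= (2 * P + P' * M) * B.
  have M0 : 0 <= M by rewrite addr_ge0.
  have P'M : 0 <= P' * M * B by rewrite mulr_ge0// mulr_ge0.
  have PB0 : 0 <= 2 * (P * B) by rewrite mulr_ge0// mulr_ge0.
  rewrite mulrDl -[X in _ <= X + _]mulrA /green_coef; case: ifP => _.
    rewrite normrN (le_trans (cos_coef_le (continuous_green_part cf) PB))//.
    by rewrite lerDl.
  rewrite normrM; apply: (@le_trans _ _ (P' * B * M)).
    by rewrite ler_pM // /M lerDr.
  by rewrite mulrAC lerDr.
move=> t; have [s sp ->//] := even_periodic_reduce t; last exact: even_periodic_green.
rewrite /green (le_trans (ler_normD _ _))// mulrDl lerD ?PB// normrM.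
by rewrite -[leRHS]mulr1 ler_pM// cosw_le1.
Qed.

End Frequency.

End Green.

(** * The reduction to the resonant sphere *)

Section Contraction.
Variables (R : realType) (X : Type) (S : set (X -> R)) (Phi : (X -> R) -> X -> R).

(** The tail from n on of the series with terms 2 / 2^k: two elements of [S] differ by at most 2,
    and each iteration halves distances. *)
Let b (n : nat) : R := 4 / 2 ^+ n.

Let b_ge0 n : 0 <= b n.
Proof. by rewrite /b divr_ge0// exprn_ge0. Qed.

Lemma pow2_small (e : R) : 0 < e -> exists n, b n < e.
Proof.
move=> e0; pose n := Num.truncn (4 / e); exists n.
rewrite /b ltr_pdivrMr ?exprn_gt0// mulrC -ltr_pdivrMr//.
apply: lt_le_trans (truncnS_gt _) _; rewrite -natrX ler_nat.
exact: ltn_expl.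
Qed.

Hypothesis S_bound : forall f x, S f -> `|f x| <= 1.
Hypothesis S_closed : forall (F : nat -> X -> R) f, (forall n, S (F n)) ->
  (forall n x, `|F n x - f x| <= b n) -> S f.
Hypothesis S_Phi : forall f, S f -> S (Phi f).
Hypothesis Phi_contr : forall f g D, S f -> S g ->
  (forall x, `|f x - g x| <= D) -> forall x, `|Phi f x - Phi g x| <= D / 2.

(* The limit is written as a supremum, so that no completeness of a function
   space is needed. *)
Lemma contraction_fixpoint f0 : S f0 -> exists2 f, S f & Phi f = f.
Proof.
move=> Sf0; pose F n := iter n Phi f0.
have SF n : S (F n) by elim: n => [|n IH] //=; exact: S_Phi.
have F1 n x : `|F n.+1 x - F n x| <= 2 / 2 ^+ n.
  elim: n x => [|n IH] x.
    rewrite expr0 divr1 (le_trans (ler_normB _ _))//.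
    have := S_bound x (SF 1%N); have := S_bound x (SF 0%N); lra.
  have := Phi_contr (SF n.+1) (SF n) IH x; rewrite /= => h.
  by rewrite exprSr invfM mulrA.
have Fk m k x : `|F (m + k)%N x - F m x| <= b m - b (m + k)%N.
  elim: k => [|k IH]; first by rewrite addn0 !subrr normr0.
  have -> : F (m + k.+1)%N x - F m x =
    (F (m + k).+1 x - F (m + k)%N x) + (F (m + k)%N x - F m x).
    by rewrite addnS; ring.
  have := F1 (m + k)%N x; have p : 0 < 2 ^+ (m + k) :> R by rewrite exprn_gt0.
  have -> : b (m + k.+1)%N = b (m + k)%N - 2 / 2 ^+ (m + k)%N.
    by rewrite /b addnS exprS; field; rewrite gt_eqF.
  by have := ler_normD (F (m + k).+1 x - F (m + k)%N x) (F (m + k)%N x - F m x); lra.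
have FF m k x : F m x - b m <= F k x + b k.
  have bm := b_ge0 m; have bk := b_ge0 k.
  case: (leqP m k) => [mk|/ltnW km].
    have := Fk m (k - m)%N x; rewrite subnKC// ler_norml => /andP[]; lra.
  have := Fk k (m - k)%N x; rewrite subnKC// ler_norml => /andP[]; lra.
(* [FF] puts every F m x - b m below every F k x + b k, so the supremum of the former stays within b
   n of F n x for all n at once. *)
pose A x := [set F n x - b n | n in [set: nat]].
pose f x := sup (A x).
have ub x k : ubound (A x) (F k x + b k) by move=> _ [m _ <-]; exact: FF.
have Ff n x : `|F n x - f x| <= b n.
  rewrite ler_norml; apply/andP; split.
  - rewrite lerBrDr addrC; have : f x <= F n x + b n; last by lra.
    apply: ge_sup; last exact: ub.
    by exists (F 0%N x - b 0%N); exists 0%N.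
  - have : F n x - b n <= f x; last by lra.
    apply: ub_le_sup; last by exists n.
    by exists (F 0%N x + b 0%N); exact: ub.
have Sf : S f by apply: S_closed Ff.
exists f => //; apply/funext => x; apply/eqP; rewrite -subr_eq0 -normr_le0.
apply/ler_addgt0Pr => e e0; have [n bn] := pow2_small (e := e / 2) ltac:(lra).
have h1 := Phi_contr Sf (SF n) (fun y => (_ : `|f y - F n y| <= b n)) x.
have h2 := Ff n.+1 x.
have -> : Phi f x - f x = (Phi f x - Phi (F n) x) + (F n.+1 x - f x).
  by rewrite /=; ring.
have b1 : b n.+1 <= b n.
  rewrite /b exprS ler_pM2l// lef_pV2 ?posrE ?mulr_gt0 ?exprn_gt0//.
  by rewrite ler_peMl ?exprn_ge0// ler1n.
have bn0 := b_ge0 n.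
have h3 : `|Phi f x - Phi (F n) x| <= b n / 2 by apply: h1 => y; rewrite distrC.
have := ler_normD (Phi f x - Phi (F n) x) (F n.+1 x - f x); lra.
Qed.

End Contraction.

(** * Blow-up, fixed point and variational elimination of the defect *)

Section Core.
Variables (R : realType) (n : nat).
Notation vec := ('I_n -> R).

(** Models x'' = - (freq^2 x + force x). The Lipschitz constant of [force] shrinks with the radius,
    which expresses quadratic vanishing. [pot_taylor] says that [force] is the gradient of [pot], in
    the quantitative form consumed by [kin_compare] and without derivatives in several variables. *)
Record perturbation := Perturbation {
  freq : vec;
  pot : vec -> R;
  force : vec -> vec;
  pert_cst : R;
  pert_radius : R;
  pert_cst_ge0 : 0 <= pert_cst;
  pert_radius_gt0 : 0 < pert_radius;
  freq_nonres : forall a, resonant (freq a) \/ freq a ^+ 2 * sinw (freq a) pi != 0;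
  pot0 : pot (fun=> 0) = 0;
  force0 : forall a, force (fun=> 0) a = 0;
  force_lip : forall (x x' : vec) (e d : R), e <= pert_radius ->
    (forall a, `|x a| <= e) -> (forall a, `|x' a| <= e) ->
    (forall a, `|x a - x' a| <= d) ->
    forall a, `|force x a - force x' a| <= pert_cst * e * d;
  pot_taylor : forall (x x' : vec) (e d : R), e <= pert_radius ->
    (forall a, `|x a| <= e) -> (forall a, `|x' a| <= e) ->
    (forall a, `|x' a - x a| <= d) ->
    `|pot x' - pot x - \sum_a force x a * (x' a - x a)| <= pert_cst * e * d ^+ 2 }.

Variable p : perturbation.
Local Notation w := (freq p).
Local Notation C0 := (pert_cst p).
Local Notation r0 := (pert_radius p).

Let C0_ge0 := pert_cst_ge0 p.
Let r0_gt0 := pert_radius_gt0 p.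

(** All unknowns, namely the functions [wcomp] and the numbers [kcomp] and [scomp], form one real
    function on a sum type, so that a single contraction in the sup norm solves for them
    together. *)
Definition state := (R * 'I_n + bool)%type -> R.
Definition wcomp (Z : state) (a : 'I_n) (t : R) : R := Z (inl (t, a)).
Definition kcomp (Z : state) : R := Z (inr true).
Definition scomp (Z : state) : R := Z (inr false).

Definition unit_state : set state :=
  [set Z | (forall x, `|Z x| <= 1) /\ forall a, even_periodic (wcomp Z a)].

Definition pt := (state * vec)%type.
Definition admissible (P : pt) := unit_state P.1 /\ forall a, `|P.2 a| <= 1.
Definition near_pt (P P' : pt) (D : R) :=
  (forall x, `|P.1 x - P'.1 x| <= D) /\ forall a, `|P.2 a - P'.2 a| <= D.

Lemma near_pt_ge0 P P' D : near_pt P P' D -> 0 <= D.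
Proof. by move=> [h _]; apply: le_trans (h (inr true)). Qed.

(* The blow-up scales are [x = mu^3 y], [Lambda = 1 + mu^2 k] and
   [y = (1 + mu s) v cos t + mu w]; then every term of the fixed point map
   carries a factor [mu]. *)
Variable mu1 : R.
Hypothesis mu1_le1 : mu1 <= 1.
Hypothesis mu1_r0 : 3 * mu1 <= r0.

(** Bounded and Lipschitz in the point, uniformly in [mu] and [t]. The class is closed under the
    operations that build the fixed point map, so its contraction estimate is obtained by
    composition, without tracking constants. *)
Definition tame (f : R -> R -> pt -> R) := exists2 C : R, 0 <= C &
  forall (mu t : R) P P' (D : R), 0 < mu <= mu1 -> admissible P -> admissible P' ->
    near_pt P P' D -> `|f mu t P| <= C /\ `|f mu t P - f mu t P'| <= C * D.

Lemma tame_eq f g : tame f -> (forall mu t P, f mu t P = g mu t P) -> tame g.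
Proof.
move=> [C C_ge0 fC] fg; exists C => // mu t P P' D hmu hP hP' hD.
by rewrite -!fg; exact: fC.
Qed.

Lemma tame_cst (f : R -> R -> R) C : (forall mu t, 0 < mu <= mu1 -> `|f mu t| <= C) ->
  tame (fun mu t _ => f mu t).
Proof.
move=> fC; exists (Num.max C 0); first by rewrite le_max lexx orbT.
move=> mu t P P' D hmu _ _ /near_pt_ge0 D0.
by rewrite subrr normr0 mulr_ge0 ?le_max ?lexx ?orbT// fC.
Qed.

Lemma tame_k (c : R) : tame (fun _ _ _ => c).
Proof. by apply: (@tame_cst (fun _ _ => c) `|c|). Qed.

Lemma tame_mu : tame (fun mu _ _ => mu).
Proof.
apply: (@tame_cst (fun mu _ => mu) 1) => mu _ /andP[m0 m1].
by rewrite gtr0_norm// (le_trans m1).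
Qed.

Lemma tame_cosw (u : R) : tame (fun _ t _ => cosw u t).
Proof. by apply: (@tame_cst (fun _ t => cosw u t) 1) => mu t _; exact: cosw_le1. Qed.

Lemma tame_v a : tame (fun _ _ P => P.2 a).
Proof.
exists 1 => // mu t P P' D _ [_ vP] _ [_ vD]; rewrite mul1r.
by split; [exact: vP|exact: vD].
Qed.

Lemma tame_Z (x : R -> _) : tame (fun _ t P => P.1 (x t)).
Proof.
exists 1 => // mu t P P' D _ [[ZP _] _] _ [ZD _]; rewrite mul1r.
by split; [exact: ZP|exact: ZD].
Qed.

Lemma tameD f g : tame f -> tame g -> tame (fun mu t P => f mu t P + g mu t P).
Proof.
move=> [C c0 fC] [C' c0' gC]; exists (C + C'); first exact: addr_ge0.
move=> mu t P P' D hmu hP hP' hD.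
have [f1 f2] := fC mu t P P' D hmu hP hP' hD.
have [g1 g2] := gC mu t P P' D hmu hP hP' hD.
split; first by rewrite (le_trans (ler_normD _ _))// lerD.
rewrite opprD addrACA mulrDl.
by rewrite (le_trans (ler_normD _ _))// lerD.
Qed.

Lemma tameM f g : tame f -> tame g -> tame (fun mu t P => f mu t P * g mu t P).
Proof.
move=> [C c0 fC] [C' c0' gC]; exists (C * C' + C' * C); first by rewrite addr_ge0 ?mulr_ge0.
move=> mu t P P' D hmu hP hP' hD; have D0 := near_pt_ge0 hD.
have [f1 f2] := fC mu t P P' D hmu hP hP' hD.
have [g1 g2] := gC mu t P P' D hmu hP hP' hD.
have hD' : near_pt P' P' 0.
  by split=> x; rewrite subrr normr0.
have [f3 _] := fC mu t P' P' 0 hmu hP' hP' hD'.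
split.
  by rewrite normrM (le_trans (ler_pM _ _ f1 g1))// lerDl mulr_ge0.
have -> : f mu t P * g mu t P - f mu t P' * g mu t P' =
  f mu t P' * (g mu t P - g mu t P') + g mu t P * (f mu t P - f mu t P') by ring.
rewrite (le_trans (ler_normD _ _))// mulrDl !normrM.
by apply: lerD; rewrite -mulrA; apply: ler_pM.
Qed.

Lemma tameZ (c : R) f : tame f -> tame (fun mu t P => c * f mu t P).
Proof. by apply: tameM; exact: tame_k. Qed.

Lemma tameN f : tame f -> tame (fun mu t P => - f mu t P).
Proof. by move=> tf; apply: tame_eq (tameZ (-1) tf) _ => *; rewrite mulN1r. Qed.

Lemma tame_unif (f : 'I_n -> R -> R -> pt -> R) : (forall a, tame (f a)) ->
  exists2 C : R, 0 <= C & forall a (mu t : R) P P' (D : R), 0 < mu <= mu1 ->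
    admissible P -> admissible P' -> near_pt P P' D ->
    `|f a mu t P| <= C /\ `|f a mu t P - f a mu t P'| <= C * D.
Proof.
move=> tf; have /choice[C hC] : forall a, exists C : R, 0 <= C /\
    forall (mu t : R) P P' (D : R), 0 < mu <= mu1 -> admissible P -> admissible P' ->
    near_pt P P' D -> `|f a mu t P| <= C /\ `|f a mu t P - f a mu t P'| <= C * D.
  by move=> a; have [C C_ge0 h] := tf a; exists C.
exists (\sum_a C a); first by apply: sumr_ge0 => a _; case: (hC a).
move=> a mu t P P' D hmu hP hP' hD; have D0 := near_pt_ge0 hD.
have Ca : C a <= \sum_a C a.
  by rewrite (bigD1 a)//= lerDl; apply: sumr_ge0 => b _; case: (hC b).
have [_ /(_ mu t P P' D hmu hP hP' hD) [h1 h2]] := hC a.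
by split; [exact: le_trans Ca|rewrite (le_trans h2)// ler_wpM2r].
Qed.

Lemma tame_sum (f : 'I_n -> R -> R -> pt -> R) :
  (forall a, tame (f a)) -> tame (fun mu t P => \sum_a f a mu t P).
Proof.
move=> /tame_unif[C C_ge0 hC]; exists (\sum_(a < n) C); first exact: sumr_ge0.
move=> mu t P P' D hmu hP hP' hD; split.
  apply: le_trans (ler_norm_sum _ _ _) _; apply: ler_sum => a _.
  by have [] := hC a mu t P P' D hmu hP hP' hD.
rewrite -sumrB mulr_suml; apply: le_trans (ler_norm_sum _ _ _) _; apply: ler_sum => a _.
by have [] := hC a mu t P P' D hmu hP hP' hD.
Qed.

Definition tame_per (f : R -> R -> pt -> R) := tame f /\
  forall mu P, 0 < mu <= mu1 -> admissible P -> even_periodic (fun t => f mu t P).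

Lemma tame_cos_coef u f : tame_per f ->
  tame (fun mu _ P => cos_coef u (fun t => f mu t P)).
Proof.
move=> [[C c0 fC] ef]; exists (2 * C); first by rewrite mulr_ge0.
move=> mu t P P' D hmu hP hP' hD.
have [cf _ _] := ef mu P hmu hP. have [cf' _ _] := ef mu P' hmu hP'.
split; first by apply: cos_coef_le => // s _; case: (fC mu s P P' D).
rewrite -cos_coefB// -mulrA; apply: cos_coef_le; first exact: continuousBf.
by move=> s _; case: (fC mu s P P' D).
Qed.

Lemma tame_half_int f : tame_per f ->
  tame (fun mu _ P => half_int (fun t => f mu t P)).
Proof.
move=> [[C c0 fC] ef]; exists (C * pi); first by rewrite mulr_ge0// pi_ge0.
move=> mu t P P' D hmu hP hP' hD.
have [cf _ _] := ef mu P hmu hP. have [cf' _ _] := ef mu P' hmu hP'.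
split; first by apply: half_int_le => // s _; case: (fC mu s P P' D).
rewrite -half_intB// mulrAC; apply: half_int_le; first exact: continuousBf.
by move=> s _; case: (fC mu s P P' D).
Qed.

Lemma tame_per_green a f : tame_per f ->
  tame_per (fun mu t P => green (w a) (fun t => f mu t P) t).
Proof.
move=> [[C c0 fC] ef]; have nr := @freq_nonres p a.
split; last by move=> mu P hmu hP; apply: even_periodic_green => //; exact: ef.
have [K K0 hK] := green_le nr.
exists (K * C); first by rewrite mulr_ge0.
move=> mu t P P' D hmu hP hP' hD.
have eP := ef mu P hmu hP. have eP' := ef mu P' hmu hP'.
have [cf _ _] := eP; have [cf' _ _] := eP'.
split; first by apply: hK => // s; case: (fC mu s P P' D).
rewrite -greenB// -mulrA; apply: hK; first exact: even_periodicB.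
by move=> s; case: (fC mu s P P' D).
Qed.

Lemma tame_per_eq f g : tame_per f -> (forall mu t P, f mu t P = g mu t P) -> tame_per g.
Proof.
move=> [tf ef] fg; split; first exact: tame_eq tf fg.
move=> mu P hmu hP.
have -> : (fun t => g mu t P) = (fun t => f mu t P) by apply/funext => t; rewrite fg.
exact: ef.
Qed.

Lemma tame_perD f g : tame_per f -> tame_per g -> tame_per (fun mu t P => f mu t P + g mu t P).
Proof.
move=> [tf ef] [tg eg]; split; first exact: tameD.
by move=> mu P hmu hP; apply: even_periodicD; [exact: ef|exact: eg].
Qed.

Lemma tame_perM f g : tame_per f -> tame_per g -> tame_per (fun mu t P => f mu t P * g mu t P).
Proof.
move=> [tf ef] [tg eg]; split; first exact: tameM.
by move=> mu P hmu hP; apply: even_periodicM; [exact: ef|exact: eg].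
Qed.

Lemma tame_per_cst (f : R -> pt -> R) : tame (fun mu _ P => f mu P) ->
  tame_per (fun mu _ P => f mu P).
Proof. by move=> tf; split => // mu P _ _; exact: even_periodic_cst. Qed.

Lemma tame_perZ (c : R) f : tame_per f -> tame_per (fun mu t P => c * f mu t P).
Proof. by apply: tame_perM; apply: (@tame_per_cst (fun _ _ => c)); exact: tame_k. Qed.

Lemma tame_per_mu : tame_per (fun mu _ _ => mu).
Proof. by apply: (@tame_per_cst (fun mu _ => mu)); exact: tame_mu. Qed.

Lemma tame_per_wcomp a : tame_per (fun _ t P => wcomp P.1 a t).
Proof.
split; first exact: (@tame_Z (fun t => inl (t, a))).
by move=> mu P _ [[_ eP] _]; exact: eP.
Qed.

Lemma tame_kcomp : tame (fun _ _ P => kcomp P.1).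
Proof. exact: (@tame_Z (fun=> inr true)). Qed.

Lemma tame_scomp : tame (fun _ _ P => scomp P.1).
Proof. exact: (@tame_Z (fun=> inr false)). Qed.

Definition central a : bool := w a == 1.

Definition yfun mu t (P : pt) : vec := fun a =>
  (central a)%:R * ((1 + mu * scomp P.1) * P.2 a * cosw (w a) t) + mu * wcomp P.1 a t.

Lemma tame_per_yfun a : tame_per (fun mu t P => yfun mu t P a).
Proof.
apply: tame_perD; last by apply: tame_perM; [exact: tame_per_mu|exact: tame_per_wcomp].
have tc : tame (fun mu (_ : R) P => (1 + mu * scomp P.1) * P.2 a).
  apply: tameM; last exact: tame_v.
  by apply: tameD; [exact: tame_k|apply: tameM; [exact: tame_mu|exact: tame_scomp]].
rewrite /central; case: eqP => [w1|_]; last first.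
  by apply: tame_per_eq (tame_per_cst (tame_k 0)) _ => *; rewrite mul0r.
apply: tame_perZ; apply: tame_perM.
  exact: (@tame_per_cst (fun mu P => (1 + mu * scomp P.1) * P.2 a)).
split; first exact: tame_cosw.
by move=> mu P _ _; apply: resonant_even_periodic; rewrite w1 /resonant eqxx orbT.
Qed.

(** The leading term is at most 1 + mu and the correction at most mu. This is the origin of the
    radius 3 in [lip3] and in [mu1_r0]. *)
Lemma yfun_le3 mu t P a : 0 < mu <= mu1 -> admissible P -> `|yfun mu t P a| <= 3.
Proof.
move=> /andP[m0 m1] [[Z1 _] v1].
have m1' : `|mu| <= 1 by rewrite gtr0_norm// (le_trans m1).
have small z : `|z| <= 1 -> `|mu * z| <= 1.
  by move=> z1; rewrite normrM mulr_ile1.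
have h1 : `|mu * wcomp P.1 a t| <= 1 by apply: small; exact: Z1.
have h2 : `|1 + mu * scomp P.1| <= 2.
  rewrite (le_trans (ler_normD _ _))// normr1.
  by have := small _ (Z1 (inr false)); rewrite /scomp; lra.
have h3 : `|P.2 a * cosw (w a) t| <= 1 by rewrite normrM mulr_ile1// cosw_le1.
rewrite /yfun (le_trans (ler_normD _ _))//.
suff : `|(central a)%:R * ((1 + mu * scomp P.1) * P.2 a * cosw (w a) t)| <= 2 by lra.
rewrite -mulrA normrM [X in _ * X]normrM.
have h4 : `|(central a)%:R| <= 1 :> R by case: central; rewrite ?normr0 ?normr1.
have : `|1 + mu * scomp P.1| * `|P.2 a * cosw (w a) t| <= 2 * 1 by apply: ler_pM.
by rewrite mulr1; move=> h5; rewrite -[leRHS]mul1r ler_pM.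
Qed.

Definition lip3 (f : R -> vec -> R) := exists2 C : R, 0 <= C &
  forall (mu : R) (x x' : vec) (d : R), 0 < mu <= mu1 -> (forall a, `|x a| <= 3) ->
    (forall a, `|x' a| <= 3) -> (forall a, `|x a - x' a| <= d) -> 0 <= d ->
    `|f mu x| <= C /\ `|f mu x - f mu x'| <= C * d.

Lemma tame_per_lip3 f : lip3 f -> tame_per (fun mu t P => f mu (yfun mu t P)).
Proof.
move=> [C c0 fC]; split.
  have [K K0 hK] := tame_unif (fun a => (tame_per_yfun a).1).
  exists (C * (1 + K)); first by rewrite mulr_ge0// addr_ge0.
  move=> mu t P P' D hmu hP hP' hD; have D0 := near_pt_ge0 hD.
  have yD a : `|yfun mu t P a - yfun mu t P' a| <= K * D.
    by have [] := hK a mu t P P' D hmu hP hP' hD.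
  have y3 a := yfun_le3 t a hmu hP; have y3' a := yfun_le3 t a hmu hP'.
  have [f1 f2] := fC mu _ _ _ hmu y3 y3' yD (mulr_ge0 K0 D0).
  split; first by rewrite (le_trans f1)// ler_peMr// lerDl.
  by rewrite (le_trans f2)// -mulrA ler_wpM2l// ler_wpM2r// lerDr.
move=> mu P hmu hP.
have ey a : even_periodic (fun t => yfun mu t P a) by case: (tame_per_yfun a) => _; apply.
have y3 t a := yfun_le3 t a hmu hP.
split.
- move=> t; apply/cvgrPdist_le => e e0.
  have c1 : 0 < C + 1 by rewrite ltr_wpDl.
  have d0 : 0 < e / (C + 1) by rewrite divr_gt0.
  have : \forall s \near t, forall a, `|yfun mu t P a - yfun mu s P a| <= e / (C + 1).
    apply: (@filter_forall R 'I_n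
      (fun a s => `|yfun mu t P a - yfun mu s P a| <= e / (C + 1)) (nbhs t)) => a.
    have [cy _ _] := ey a.
    by have /cvgrPdist_le/(_ _ d0) := cy t.
  apply: filterS => s hs.
  have [_ h] := fC mu _ _ _ hmu (y3 t) (y3 s) hs (ltW d0).
  rewrite (le_trans h)// mulrA ler_pdivrMr// mulrC ler_wpM2l ?ltW//.
  by rewrite ltrDl.
- by move=> t; congr (f mu _); apply/funext => a; case: (ey a) => _ ->.
- by move=> t; congr (f mu _); apply/funext => a; case: (ey a) => _ _ ->.
Qed.

(** [force] vanishes to second order and [pot] to third, so after the substitution x = mu^3 y
    division by mu^6, respectively mu^9 for [theta], leaves maps bounded uniformly in [mu]. *)
Definition rho mu (y : vec) : vec := fun a => force p (fun b => mu ^+ 3 * y b) a / mu ^+ 6.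

Definition theta mu (y : vec) : R := pot p (fun b => mu ^+ 3 * y b) / mu ^+ 9.

Lemma mu3_r0 mu : 0 < mu <= mu1 -> 3 * mu ^+ 3 <= r0.
Proof.
move=> /andP[m0 m1]; have mu_le1 : mu <= 1 by apply: le_trans m1 _.
apply: le_trans mu1_r0; rewrite ler_pM2l//; apply: le_trans m1.
by rewrite exprS ger_pMr// exprn_ile1// ltW.
Qed.

Lemma scale_le mu (y : vec) c : 0 < mu -> (forall a, `|y a| <= c) ->
  forall a, `|mu ^+ 3 * y a| <= c * mu ^+ 3.
Proof.
move=> m0 y3 a; rewrite normrM gtr0_norm ?exprn_gt0// mulrC.
by rewrite ler_wpM2r// exprn_ge0// ltW.
Qed.

Lemma rho_bound mu (x x' : vec) d a : 0 < mu <= mu1 -> (forall a, `|x a| <= 3) ->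
  (forall a, `|x' a| <= 3) -> (forall a, `|x a - x' a| <= d) ->
  `|rho mu x a| <= 9 * C0 /\ `|rho mu x a - rho mu x' a| <= 3 * C0 * d.
Proof.
move=> hmu x3 x3' xd; have [m0 _] := andP hmu.
have m6 : 0 < mu ^+ 6 by rewrite exprn_gt0.
have key (u u' : vec) c : (forall a, `|u a| <= 3) -> (forall a, `|u' a| <= 3) ->
    (forall a, `|u a - u' a| <= c) -> `|rho mu u a - rho mu u' a| <= 3 * C0 * c.
  move=> u3 u3' uc; rewrite /rho -mulrBl normrM normfV (gtr0_norm m6) ler_pdivrMr//.
  have := @force_lip p _ _ _ (c * mu ^+ 3) (mu3_r0 hmu) (scale_le m0 u3) (scale_le m0 u3').
  have uc' b : `|mu ^+ 3 * u b - mu ^+ 3 * u' b| <= c * mu ^+ 3.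
    by rewrite -mulrBr; exact: (scale_le (y := fun b => u b - u' b) m0 uc).
  move=> /(_ uc' a) h; apply: le_trans h _; rewrite le_eqVlt; apply/orP; left.
  by apply/eqP; ring.
split; last exact: key.
have z3 : forall b : 'I_n, `|(fun=> 0 : R) b| <= 3 by move=> b; rewrite normr0.
have z3' b : `|x b - (fun=> 0 : R) b| <= 3 by rewrite subr0.
have := key x (fun=> 0) 3 x3 z3 z3'.
have e0 : rho mu (fun=> 0) a = 0.
  rewrite /rho (_ : (fun=> _) = (fun=> 0)); first by rewrite force0 mul0r.
  by apply/funext => b; rewrite mulr0.
by rewrite e0 subr0; have -> : 9 * C0 = 3 * C0 * 3 by ring.
Qed.

Lemma rho_lip a : lip3 (fun mu y => rho mu y a).
Proof.
exists (9 * C0); first by rewrite mulr_ge0.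
move=> mu x x' d hmu x3 x3' xd d0.
have [h1 h2] := rho_bound a hmu x3 x3' xd; split => //.
by rewrite (le_trans h2)// ler_wpM2r// ler_wpM2r// ler_nat.
Qed.

Lemma theta_taylor mu (x x' : vec) d : 0 < mu <= mu1 -> (forall a, `|x a| <= 3) ->
  (forall a, `|x' a| <= 3) -> (forall a, `|x' a - x a| <= d) ->
  `|theta mu x' - theta mu x - \sum_a rho mu x a * (x' a - x a)| <= 3 * C0 * d ^+ 2.
Proof.
move=> hmu x3 x3' xd; have [m0 _] := andP hmu.
have mn : mu != 0 by rewrite gt_eqF.
have m9 : 0 < mu ^+ 9 by rewrite exprn_gt0.
have xd' b : `|mu ^+ 3 * x' b - mu ^+ 3 * x b| <= d * mu ^+ 3.
  by rewrite -mulrBr; exact: (scale_le (y := fun b => x' b - x b) m0 xd).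
have := @pot_taylor p _ _ _ _ (mu3_r0 hmu) (scale_le m0 x3) (scale_le m0 x3') xd'.
set A := pot p _; set B := pot p _; set S := \sum_a _ => h.
have -> : \sum_a rho mu x a * (x' a - x a) = S / mu ^+ 9.
  rewrite /S mulr_suml; apply: eq_bigr => a _; rewrite /rho -mulrBr.
  by field.
rewrite /theta -/A -/B -!mulrBl normrM normfV (gtr0_norm m9) ler_pdivrMr//.
by apply: le_trans h _; rewrite le_eqVlt; apply/orP; left; apply/eqP; ring.
Qed.

Lemma theta_lip : lip3 theta.
Proof.
pose C := \sum_(a < n) 9 * C0 + 18 * C0.
have C_ge0 : 0 <= C by rewrite addr_ge0 ?mulr_ge0// sumr_ge0// => a _; rewrite mulr_ge0.
have key (mu : R) (x x' : vec) (d : R) : 0 < mu <= mu1 -> (forall a, `|x a| <= 3) ->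
    (forall a, `|x' a| <= 3) -> (forall a, `|x a - x' a| <= d) -> 0 <= d ->
    `|theta mu x - theta mu x'| <= C * d.
  (* The Taylor remainder is quadratic in d. Points of the ball of radius 3 differ by at most 6, so
     truncating d at 6 makes it linear. *)
  move=> hmu x3 x3' xd d0; pose d' := Num.min d 6.
  have d'0 : 0 <= d' by rewrite le_min d0 /=.
  have d'6 : d' <= 6 by rewrite ge_min lexx orbT.
  have d'd : d' <= d by rewrite ge_min lexx.
  have xd' a : `|x a - x' a| <= d'.
    rewrite le_min xd /= (le_trans (ler_normB _ _))//.
    have := x3 a; have := x3' a; lra.
  have h := theta_taylor hmu x3' x3 xd'.
  have hS : `|\sum_a rho mu x' a * (x a - x' a)| <= (\sum_(a < n) 9 * C0) * d'.
    rewrite mulr_suml; apply: le_trans (ler_norm_sum _ _ _) _; apply: ler_sum => a _.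
    rewrite normrM; apply: ler_pM => //.
    have zz b : `|x' b - x' b| <= 0 by rewrite subrr normr0.
    by have [] := rho_bound a hmu x3' x3' zz.
  set S := \sum_a rho mu x' a * _ in h hS.
  have -> : theta mu x - theta mu x' = (theta mu x - theta mu x' - S) + S by ring.
  rewrite (le_trans (ler_normD _ _))//.
  have : 3 * C0 * d' ^+ 2 <= 18 * C0 * d'.
    have -> : 18 * C0 * d' = 3 * C0 * (6 * d') by ring.
    by rewrite ler_wpM2l ?mulr_ge0// expr2 ler_wpM2r.
  have : C * d' <= C * d by rewrite ler_wpM2l.
  have : C * d' = (\sum_(a < n) 9 * C0) * d' + 18 * C0 * d' by rewrite /C mulrDl.
  lra.
exists (C * 3); first by rewrite mulr_ge0.
move=> mu x x' d hmu x3 x3' xd d0; split; last first.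
  by rewrite (le_trans (key _ _ _ _ hmu x3 x3' xd d0))// ler_wpM2r// ler_peMr// ler1n.
have z3 : forall b : 'I_n, `|(fun=> 0 : R) b| <= 3 by move=> b; rewrite normr0.
have z3' b : `|x b - (fun=> 0 : R) b| <= 3 by rewrite subr0.
have := key mu x (fun=> 0) 3 hmu x3 z3 z3' (ler0n _ _).
have e0 : theta mu (fun=> 0) = 0.
  rewrite /theta (_ : (fun=> _) = (fun=> 0)); first by rewrite pot0 mul0r.
  by apply/funext => b; rewrite mulr0.
by rewrite e0 subr0.
Qed.

(** Comes from [lam * gradient] = w^2 y + mu^2 [rhs], with [lam] and [gradient] defined below: it is
    what remains of the force beyond the harmonic term, divided by mu^2. *)
Definition rhs a mu t (P : pt) : R :=
  kcomp P.1 * (w a ^+ 2 * yfun mu t P a)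
  + (1 + mu ^+ 2 * kcomp P.1) * (mu * rho mu (yfun mu t P) a).

Lemma tame_per_rho a : tame_per (fun mu t P => rho mu (yfun mu t P) a).
Proof. exact: tame_per_lip3 (rho_lip a). Qed.

Lemma tame_mu2k : tame (fun mu _ P => 1 + mu ^+ 2 * kcomp P.1).
Proof.
apply: tameD; [exact: tame_k|apply: tameM; last exact: tame_kcomp].
by apply: tame_eq (tameM tame_mu tame_mu) _ => mu t P; rewrite expr2.
Qed.

Lemma tame_per_rhs a : tame_per (rhs a).
Proof.
apply: tame_perD.
  apply: tame_perM; first exact: (tame_per_cst (f := fun _ P => kcomp P.1) tame_kcomp).
  by apply: tame_perZ; exact: tame_per_yfun.
apply: tame_perM; first exact: (tame_per_cst (f := fun mu P => _) tame_mu2k).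
by apply: tame_perM; [exact: tame_per_mu|exact: tame_per_rho].
Qed.

Definition psi_w a mu t P : R := - green (w a) (fun s => rhs a mu s P) t.

(* [k] keeps the resonant defect orthogonal to [v]; [s] keeps the mean potential
   energy equal to that of [v cos t]. *)
Definition psi_k mu (t : R) P : R :=
  - (kcomp P.1 * scomp P.1 + (1 + mu ^+ 2 * kcomp P.1) *
     \sum_a (central a)%:R * (P.2 a * cos_coef (w a) (fun s => rho mu (yfun mu s P) a))).

Definition psi_s mu (t : R) P : R :=
  - 2^-1 * (scomp P.1 * scomp P.1
    + 2 / pi * (\sum_a w a ^+ 2 * half_int (fun s => wcomp P.1 a s * wcomp P.1 a s)
               + 2 * (mu * half_int (fun s => theta mu (yfun mu s P))))).

Lemma tame_per_psi_w a : tame_per (psi_w a).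
Proof.
by apply: tame_per_eq (tame_perZ (-1) (tame_per_green a (tame_per_rhs a))) _ => *;
  rewrite mulN1r.
Qed.

Lemma tame_psi_k : tame psi_k.
Proof.
apply/tameN/tameD; first by apply: tameM; [exact: tame_kcomp|exact: tame_scomp].
apply: tameM; first exact: tame_mu2k.
apply: tame_sum => a; apply/tameZ/tameM; first exact: tame_v.
by apply: tame_cos_coef; exact: tame_per_rho.
Qed.

Lemma tame_psi_s : tame psi_s.
Proof.
apply/tameZ/tameD; first by apply: tameM; exact: tame_scomp.
apply/tameZ/tameD.
  apply: tame_sum => a; apply/tameZ/tame_half_int.
  by apply: tame_perM; exact: tame_per_wcomp.
apply/tameZ/tameM; first exact: tame_mu.
exact/tame_half_int/(tame_per_lip3 theta_lip).
Qed.

Definition psi mu (P : pt) : state := fun x =>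
  match x with
  | inl (t, a) => psi_w a mu t P
  | inr true => psi_k mu 0 P
  | inr false => psi_s mu 0 P
  end.

Lemma psi_bound : exists2 C : R, 0 < C & forall (mu : R) x P P' (D : R), 0 < mu <= mu1 ->
  admissible P -> admissible P' -> near_pt P P' D ->
  `|psi mu P x| <= C /\ `|psi mu P x - psi mu P' x| <= C * D.
Proof.
have [Ck k0 hk] := tame_psi_k; have [Cs s0 hs] := tame_psi_s.
have [Cw w0 hw] := tame_unif (fun a => (tame_per_psi_w a).1).
exists (1 + Ck + Cs + Cw); first by lra.
move=> mu x P P' D hmu hP hP' hD; have D0 := near_pt_ge0 hD.
have lift c f f' : c <= 1 + Ck + Cs + Cw -> `|f| <= c /\ `|f - f'| <= c * D ->
    `|f| <= 1 + Ck + Cs + Cw /\ `|f - f'| <= (1 + Ck + Cs + Cw) * D.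
  move=> cc [h1 h2]; split; first exact: le_trans cc.
  by apply: le_trans h2 _; exact: ler_wpM2r.
case: x => [[t a]|[]] /=.
- by apply: lift (hw a mu t P P' D hmu hP hP' hD); lra.
- by apply: lift (hk mu 0 P P' D hmu hP hP' hD); lra.
- by apply: lift (hs mu 0 P P' D hmu hP hP' hD); lra.
Qed.

Lemma unit_state0 : unit_state (fun=> 0).
Proof.
split; first by move=> x; rewrite normr0.
by move=> a; exact: even_periodic_cst.
Qed.

Lemma unit_state_closed (F : nat -> state) Z : (forall k, unit_state (F k)) ->
  (forall k x, `|F k x - Z x| <= 4 / 2 ^+ k) -> unit_state Z.
Proof.
move=> SF FZ; split.
  move=> x; apply/ler_addgt0Pr => e e0; have [k ke] := pow2_small e0.
  have [h _] := SF k; have := h x; have := FZ k x; rewrite distrC => h1 h2.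
  have -> : Z x = (Z x - F k x) + F k x by ring.
  have := ler_normD (Z x - F k x) (F k x); lra.
move=> a; apply: (@even_periodic_ulim _ _ (fun k => wcomp (F k) a) (fun k => 4 / 2 ^+ k)).
- by move=> k; case: (SF k).
- by move=> k t; exact: FZ.
- by move=> e e0; exact: pow2_small.
Qed.

(** By [psi_bound] the factor [mu], once small, gives a map that is Lipschitz with constant 1/2 in
    state and parameter jointly. Fixed points then exist and depend on [v] with Lipschitz constant
    at most 1. *)
Lemma fixed_family : exists2 mu2 : R, 0 < mu2 & forall mu : R, 0 < mu <= mu1 -> mu <= mu2 ->
  exists Z : vec -> state, forall v, (forall a, `|v a| <= 1) ->
    [/\ unit_state (Z v), forall x, Z v x = mu * psi mu (Z v, v) x &
     forall v' (d : R), (forall a, `|v' a| <= 1) -> (forall a, `|v a - v' a| <= d) ->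
       0 <= d -> forall x, `|Z v x - Z v' x| <= d].
Proof.
have [C C_gt0 hC] := psi_bound.
exists (1 / (2 * (C + 1))); first by rewrite divr_gt0// mulr_gt0// addr_gt0.
move=> mu hmu mu2; have [m0 _] := andP hmu.
have muC : mu * C <= 1 / 2 /\ mu <= 1.
  have c1 : 0 < 2 * (C + 1) by lra.
  by move: mu2; rewrite ler_pdivlMr// => h; split; nra.
have half x P P' D : admissible P -> admissible P' -> near_pt P P' D ->
    `|mu * psi mu P x| <= 1 /\ `|mu * psi mu P x - mu * psi mu P' x| <= D / 2.
  move=> hP hP' hD; have D0 := near_pt_ge0 hD.
  have [h1 h2] := hC mu x P P' D hmu hP hP' hD.
  rewrite -mulrBr !normrM gtr0_norm//; split.
    by apply: (@le_trans _ _ (mu * C)); [rewrite ler_pM2l|lra].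
  apply: (@le_trans _ _ (mu * C * D)); first by rewrite -mulrA ler_pM2l.
  by rewrite mulrC; apply: ler_wpM2l => //; lra.
have near0 P : near_pt P P 0 by split=> x; rewrite subrr normr0.
have /choice[Z hZ] : forall v : vec, exists Z, (forall a, `|v a| <= 1) ->
    unit_state Z /\ (fun x => mu * psi mu (Z, v) x) = Z.
  move=> v; have [v1|nv1] := pselect (forall a, `|v a| <= 1); last by exists (fun=> 0).
  have [] := @contraction_fixpoint R _ unit_state
    (fun Z x => mu * psi mu (Z, v) x) _ unit_state_closed _ _ _ unit_state0.
  - by move=> f x [h _]; exact: h.
  - move=> Z SZ; have hP : admissible (Z, v) by [].
    split=> [x|a]; first by have [] := half x _ _ 0 hP hP (near0 _).
    by apply: even_periodicZ; have [_ h] := tame_per_psi_w a; exact: (h mu (Z, v)).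
  - move=> f g D Sf Sg fg x.
    have D0 : 0 <= D by apply: le_trans (fg (inr true)).
    have [] // := half x (f, v) (g, v) D; split => //= a.
    by rewrite subrr normr0.
  - by move=> Z SZ eZ; exists Z.
exists Z => v v1; have [SZ eZ] := hZ v v1; split => //.
  by move=> x; rewrite -[in LHS]eZ.
move=> v' d v1' vd d0 x; have [SZ' eZ'] := hZ v' v1'.
(* The supremum of the difference need not be attained, so the halving is iterated from the trivial
   bound 2: a bound D that dominates d improves to D / 2. *)
have iter k y : `|Z v y - Z v' y| <= d + 4 / 2 ^+ k.
  elim: k y => [|k IH] y.
    rewrite expr0 divr1 (le_trans (ler_normB _ _))//.
    have := SZ.1 y; have := SZ'.1 y; lra.
  have k0 : 0 <= 4 / 2 ^+ k :> R by rewrite divr_ge0// exprn_ge0.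
  have [|||_] := half y (Z v, v) (Z v', v') (d + 4 / 2 ^+ k) => //.
    by split=> //= a; rewrite (le_trans (vd a))// lerDl.
  rewrite (congr1 (fun f => f y) eZ) (congr1 (fun f => f y) eZ') => h.
  apply: le_trans h _; rewrite exprS.
  have -> : (d + 4 / 2 ^+ k) / 2 = d / 2 + 4 / (2 * 2 ^+ k).
    by field; rewrite expf_neq0.
  by rewrite lerD2r; lra.
apply/ler_addgt0Pr => e e0; have [k ke] := pow2_small e0.
by apply: le_trans (iter k x) _; rewrite lerD2l ltW.
Qed.

(** With the period frozen at 2 pi, the true frequency appears as this factor of the force. It is
    the Lagrange multiplier of the energy constraint in [kin_compare]. *)
Definition lam mu (P : pt) : R := 1 + mu ^+ 2 * kcomp P.1.

(** The Fourier component of the equation that [green] cannot remove: an amplitude along cos t when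
    w = 1, a constant force when w = 0, and 0 at the other frequencies. *)
Definition xi a mu (P : pt) : R := mu ^+ 2 * cos_coef (w a) (fun t => rhs a mu t P).

Definition gradient a mu t (P : pt) : R :=
  w a ^+ 2 * yfun mu t P a + mu ^+ 3 * rho mu (yfun mu t P) a.

Definition acc a mu t (P : pt) : R :=
  - lam mu P * gradient a mu t P + xi a mu P * cosw (w a) t.

Lemma tame_per_gradient a : tame_per (gradient a).
Proof.
apply: tame_perD; first by apply: tame_perZ; exact: tame_per_yfun.
apply: tame_perM; last exact: tame_per_rho.
by apply: tame_per_eq (tame_perM tame_per_mu (tame_perM tame_per_mu tame_per_mu)) _
  => mu t P; rewrite !exprS expr0 mulr1.
Qed.

Lemma tame_per_acc a : tame_per (acc a).
Proof.
apply: tame_perD.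
  apply: tame_perM; last exact: tame_per_gradient.
  by apply: (@tame_per_cst (fun mu P => - lam mu P)); exact: (tameN tame_mu2k).
have [rw|rw] := boolP (resonant (w a)); last first.
  apply: tame_per_eq (tame_per_cst (tame_k 0)) _ => mu t P.
  by rewrite /xi cos_coef_nonres// mulr0 mul0r.
apply: tame_perM; last first.
  by split; [exact: tame_cosw|move=> *; exact: resonant_even_periodic].
apply: (@tame_per_cst (fun mu P => xi a mu P)); apply: tameM.
  by apply: tame_eq (tameM tame_mu tame_mu) _ => mu t P; rewrite expr2.
exact: tame_cos_coef (tame_per_rhs a).
Qed.

Record solves mu (P : pt) : Prop := Solves {
  solves_mu : 0 < mu <= mu1;
  solves_adm : admissible P;
  solves_fix : forall x, P.1 x = mu * psi mu P x;
  solves_sphere : \sum_a (central a)%:R * (P.2 a * P.2 a) = 1 }.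

Section Solution.
Variables (mu : R) (P : pt).
Hypothesis sP : solves mu P.

Let hmu := solves_mu sP.
Let hP := solves_adm sP.

Lemma tame_per_continuous f : tame_per f -> continuous (fun t => f mu t P).
Proof. by move=> [_ ef]; case: (ef mu P hmu hP). Qed.

Let cy a := tame_per_continuous (tame_per_yfun a).
Let cw a := tame_per_continuous (tame_per_wcomp a).
Let crho a := tame_per_continuous (tame_per_rho a).
Let crhs a := tame_per_continuous (tame_per_rhs a).

Lemma sol_wcomp a : wcomp P.1 a = fun t => - mu * green (w a) (fun s => rhs a mu s P) t.
Proof. by apply/funext => t; rewrite /wcomp (solves_fix sP) /= /psi_w mulrN mulNr. Qed.

(** The operator d^2/dt^2 + w^2 annihilates [cosw] and undoes [green] up to the resonant mode of
    [rhs], which reappears as the [xi] term of [acc]. *)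
Lemma sol_ode a : exists2 y1, is_primitive (fun t => yfun mu t P a) y1 &
  is_primitive y1 (fun t => acc a mu t P).
Proof.
set c := (central a)%:R * ((1 + mu * scomp P.1) * P.2 a).
set f := fun s => rhs a mu s P.
have cf : continuous f by exact: crhs.
exists (fun t => c * - (w a ^+ 2 * sinw (w a) t) - mu ^+ 2 * green' (w a) f t).
  have -> : (fun t => yfun mu t P a) =
      (fun t => c * cosw (w a) t - mu ^+ 2 * green (w a) f t).
    by apply/funext => t; rewrite /yfun sol_wcomp /c; ring.
  apply: is_primitiveB; apply: is_primitiveZ; first exact: is_primitive_cosw.
  exact: is_primitive_green.
have h1 := is_primitiveZ c (is_primitiveN (is_primitiveZ (w a ^+ 2) (is_primitive_sinw (w a)))).
have h2 := is_primitiveZ (mu ^+ 2) (is_primitive_green' (w a) cf).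
apply: is_primitive_eq (is_primitiveB h1 h2) _ => t.
rewrite /acc /xi /cos_reduce -/f /gradient.
have ey : yfun mu t P a = c * cosw (w a) t - mu ^+ 2 * green (w a) f t.
  by rewrite /yfun sol_wcomp /c; ring.
have ef : f t = kcomp P.1 * (w a ^+ 2 * yfun mu t P a)
  + lam mu P * (mu * rho mu (yfun mu t P) a) by [].
rewrite ef ey /lam; ring.
Qed.

Lemma cos_coef_wcomp a : cos_coef (w a) (wcomp P.1 a) = 0.
Proof.
rewrite sol_wcomp cos_coefZ ?cos_coef_green ?mulr0//.
by have [] := even_periodic_green (@freq_nonres p a)
  ((tame_per_rhs a).2 mu P hmu hP).
Qed.

Lemma central_resonant a : central a -> resonant (w a).
Proof. by rewrite /central /resonant => ->; rewrite orbT. Qed.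

Lemma cos_coef_yfun a : cos_coef (w a) (fun t => yfun mu t P a) =
  (central a)%:R * ((1 + mu * scomp P.1) * P.2 a).
Proof.
rewrite /yfun cos_coefD; first last.
- by apply: continuousZf; exact: cw.
- by do 2 apply: continuousZf; exact: continuous_cosw.
rewrite [X in _ + X]cos_coefZ ?cos_coef_wcomp ?mulr0 ?addr0; last exact: cw.
rewrite cos_coefZ; last by apply: continuousZf; exact: continuous_cosw.
rewrite cos_coefZ; last exact: continuous_cosw.
case: (boolP (central a)) => [ca|]; last by rewrite !mul0r.
by rewrite cos_coef_cosw ?mulr1// central_resonant.
Qed.

(** Since v has norm 1, pairing the resonant coefficients of [rhs] with v gives k (1 + mu s) plus
    [lam] mu times the sum in [psi_k]. The fixed point equation for [kcomp] is exactly the vanishing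
    of this expression. *)
Lemma sol_radial : \sum_a (central a)%:R * (P.2 a * xi a mu P) = 0.
Proof.
have [m0 _] := andP hmu.
have ek : kcomp P.1 = mu * psi_k mu 0 P by rewrite /kcomp (solves_fix sP).
pose c a := cos_coef (w a) (fun s => rho mu (yfun mu s P) a).
have e a : (central a)%:R * (P.2 a * xi a mu P) =
   mu ^+ 2 * (kcomp P.1 * (1 + mu * scomp P.1)) * ((central a)%:R * (P.2 a * P.2 a))
   + mu ^+ 2 * (lam mu P * mu) * ((central a)%:R * (P.2 a * c a)).
  rewrite /xi /rhs; case: (boolP (central a)) => [ca|_]; last by rewrite !mul0r !mulr0 addr0.
  rewrite cos_coefD; first last.
  - by do 2 apply: continuousZf; exact: crho.
  - by do 2 apply: continuousZf; exact: cy.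
  rewrite cos_coefZ; last by apply: continuousZf; exact: cy.
  rewrite cos_coefZ; last exact: cy.
  rewrite cos_coefZ; last by apply: continuousZf; exact: crho.
  rewrite cos_coefZ; last exact: crho.
  rewrite cos_coef_yfun ca -/(c a) (eqP ca) /lam /=; ring.
rewrite (eq_bigr _ (fun a _ => e a)) big_split/= -!mulr_sumr (solves_sphere sP).
have -> : \sum_a (central a)%:R * (P.2 a * c a) =
  \sum_a (central a)%:R * (P.2 a * cos_coef (w a) (fun s => rho mu (yfun mu s P) a)) by [].
move: ek; rewrite /psi_k -/(lam mu P); set S := \sum_a _ => ek.
have h : kcomp P.1 * (1 + mu * scomp P.1) = - (mu * (lam mu P * S)).
  have -> : kcomp P.1 * (1 + mu * scomp P.1) =
    kcomp P.1 + mu * (kcomp P.1 * scomp P.1) by ring.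
  by rewrite [X in X + _]ek; ring.
by rewrite -[X in X * 1]mulrA h; ring.
Qed.

Lemma sol_half_int_cos a : central a ->
  half_int (fun t => cosw (w a) t * wcomp P.1 a t) = 0.
Proof.
move=> ca; have := cos_coef_wcomp a; rewrite /cos_coef central_resonant// => /eqP.
by rewrite mulf_eq0 invr_eq0 (gt_eqF (cosw_mass_gt0 _)) orbF => /eqP.
Qed.

Lemma central_mass a : central a -> cosw_mass (w a) = pi / 2.
Proof. by rewrite /central /cosw_mass => /eqP ->; rewrite oner_eq0. Qed.

(** The right-hand side is the energy of v cos t on [0, pi]. Cross terms disappear because [wcomp]
    is orthogonal to [cosw] in central directions, and the equation for [scomp] balances what
    remains. *)
Lemma sol_energy :
  \sum_a 2^-1 * (w a ^+ 2 * half_int (fun t => yfun mu t P a * yfun mu t P a))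
  + mu ^+ 3 * half_int (fun t => theta mu (yfun mu t P)) = pi / 4.
Proof.
have pi0 : pi != 0 :> R by rewrite gt_eqF// pi_gt0.
set s := scomp P.1; set Th := half_int (fun t => theta _ _).
pose W a := half_int (fun t => wcomp P.1 a t * wcomp P.1 a t).
have es : s = mu * (- 2^-1 * (s * s + 2 / pi * (\sum_a w a ^+ 2 * W a + 2 * (mu * Th)))).
  by rewrite {1}/s /scomp (solves_fix sP).
have e a : 2^-1 * (w a ^+ 2 * half_int (fun t => yfun mu t P a * yfun mu t P a)) =
    (1 + mu * s) ^+ 2 * (pi / 4) * ((central a)%:R * (P.2 a * P.2 a))
    + mu ^+ 2 / 2 * (w a ^+ 2 * W a).
  set c := (central a)%:R * ((1 + mu * s) * P.2 a).
  have cc : continuous (cosw (w a)) by exact: continuous_cosw.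
  have -> : (fun t => yfun mu t P a * yfun mu t P a) = (fun t =>
      c ^+ 2 * (cosw (w a) t * cosw (w a) t)
      + (c * mu * 2 * (cosw (w a) t * wcomp P.1 a t)
         + mu ^+ 2 * (wcomp P.1 a t * wcomp P.1 a t))).
    by apply/funext => t; rewrite /yfun -/s /c; ring.
  rewrite half_intD; first last.
  - by apply: continuousDf; apply: continuousZf; apply: continuousMf => //; exact: cw.
  - by apply: continuousZf; exact: continuousMf.
  rewrite half_intD; first last.
  - by apply: continuousZf; apply: continuousMf; exact: cw.
  - by apply: continuousZf; apply: continuousMf => //; exact: cw.
  rewrite half_intZ; last exact: continuousMf.
  rewrite half_intZ; last by apply: continuousMf => //; exact: cw.
  rewrite half_intZ; last by apply: continuousMf; exact: cw.
  rewrite -/(W a) /c; case: (boolP (central a)) => [ca|_] /=; last by rewrite !mul0r; ring.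
  rewrite half_int_cosw2 ?central_resonant// sol_half_int_cos// central_mass// (eqP ca).
  by field.
rewrite (eq_bigr _ (fun a _ => e a)) big_split/= -!mulr_sumr (solves_sphere sP).
move: es; set S := \sum_a _ => es.
move: pi0 es; generalize (pi : R) => q q0 es.
(* Twice the fixed point equation for [scomp], cleared of its minus sign; it is the bracket by which
   the energy deviates from pi / 4. *)
have h : 2 * s + mu * s * s + mu * (2 / q) * (S + 2 * (mu * Th)) = 0.
  by rewrite [X in 2 * X + _]es; field.
have -> : (1 + mu * s) ^+ 2 * (q / 4) * 1 + mu ^+ 2 / 2 * S + mu ^+ 3 * Th =
  q / 4 + mu * q / 4 * (2 * s + mu * s * s + mu * (2 / q) * (S + 2 * (mu * Th))).
  by field.
by rewrite h mulr0 addr0.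
Qed.

End Solution.

(* The kinetic energy, integrated by parts so that only [y''] appears. *)
Definition kin mu (t : R) (P : pt) : R :=
  - \sum_a 2^-1 * half_int (fun s => acc a mu s P * yfun mu s P a).

Lemma tame_kin : tame kin.
Proof.
apply/tameN/tame_sum => a; apply/tameZ/tame_half_int.
by apply: tame_perM; [exact: tame_per_acc|exact: tame_per_yfun].
Qed.

(** The first variation of the kinetic energy with a quadratic error. Equal mean potential energies
    make the pairing of the gradient with the displacement second order, by [theta_taylor]. Only the
    [xi] pairing stays at first order, and [sol_radial] removes from it the contribution of [P]. *)
Lemma kin_compare : exists2 C : R, 0 <= C & forall (mu : R) P P' (D : R), solves mu P -> solves mu P' ->
  near_pt P P' D ->
  kin mu 0 P' - kin mu 0 P <=
    - (pi / 2) * (1 + mu * scomp P'.1) * (\sum_a (central a)%:R * (xi a mu P * P'.2 a))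
    + C * D ^+ 2.
Proof.
have [Cy Cy0 hCy] := tame_unif (fun a => (tame_per_yfun a).1).
have [Ca Ca0 hCa] := tame_unif (fun a => (tame_per_acc a).1).
have [Cl Cl0 hCl] := tame_mu2k.
pose W := \sum_a 2^-1 * (w a ^+ 2 * pi) + 3 * C0 * pi.
have W0 : 0 <= W.
  apply: addr_ge0; last by rewrite !mulr_ge0// pi_ge0.
  apply: sumr_ge0 => a _; apply: mulr_ge0; first by rewrite invr_ge0.
  by apply: mulr_ge0; [exact: sqr_ge0|exact: pi_ge0].
exists (Cl * (W * Cy ^+ 2) + \sum_(a < n) 2^-1 * (Ca * Cy * pi)).
  apply: addr_ge0; first by apply/mulr_ge0/mulr_ge0/sqr_ge0.
  apply: sumr_ge0 => a _; apply: mulr_ge0; first by rewrite invr_ge0.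
  by apply: mulr_ge0; [exact: mulr_ge0|exact: pi_ge0].
move=> mu P P' D sP sP' hD; have D0 := near_pt_ge0 hD.
have hmu := solves_mu sP; have hP := solves_adm sP; have hP' := solves_adm sP'.
have [m0 m1] := andP hmu.
have cy a := tame_per_continuous sP (tame_per_yfun a).
have cy' a := tame_per_continuous sP' (tame_per_yfun a).
have ca a := tame_per_continuous sP (tame_per_acc a).
have ca' a := tame_per_continuous sP' (tame_per_acc a).
have cg a := tame_per_continuous sP (tame_per_gradient a).
have cr a := tame_per_continuous sP (tame_per_rho a).
have ct := tame_per_continuous sP (tame_per_lip3 theta_lip).
have ct' := tame_per_continuous sP' (tame_per_lip3 theta_lip).
pose dy a t := yfun mu t P' a - yfun mu t P a.
have cdy a : continuous (dy a) by exact: continuousBf.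
have dyD a t : `|dy a t| <= Cy * D.
  by rewrite distrC; have [_] := hCy a mu t P P' D hmu hP hP' hD.
pose G a := half_int (fun t => gradient a mu t P * dy a t).
pose Xa a := half_int (fun t => xi a mu P * cosw (w a) t * dy a t).
pose Q a := half_int (fun t => (acc a mu t P' - acc a mu t P) * dy a t).
(* The symmetry of the second derivative, [half_int_ibp], doubles the pairing of [acc] at [P] with
   the displacement; [Q] collects the product of the two increments. *)
have split1 a : half_int (fun s => acc a mu s P' * yfun mu s P' a)
    - half_int (fun s => acc a mu s P * yfun mu s P a) =
    2 * (- lam mu P * G a + Xa a) + Q a.
  have [y1 h1 h1'] := sol_ode sP a; have [y2 h2 h2'] := sol_ode sP' a.
  have ibp := half_int_ibp ((tame_per_yfun a).2 mu P hmu hP)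
     ((tame_per_yfun a).2 mu P' hmu hP') h1 h1' h2 h2' (ca a) (ca' a).
  have eA : - lam mu P * G a + Xa a = half_int (fun t => acc a mu t P * dy a t).
    rewrite /G /Xa -half_intZ; last exact: continuousMf.
    rewrite -half_intD; first last.
    - by apply: continuousMf => //; apply: continuousZf; exact: continuous_cosw.
    - by apply: continuousZf; exact: continuousMf.
    by congr half_int; apply/funext => t; rewrite /acc; ring.
  rewrite eA.
  have -> : half_int (fun t => acc a mu t P * dy a t) =
     half_int (fun t => acc a mu t P * yfun mu t P' a)
     - half_int (fun t => acc a mu t P * yfun mu t P a).
    rewrite -half_intB; try exact: continuousMf.
    by congr half_int; apply/funext => t; rewrite /dy; ring.
  have -> : Q a = (half_int (fun t => acc a mu t P' * yfun mu t P' a)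
     - half_int (fun t => yfun mu t P a * acc a mu t P'))
     - (half_int (fun t => acc a mu t P * yfun mu t P' a)
     - half_int (fun t => acc a mu t P * yfun mu t P a)).
    rewrite -half_intB; try exact: continuousMf.
    rewrite -half_intB; try exact: continuousMf.
    rewrite -half_intB; try (apply: continuousBf; exact: continuousMf).
    by congr half_int; apply/funext => t; rewrite /dy; ring.
  rewrite ibp; ring.
(* Pairing with [cosw] sees only the leading part of the displacement. It gives 0 in the kernel
   directions, where [yfun] has zero mean, so the constant forces do not enter the variation. *)
have eX a : Xa a = pi / 2 * ((central a)%:R * (xi a mu P *
    ((1 + mu * scomp P'.1) * P'.2 a - (1 + mu * scomp P.1) * P.2 a))).
  have [rw|rw] := boolP (resonant (w a)); last first.
    have x0 : xi a mu P = 0 by rewrite /xi cos_coef_nonres// mulr0.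
    rewrite /Xa x0 mul0r !mulr0.
    have -> : (fun t => 0 * cosw (w a) t * dy a t) = (fun t => 0 * dy a t).
      by apply/funext => t; rewrite !mul0r.
    by rewrite half_intZ// mul0r.
  have ed : cos_coef (w a) (dy a) = (central a)%:R *
      ((1 + mu * scomp P'.1) * P'.2 a - (1 + mu * scomp P.1) * P.2 a).
    by rewrite /dy cos_coefB// (cos_coef_yfun sP') (cos_coef_yfun sP) mulrBr.
  have -> : Xa a = xi a mu P * (cos_coef (w a) (dy a) * cosw_mass (w a)).
    rewrite /cos_coef rw divfK ?gt_eqF ?cosw_mass_gt0// -half_intZ.
      by congr half_int; apply/funext => t; rewrite mulrA.
    by apply: continuousMf => //; exact: continuous_cosw.
  rewrite ed; case: (boolP (central a)) => [cta|_] /=; last by rewrite !mul0r !mulr0.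
  by rewrite central_mass//; ring.
(* The difference of the two energy identities: the first-order part of the potential energy equals
   minus the quadratic part and the Taylor remainder of [theta]. *)
have eG : \sum_a G a = - (\sum_a 2^-1 * (w a ^+ 2 * half_int (fun t => dy a t * dy a t))
   + mu ^+ 3 * half_int (fun t => theta mu (yfun mu t P') - theta mu (yfun mu t P)
        - \sum_a rho mu (yfun mu t P) a * dy a t)).
  have cS : continuous (fun t => \sum_a rho mu (yfun mu t P) a * dy a t).
    by apply: continuous_sumf => a _; exact: continuousMf.
  rewrite half_intB//; last exact: continuousBf.
  rewrite half_intB// half_int_sum; last by move=> a _; exact: continuousMf.
  have := sol_energy sP; rewrite -(sol_energy sP').
  set T1 := half_int _; set T2 := half_int (fun t => theta _ (yfun _ _ P')) => en.
  have eGa a : G a + 2^-1 * (w a ^+ 2 * half_int (fun t => dy a t * dy a t)) =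
      2^-1 * (w a ^+ 2 * half_int (fun t => yfun mu t P' a * yfun mu t P' a))
      - 2^-1 * (w a ^+ 2 * half_int (fun t => yfun mu t P a * yfun mu t P a))
      + mu ^+ 3 * half_int (fun t => rho mu (yfun mu t P) a * dy a t).
    have c1 : continuous (fun t => dy a t * dy a t) by exact: continuousMf.
    have c2 : continuous (fun t => yfun mu t P' a * yfun mu t P' a) by exact: continuousMf.
    have c3 : continuous (fun t => yfun mu t P a * yfun mu t P a) by exact: continuousMf.
    have c4 : continuous (fun t => rho mu (yfun mu t P) a * dy a t) by exact: continuousMf.
    have c5 : continuous (fun t => gradient a mu t P * dy a t) by exact: continuousMf.
    have eg : half_int (fun t => gradient a mu t P * dy a t
         + 2^-1 * w a ^+ 2 * (dy a t * dy a t)) =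
       half_int (fun t => (2^-1 * w a ^+ 2 * (yfun mu t P' a * yfun mu t P' a)
          - 2^-1 * w a ^+ 2 * (yfun mu t P a * yfun mu t P a))
          + mu ^+ 3 * (rho mu (yfun mu t P) a * dy a t)).
      by congr half_int; apply/funext => t; rewrite /gradient /dy; field.
    rewrite (half_intD c5 (continuousZf c1)) (half_intZ _ c1) in eg.
    rewrite (half_intD (continuousBf (continuousZf c2) (continuousZf c3))
      (continuousZf c4)) (half_intZ _ c4) in eg.
    rewrite (half_intB (continuousZf c2) (continuousZf c3)) in eg.
    rewrite (half_intZ _ c2) (half_intZ _ c3) in eg.
    by rewrite /G; lra.
  have : \sum_a (G a + 2^-1 * (w a ^+ 2 * half_int (fun t => dy a t * dy a t))) =
    \sum_a 2^-1 * (w a ^+ 2 * half_int (fun t => yfun mu t P' a * yfun mu t P' a))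
    - \sum_a 2^-1 * (w a ^+ 2 * half_int (fun t => yfun mu t P a * yfun mu t P a))
    + mu ^+ 3 * \sum_a half_int (fun t => rho mu (yfun mu t P) a * dy a t).
    by rewrite mulr_sumr -sumrB -big_split/=; apply: eq_bigr => a _; rewrite eGa.
  rewrite big_split/=; set u1 := \sum_a _; set u2 := \sum_a _.
  rewrite mulrBr mulrBr; lra.
have CyD0 : 0 <= Cy * D by exact: mulr_ge0.
have dy2 a t : `|dy a t * dy a t| <= (Cy * D) ^+ 2.
  by rewrite normrM expr2 ler_pM.
have GD : `|\sum_a G a| <= W * Cy ^+ 2 * D ^+ 2.
  have -> : W * Cy ^+ 2 * D ^+ 2 = \sum_a 2^-1 * (w a ^+ 2 * ((Cy * D) ^+ 2 * pi))
      + 3 * C0 * (Cy * D) ^+ 2 * pi.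
    rewrite /W -mulrA -exprMn mulrDl mulr_suml; congr (_ + _); last by ring.
    by apply: eq_bigr => a _; ring.
  rewrite eG normrN (le_trans (ler_normD _ _))//; apply: lerD.
    apply: le_trans (ler_norm_sum _ _ _) _; apply: ler_sum => a _.
    rewrite normrM ger0_norm ?invr_ge0// ler_pM2l ?invr_gt0//.
    rewrite normrM ger0_norm ?sqr_ge0//; apply: ler_wpM2l; first exact: sqr_ge0.
    by apply: half_int_le => //; exact: continuousMf.
  rewrite normrM ger0_norm ?exprn_ge0 ?(ltW m0)//.
  have m31 : mu ^+ 3 <= 1 by rewrite exprn_ile1 ?(ltW m0)// (le_trans m1).
  rewrite -[leRHS]mul1r; apply: ler_pM => //; first by rewrite exprn_ge0// ltW.
  apply: half_int_le.
    apply: continuousBf; first exact: continuousBf.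
    by apply: continuous_sumf => a _; exact: continuousMf.
  move=> t _; apply: theta_taylor => // a; [exact: yfun_le3|exact: yfun_le3|].
  exact: dyD.
have QD a : `|Q a| <= Ca * Cy * pi * D ^+ 2.
  have -> : Ca * Cy * pi * D ^+ 2 = (Ca * D) * (Cy * D) * pi by ring.
  apply: half_int_le; first by apply: continuousMf => //; exact: continuousBf.
  move=> t _; rewrite normrM; apply: ler_pM => //; rewrite distrC.
  by have [_] := hCa a mu t P P' D hmu hP hP' hD.
have lamC : `|lam mu P| <= Cl.
  by have [] := hCl mu 0 P P' D hmu hP hP' hD.
have eK : kin mu 0 P' - kin mu 0 P =
    lam mu P * \sum_a G a - \sum_a Xa a - \sum_a 2^-1 * Q a.
  rewrite /kin opprK addrC mulr_sumr -!sumrB.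
  by apply: eq_bigr => a _; have := split1 a; lra.
have eXs : \sum_a Xa a = pi / 2 * (1 + mu * scomp P'.1) *
    (\sum_a (central a)%:R * (xi a mu P * P'.2 a)).
  have h := sol_radial sP.
  have -> : \sum_a Xa a = pi / 2 * (1 + mu * scomp P'.1) *
      (\sum_a (central a)%:R * (xi a mu P * P'.2 a))
      - pi / 2 * (1 + mu * scomp P.1) * (\sum_a (central a)%:R * (P.2 a * xi a mu P)).
    rewrite !mulr_sumr -sumrB; apply: eq_bigr => a _; rewrite eX; ring.
  by rewrite h mulr0 subr0.
rewrite eK eXs !mulNr.
have h1 : lam mu P * \sum_a G a <= Cl * (W * Cy ^+ 2) * D ^+ 2.
  rewrite -mulrA (le_trans (ler_norm _))// normrM; apply: ler_pM => //.
have h2 : - \sum_a 2^-1 * Q a <= (\sum_(a < n) 2^-1 * (Ca * Cy * pi)) * D ^+ 2.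
  rewrite mulr_suml -sumrN; apply: ler_sum => a _; rewrite -mulrN -mulrA.
  rewrite ler_pM2l ?invr_gt0//; apply: le_trans (QD a).
  by rewrite -normrN ler_norm.
rewrite [X in _ <= _ + X]mulrDl; lra.
Qed.

Lemma zero_of_small_slope (c K : R) : 0 <= K ->
  (forall tau, 0 < tau <= 1 -> c <= K * tau) -> c <= 0.
Proof.
move=> K0 h; have [//|c0] := leP c 0.
have d0 : 0 < c + K + 1 by lra.
have tau1 : 0 < c / (c + K + 1) <= 1 by rewrite divr_gt0//= ler_pdivrMr//; lra.
have := h _ tau1; rewrite mulrA ler_pdivlMr// => {}h.
have : 0 < c * (c + 1) by rewrite mulr_gt0//; lra.
nra.
Qed.

(** The second equation is a vanishing sum of squares that confines v to the central coordinates.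
    The unit sphere of the resonant eigenspace thus becomes a closed bounded set of full-length row
    vectors. *)
Definition central_sphere : set 'rV[R]_n :=
  [set v | \sum_a (central a)%:R * (v 0 a * v 0 a) = 1] `&`
  [set v | \sum_a (~~ central a)%:R * (v 0 a * v 0 a) = 0].

Lemma central_sphere_out v a : central_sphere v -> ~~ central a -> v 0 a = 0.
Proof.
move=> [_ /eqP]; rewrite /= psumr_eq0; last first.
  by move=> b _; rewrite mulr_ge0// -expr2 sqr_ge0.
move=> /allP /(_ a); rewrite mem_index_enum => /(_ isT) /= h ca.
by move: h; rewrite ca mul1r -expr2 sqrf_eq0 => /eqP.
Qed.

Lemma central_sphere_le1 v a : central_sphere v -> `|v 0 a| <= 1.
Proof.
move=> sv; have [ca|/(central_sphere_out sv) ->] := boolP (central a); last by rewrite normr0.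
have [/= h1 _] := sv.
rewrite -(expr_le1 (n := 2)) ?normr_ge0// -normrX ger0_norm ?sqr_ge0// -h1.
rewrite (bigD1 a)//= ca mul1r expr2 lerDl; apply: sumr_ge0 => b _.
by rewrite mulr_ge0// -expr2 sqr_ge0.
Qed.

Lemma closed_central_sphere : closed central_sphere.
Proof. by apply: closedI; apply: closed_rV_eq; exact: continuous_rV_square. Qed.

(* Rotating a minimiser of [kin] towards [xi] would decrease [kin] to first
   order, unless [xi] vanishes on the resonant directions. *)
Lemma critical_state : (exists a, central a) -> exists2 mu2 : R, 0 < mu2 &
  forall mu : R, 0 < mu <= mu1 -> mu <= mu2 -> exists2 P, solves mu P &
    (forall a, ~~ central a -> P.2 a = 0) /\ forall a, central a -> xi a mu P = 0.
Proof.
move=> [a0 ca0]; have [mu2 mu20 hmu2] := fixed_family.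
have [C C_ge0 hC] := kin_compare; have [L L0 hL] := tame_kin.
exists (Num.min mu2 (1 / 2)); first by rewrite lt_min mu20/=; lra.
move=> mu hmu; rewrite le_min => /andP[mu2' mu_half].
have [Z hZ] := hmu2 mu hmu mu2'; have [m0 _] := andP hmu.
pose P (v : 'rV[R]_n) : pt := (Z (v 0 : vec), v 0 : vec).
have sP v : central_sphere v -> solves mu (P v).
  move=> sv; have v1 a := central_sphere_le1 a sv.
  have [h1 h2 _] := hZ (v 0) v1; split => //.
  by case: sv.
have nP v v' d : central_sphere v -> central_sphere v' -> 0 <= d ->
    (forall a, `|v 0 a - v' 0 a| <= d) -> near_pt (P v) (P v') d.
  move=> sv sv' d0 vd; have v1 a := central_sphere_le1 a sv.
  have v1' a := central_sphere_le1 a sv'.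
  by have [_ _ h3] := hZ (v 0) v1; split => //= x; exact: h3.
have A0 : central_sphere !=set0.
  exists (delta_mx 0 a0); split => /=.
  - rewrite (bigD1 a0)//= big1 ?addr0; first by rewrite !mxE !eqxx ca0 !mulr1.
    by move=> b ba; rewrite !mxE (negbTE ba) andbF mulr0 mulr0.
  - rewrite big1// => b _; rewrite !mxE /=; have [->|ba] := eqVneq b a0.
      by rewrite ca0 mul0r.
    by rewrite mulr0 mulr0.
have [|v sv vmin] := @rV_min_lipschitz R n central_sphere (fun v => kin mu 0 (P v)) L
  A0 closed_central_sphere (fun v a => @central_sphere_le1 v a) L0.
  move=> v v' d sv sv' d0 vd.
  have [_] := hL mu 0 (P v) (P v') d hmu (solves_adm (sP v sv)) (solves_adm (sP v' sv'))
    (nP v v' d sv sv' d0 vd).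
  by [].
exists (P v); first exact: sP.
split; first by move=> a; exact: central_sphere_out.
pose x a := (central a)%:R * xi a mu (P v).
have [q qE] : exists q, q = \sum_a x a * x a by exists (\sum_a x a * x a).
have q0 : 0 <= q by rewrite qE; apply: sumr_ge0 => a _; rewrite -expr2 sqr_ge0.
suff : q <= 0.
  move=> q0' a ca; have /eqP : q = 0 by apply/eqP; rewrite eq_le q0'.
  rewrite qE psumr_eq0; last by move=> b _; rewrite -expr2 sqr_ge0.
  move=> /allP /(_ a); rewrite mem_index_enum => /(_ isT) /=.
  by rewrite /x ca mul1r -expr2 sqrf_eq0 => /eqP.
have rad : \sum_a v 0 a * x a = 0.
  rewrite -[RHS](sol_radial (sP v sv)); apply: eq_bigr => a _; rewrite /x /=; ring.
have [/= vn _] := sv; have vout a := central_sphere_out (a := a) sv.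
pose b := \sum_a `|x a|.
have xb a : `|x a| <= b by rewrite /b (bigD1 a)//= lerDl sumr_ge0.
have b0 : 0 <= b by apply: sumr_ge0.
pose B := 2 * q + 2 * b; have B0 : 0 <= B by rewrite /B; lra.
have p0 := pi_gt0 R.
have q1 : 0 < 1 + q by lra.
have key tau : 0 < tau <= 1 -> pi / 2 * q / (1 + q) <= C * B ^+ 2 * tau.
  move=> /andP[t0 t1]; pose D := 1 + tau ^+ 2 * q.
  have tq : 0 <= tau ^+ 2 * q by rewrite mulr_ge0// sqr_ge0.
  have D0 : 0 < D by rewrite /D; lra.
  (* Rational parametrisation of the great circle through v in the direction x, which is orthogonal
     to v by [rad] and has squared norm q. It remains on the sphere without roots or trigonometry
     and moves v by at most tau B. *)
  pose v' := \row_a (((1 - tau ^+ 2 * q) * v 0 a + 2 * tau * x a) / D).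
  have e' a : v' 0 a = ((1 - tau ^+ 2 * q) * v 0 a + 2 * tau * x a) / D by rewrite mxE.
  have sv' : central_sphere v'.
    split => /=; last first.
      rewrite big1// => a _; case: (boolP (central a)) => ca /=; first by rewrite mul0r.
      by rewrite e' vout// /x (negbTE ca) mul0r !mulr0 addr0 mul0r mulr0 mulr0.
    have -> : \sum_a (central a)%:R * (v' 0 a * v' 0 a) =
       ((1 - tau ^+ 2 * q) ^+ 2 * \sum_a (central a)%:R * (v 0 a * v 0 a)
        + (1 - tau ^+ 2 * q) * 4 * tau * \sum_a v 0 a * x a
        + 4 * tau ^+ 2 * \sum_a x a * x a) / D ^+ 2.
      rewrite !mulr_sumr -!big_split/= mulr_suml; apply: eq_bigr => a _.
      rewrite e'; case: (boolP (central a)) => ca /=.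
        by field; rewrite gt_eqF.
      by rewrite vout// /x (negbTE ca) /= !(mul0r, mulr0, addr0).
    by rewrite vn rad -qE /D; field; rewrite -/D gt_eqF.
  have vd a : `|v 0 a - v' 0 a| <= tau * B.
    have -> : v 0 a - v' 0 a = (2 * tau ^+ 2 * q * v 0 a - 2 * tau * x a) / D.
      rewrite e'; apply: (mulIf (lt0r_neq0 D0)).
      by rewrite mulrBl !divfK ?lt0r_neq0// /D; ring.
    rewrite normrM normfV (gtr0_norm D0) ler_pdivrMr//.
    have tB : tau * B <= tau * B * D by rewrite ler_peMr ?mulr_ge0 ?(ltW t0)// /D; lra.
    apply: le_trans tB; rewrite (le_trans (ler_normB _ _))//.
    have h1 : `|2 * tau ^+ 2 * q * v 0 a| <= 2 * tau * q.
      have c0 : 0 <= 2 * tau ^+ 2 * q by rewrite -mulrA mulr_ge0.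
      rewrite normrM (ger0_norm c0); apply: (@le_trans _ _ (2 * tau ^+ 2 * q * 1)).
        by apply: ler_wpM2l => //; exact: central_sphere_le1.
      rewrite mulr1; apply: ler_wpM2r => //; apply: ler_wpM2l => //.
      by rewrite expr2 ler_piMr// ltW.
    have h2 : `|2 * tau * x a| <= 2 * tau * b.
      by rewrite normrM ger0_norm ?mulr_ge0 ?(ltW t0)// ler_wpM2l ?mulr_ge0 ?(ltW t0).
    by rewrite /B; lra.
  have tB0 : 0 <= tau * B by apply: mulr_ge0 => //; exact: ltW.
  have tt0 : 0 <= 2 * tau by rewrite mulr_ge0// ltW.
  have := hC mu (P v) (P v') (tau * B) (sP v sv) (sP v' sv') (nP v v' _ sv sv' tB0 vd).
  have -> : \sum_a (central a)%:R * (xi a mu (P v) * (P v').2 a) = 2 * tau * q / D.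
    have -> : \sum_a (central a)%:R * (xi a mu (P v) * (P v').2 a) =
      ((1 - tau ^+ 2 * q) * (\sum_a v 0 a * x a) + 2 * tau * \sum_a x a * x a) / D.
      rewrite !mulr_sumr -big_split/= mulr_suml; apply: eq_bigr => a _.
      rewrite /= e' /x; case: (central a) => /=; last by rewrite !(mul0r, mulr0, addr0).
      by field; rewrite gt_eqF.
    by rewrite rad mulr0 add0r -qE.
  have := vmin v' sv'; rewrite -subr_ge0; set K := _ - _ => K0 hK.
  (* The choice mu <= 1 / 2 keeps the amplitude factor away from 0, so the decrease of [kin] is of
     order tau q against an error of order tau^2; letting tau tend to 0 gives q <= 0. *)
  have sig : 1 / 2 <= 1 + mu * scomp (P v').1.
    have := (solves_adm (sP v' sv')).1.1 (inr false); rewrite -/(scomp _) => s1.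
    have : `|mu * scomp (P v').1| <= 1 / 2.
      by rewrite normrM gtr0_norm// (le_trans _ mu_half)// ler_piMr// ltW.
    by rewrite ler_norml => /andP[]; lra.
  have hq : 0 <= 2 * tau * q / D by apply: divr_ge0; [exact: mulr_ge0|exact: ltW].
  have h3 : pi / 2 * (1 / 2) * (2 * tau * q / D) <= C * (tau * B) ^+ 2.
    have : pi / 2 * (1 / 2) * (2 * tau * q / D) <=
       pi / 2 * (1 + mu * scomp (P v').1) * (2 * tau * q / D).
      by rewrite ler_wpM2r// ler_wpM2l// divr_ge0// ltW.
    by lra.
  have h4 : 2 * tau * q / (1 + q) <= 2 * tau * q / D.
    apply: ler_wpM2l; first exact: mulr_ge0.
    by rewrite lef_pV2 ?posrE// /D lerD2l ler_piMl// expr_le1// ltW.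
  rewrite -(ler_pM2l t0).
  have -> : tau * (pi / 2 * q / (1 + q)) = pi / 2 * (1 / 2) * (2 * tau * q / (1 + q)).
    by field; rewrite gt_eqF.
  have -> : tau * (C * B ^+ 2 * tau) = C * (tau * B) ^+ 2 by ring.
  apply: le_trans h3; apply: ler_wpM2l => //.
  by apply: mulr_ge0 => //; apply: divr_ge0 => //; exact: ltW.
have := zero_of_small_slope _ key; rewrite mulr_ge0 ?sqr_ge0// => /(_ isT).
by rewrite pmulr_lle0 ?invr_gt0// pmulr_rle0// divr_gt0.
Qed.

End Core.

(** Undoes the blow-up: e is mu^3 and L is [lam]. The force [c] is the remaining value of [xi] in
    the kernel directions, where the reduction provides no means to remove it. *)
Theorem brake_orbits (R : realType) (n : nat) (p : perturbation R n) (eta : R) :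
  (exists a, freq p a = 1) -> 0 < eta ->
  exists (e L : R) (x : 'I_n -> R -> R) (v c : 'I_n -> R),
  [/\ 0 < e < eta, `|L - 1| < eta, \sum_a v a * v a = 1
    & forall a,
      [/\ even_periodic (x a),
        exists2 x1, is_primitive (x a) x1 & is_primitive x1 (fun t =>
          - L * (freq p a ^+ 2 * x a t + force p (fun b => x b t) a) + c a),
        freq p a != 0 -> c a = 0
        & forall t, `|x a t - e * (v a * cos t)| <= eta * e]].
Proof.
move=> [a0 wa0] eta0; pose mu1 := Num.min 1 (pert_radius p / 3).
have r0 := pert_radius_gt0 p.
have mu1_gt0 : 0 < mu1 by rewrite lt_min ltr01 divr_gt0.
have mu1_le1 : mu1 <= 1 by rewrite ge_min lexx.
have mu1_r0 : 3 * mu1 <= pert_radius p.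
  have : mu1 <= pert_radius p / 3 by rewrite ge_min lexx orbT.
  by lra.
have [|mu2 mu20 hmu2] := critical_state mu1_le1 mu1_r0.
  by exists a0; rewrite /central wa0.
pose mu := Num.min mu1 (Num.min mu2 (eta / 2)).
have m0 : 0 < mu by rewrite lt_min mu1_gt0 lt_min mu20 divr_gt0.
have mm1 : mu <= mu1 by rewrite ge_min lexx.
have mm2 : mu <= mu2 by rewrite !ge_min lexx !orbT.
have mme : mu <= eta / 2 by rewrite !ge_min lexx !orbT.
have mu_le1 : mu <= 1 by exact: le_trans mm1 _.
have hmu : 0 < mu <= mu1 by rewrite m0.
have [P sP [Pout xiP]] := hmu2 mu hmu mm2.
have [[Z1 _] v1] := solves_adm sP.
exists (mu ^+ 3), (lam mu P), (fun a t => mu ^+ 3 * yfun p mu t P a), P.2,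
  (fun a => mu ^+ 3 * (xi p a mu P * (freq p a == 0)%:R)).
have pw (k : nat) : mu ^+ k.+1 <= mu by rewrite exprS ger_pMr// exprn_ile1// ltW.
have m3 : 0 < mu ^+ 3 by rewrite exprn_gt0.
split.
- by rewrite m3 (le_lt_trans (pw 2%N))//; lra.
- rewrite /lam addrAC subrr add0r normrM (ger0_norm (sqr_ge0 _)).
  apply: (@le_lt_trans _ _ (mu * 1)); last by lra.
  by apply: ler_pM => //; [exact: sqr_ge0|exact: Z1].
- rewrite -(solves_sphere sP); apply: eq_bigr => a _.
  by case: (boolP (central p a)) => [_|ca] /=; rewrite ?mul1r// Pout// !mul0r.
move=> a; split.
- by apply: even_periodicZ; apply: (tame_per_yfun p mu1_le1 a).2 => //; exact: solves_adm sP.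
- have [y1 h1 h2] := sol_ode mu1_le1 mu1_r0 sP a.
  exists (fun t => mu ^+ 3 * y1 t); first exact: is_primitiveZ.
  apply: is_primitive_eq (is_primitiveZ (mu ^+ 3) h2) _ => t.
  rewrite /acc /gradient /rho.
  (* Three cases: at frequency 0 the mode [cosw] is constantly 1, at frequency 1 the critical state
     has zero [xi], and elsewhere [cos_coef] is zero by definition. *)
  have -> : xi p a mu P * cosw (freq p a) t = xi p a mu P * (freq p a == 0)%:R.
    have [w0|w0] := eqVneq (freq p a) 0; first by rewrite /cosw w0 mul0r cos0.
    rewrite /= mulr0; have [rw|rw] := boolP (resonant (freq p a)).
      by rewrite xiP ?mul0r//; move: rw; rewrite /resonant (negbTE w0).
    by rewrite /xi cos_coef_nonres// mulr0 mul0r.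
  by field; rewrite gt_eqF.
- by move=> /negbTE ->; rewrite !mulr0.
- move=> t; rewrite -mulrBr normrM (gtr0_norm m3) mulrC ler_wpM2r ?(ltW m3)//.
  have small z : `|z| <= 1 -> `|mu * z| <= eta / 2.
    by move=> z1; rewrite normrM gtr0_norm// (le_trans _ mme)// ler_piMr// ltW.
  have [ca|ca] := boolP (central p a); last first.
    rewrite /yfun (negbTE ca) /= Pout// !mul0r add0r subr0.
    by apply: le_trans (small _ (Z1 _)) _; lra.
  have -> : yfun p mu t P a - P.2 a * cos t =
    mu * (scomp P.1 * (P.2 a * cos t)) + mu * wcomp P.1 a t.
    by rewrite /yfun ca (eqP ca) /cosw mul1r /=; ring.
  have h1 := small _ (Z1 (inl (t, a))).
  have h2 : `|mu * (scomp P.1 * (P.2 a * cos t))| <= eta / 2.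
    apply: small; rewrite normrM mulr_ile1//; first exact: Z1.
    by rewrite normrM mulr_ile1// ler_norml cos_geN1 cos_le1.
  by rewrite (le_trans (ler_normD _ _))//; rewrite -/(wcomp P.1 a t) in h1; lra.
Qed.

(** * The spectral theorem for real symmetric matrices *)

Section Spectral.
Variables (R : realType) (n : nat).
Implicit Types (x y z : 'rV[R]_n) (H : 'M[R]_n).

Definition dot x y : R := (x *m y^T) 0 0.

Lemma dotE x y : dot x y = \sum_a x 0 a * y 0 a.
Proof. by rewrite /dot mxE; apply: eq_bigr => a _; rewrite mxE. Qed.

Lemma dotC x y : dot x y = dot y x.
Proof. by rewrite !dotE; apply: eq_bigr => a _; rewrite mulrC. Qed.

Lemma dotDl x y z : dot (x + y) z = dot x z + dot y z.
Proof. by rewrite /dot mulmxDl mxE. Qed.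

Lemma dotZl (k : R) x y : dot (k *: x) y = k * dot x y.
Proof. by rewrite /dot -scalemxAl mxE. Qed.

Lemma dotDr x y z : dot z (x + y) = dot z x + dot z y.
Proof. by rewrite dotC dotDl !(dotC z). Qed.

Lemma dotZr (k : R) x y : dot y (k *: x) = k * dot y x.
Proof. by rewrite dotC dotZl dotC. Qed.

Lemma dot_ge0 x : 0 <= dot x x.
Proof. by rewrite dotE; apply: sumr_ge0 => a _; rewrite -expr2 sqr_ge0. Qed.

Lemma dot_eq0 x : dot x x = 0 -> x = 0.
Proof.
rewrite dotE => /eqP; rewrite psumr_eq0; last by move=> a _; rewrite -expr2 sqr_ge0.
move=> /allP h; apply/rowP => a; rewrite mxE; have := h a; rewrite mem_index_enum.
by move=> /(_ isT) /=; rewrite -expr2 sqrf_eq0 => /eqP.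
Qed.

Lemma dot_sym H x y : H^T = H -> dot (x *m H) y = dot (y *m H) x.
Proof.
by move=> sH; rewrite dotC /dot trmx_mul sH mulmxA.
Qed.

Lemma zero_of_quadratic (a b : R) : (forall t, 0 <= 2 * t * a + t ^+ 2 * b) -> a = 0.
Proof.
move=> h.
have key (c : R) : (forall t, 0 <= 2 * t * c + t ^+ 2 * b) -> - c <= 0.
  move=> hc; apply: (@zero_of_small_slope _ _ (`|b|)) => // t /andP[t0 t1].
  have := hc t; have -> : 2 * t * c + t ^+ 2 * b = t * (2 * c + t * b) by ring.
  rewrite pmulr_rge0// => h1; have : t * b <= t * `|b| by rewrite ler_wpM2l ?ler_norm// ltW.
  have : 0 <= t * `|b| by rewrite mulr_ge0// ltW.
  lra.
have h1 := key a h; have h2 : - - a <= 0.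
  by apply: key => t; have := h (- t); rewrite sqrrN; lra.
by apply/eqP; rewrite eq_le; lra.
Qed.

Lemma rV_min_continuous (A : set 'rV[R]_n) (f : 'rV[R]_n -> R) : A !=set0 -> closed A ->
  (forall v a, A v -> `|v 0 a| <= 1) -> continuous f ->
  exists2 c, A c & forall v, A v -> f c <= f v.
Proof.
move=> A0 cA A1 cf; have [||c + cmin] := @EVT_min_rV R n f A A0 _ _.
- exact: unit_rV_compact.
- exact: continuous_subspaceT.
- rewrite inE => Ac; exists c => // v Av; apply: cmin; exact: mem_set.
Qed.

Lemma continuous_dot_mul H : continuous (fun x => dot (x *m H) x).
Proof.
have -> : (fun x => dot (x *m H) x) = (fun x => \sum_a (\sum_b x 0 b * H b a) * x 0 a).
  by apply/funext => x; rewrite dotE; apply: eq_bigr => a _; rewrite mxE.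
apply: (@continuous_rV_sum _ _ (fun a x => (\sum_b x 0 b * H b a) * x 0 a)) => a.
apply: (@continuous_rVM _ _ (fun x => \sum_b x 0 b * H b a) (fun x => x 0 a)).
  exact: (@continuous_rV_dot _ _ (fun b => H b a)).
exact: coord_continuous.
Qed.

(** Minimise the quadratic form over unit vectors orthogonal to the rows of [E]; k < n provides such
    vectors. As H is symmetric, this complement is invariant, so it contains the residual x H - l x,
    and minimality in that direction forces the residual to vanish. *)
Lemma eigenrow_orthogonal (k : nat) H (E : 'M[R]_(k, n)) (d : 'rV[R]_k) :
  (k < n)%N -> H^T = H -> E *m H = diag_mx d *m E ->
  exists (x : 'rV[R]_n) (l : R), [/\ dot x x = 1, x *m E^T = 0 & x *m H = l *: x].
Proof.
move=> kn sH EH.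
pose A := [set x : 'rV[R]_n | \sum_a 1 * (x 0 a * x 0 a) = 1] `&`
  \bigcap_(i in [set: 'I_k]) [set x : 'rV[R]_n | \sum_a x 0 a * E i a = 0].
have A1 x : A x <-> dot x x = 1 /\ x *m E^T = 0.
  have e1 : dot x x = \sum_a 1 * (x 0 a * x 0 a).
    by rewrite dotE; apply: eq_bigr => a _; rewrite mul1r.
  have e2 i : (x *m E^T) 0 i = \sum_a x 0 a * E i a.
    by rewrite mxE; apply: eq_bigr => a _; rewrite mxE.
  split=> [[/= h1 h2]|[h1 h2]].
    rewrite e1; split => //; apply/rowP => i; rewrite e2 mxE; exact: h2.
  split => /=; first by rewrite -e1.
  by move=> i _ /=; rewrite -e2 h2 mxE.
have cA : closed A.
  apply: closedI; first by apply: closed_rV_eq; exact: continuous_rV_square.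
  by apply: closed_bigI => i _; apply: closed_rV_eq; exact: (@continuous_rV_dot _ _ (E i)).
have Ale x a : A x -> `|x 0 a| <= 1.
  move=> /A1[h _]; rewrite -(expr_le1 (n := 2)) ?normr_ge0//.
  rewrite -normrX ger0_norm ?sqr_ge0// -h dotE (bigD1 a)//= expr2 lerDl.
  by apply: sumr_ge0 => b _; rewrite -expr2 sqr_ge0.
have norm1 x : x != 0 -> x *m E^T = 0 -> A ((Num.sqrt (dot x x))^-1 *: x).
  move=> x0 xE; have d0 : 0 < dot x x.
    by rewrite lt0r dot_ge0 andbT; apply: contra x0 => /eqP/dot_eq0 ->.
  apply/A1; split; last by rewrite -scalemxAl xE scaler0.
  rewrite dotZl dotZr mulrA -invfM -expr2 sqr_sqrtr ?(ltW d0)// mulVf//.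
  by rewrite gt_eqF.
have A0 : A !=set0.
  have : kermx E^T != 0.
    rewrite -mxrank_eq0 mxrank_ker mxrank_tr -lt0n subn_gt0.
    exact: leq_ltn_trans (rank_leq_row E) kn.
  move=> /rowV0Pn[x /sub_kermxP xE x0]; eexists; exact: norm1 x0 xE.
have [x Ax xmin] := rV_min_continuous A0 cA Ale (continuous_dot_mul (H := H)).
have [xx xE] := (A1 x).1 Ax.
pose l := dot (x *m H) x; exists x, l; split => //.
have ineq u : u *m E^T = 0 -> 0 <= dot (u *m H) u - l * dot u u.
  move=> uE; have [->|u0] := eqVneq u 0.
    by rewrite mul0mx {1 2}/dot !mul0mx !mxE mulr0 subrr.
  have d0 : 0 < dot u u.
    by rewrite lt0r dot_ge0 andbT; apply: contra u0 => /eqP/dot_eq0 ->.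
  have := xmin _ (norm1 u u0 uE); rewrite -/l -scalemxAl dotZl dotZr mulrA -invfM.
  by rewrite -expr2 sqr_sqrtr ?(ltW d0)// [leRHS]mulrC ler_pdivlMr// subr_ge0.
have [z zdef] : exists z, z = x *m H - l *: x by exists (x *m H - l *: x).
have zE : z *m E^T = 0.
  rewrite zdef mulmxBl -scalemxAl xE scaler0 subr0 -mulmxA.
  have -> : H *m E^T = E^T *m diag_mx d.
    by rewrite -[in LHS]sH -trmx_mul EH trmx_mul tr_diag_mx.
  by rewrite mulmxA xE mul0mx.
have zx : dot (x *m H) z - l * dot x z = dot z z.
  by rewrite -mulNr -dotZl -dotDl scaleNr -zdef.
apply/eqP; rewrite -subr_eq0 -zdef; apply/eqP/dot_eq0.
(* Along x + t z the form minus l times the squared norm is nonnegative and has no constant term, so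
   its linear coefficient, the squared norm of z, is zero. *)
rewrite -zx; apply: (@zero_of_quadratic _ (dot (z *m H) z - l * dot z z)) => t.
have := ineq (x + t *: z); rewrite mulmxDl -[t *: z *m _]scalemxAl xE zE scaler0 addr0.
move=> /(_ erefl); rewrite mulmxDl -scalemxAl !(dotDl, dotDr, dotZl, dotZr).
rewrite xx -/l (dot_sym z x sH) (dotC z x) => h.
apply: le_trans h _; rewrite le_eqVlt; apply/orP; left; apply/eqP; ring.
Qed.

(** Orthonormal eigenrows are collected one at a time, which is why the induction runs over
    rectangular matrices with k <= n rows. *)
Lemma symmetric_spectral H : H^T = H ->
  exists (E : 'M[R]_n) (d : 'rV[R]_n), E *m E^T = 1%:M /\ E *m H = diag_mx d *m E.
Proof.
move=> sH.
suff : forall k, (k <= n)%N -> exists (E : 'M[R]_(k, n)) (d : 'rV[R]_k),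
    E *m E^T = 1%:M /\ E *m H = diag_mx d *m E by apply.
elim=> [_|k IH kn].
  exists 0, 0; split; first by apply/matrixP => -[].
  by rewrite mul0mx mulmx0.
have [E [d [EE EH]]] := IH (ltnW kn).
have [x [l [xx xE xH]]] := eigenrow_orthogonal kn sH EH.
suff : exists (E : 'M[R]_(1 + k, n)) (d : 'rV[R]_(1 + k)),
    E *m E^T = 1%:M /\ E *m H = diag_mx d *m E by [].
exists (col_mx x E), (row_mx (l%:M : 'M[R]_1) d); split.
  rewrite tr_col_mx mul_col_row xE EE.
  have -> : E *m x^T = 0 by rewrite -[E]trmxK -trmx_mul xE trmx0.
  have -> : x *m x^T = 1%:M by rewrite [LHS]mx11_scalar -/(dot x x) xx.
  by rewrite -scalar_mx_block.
rewrite mul_col_mx xH EH diag_mx_row mul_block_col !mul0mx addr0 add0r.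
congr (col_mx _ _); apply/rowP => a; rewrite mxE mul_diag_mx !mxE.
by rewrite eqxx mulr1n.
Qed.

End Spectral.

(** * The potential near the equilibrium triangle *)

Section Potential.
Variable R : realType.
Implicit Types (q e u : config R) (s t a b : R) (i j : 'I_3).

Lemma is_derive1D (f g : R -> R) t (a b : R) : is_derive t 1 f a -> is_derive t 1 g b ->
  is_derive t 1 (fun x => f x + g x) (a + b).
Proof. exact: is_deriveD. Qed.

Lemma is_derive1M (f g : R -> R) t (a b : R) : is_derive t 1 f a -> is_derive t 1 g b ->
  is_derive t 1 (fun x => f x * g x) (a * g t + f t * b).
Proof.
move=> fa gb; have := @is_deriveM _ _ _ _ _ _ _ _ fa gb.
by move=> h; apply: (is_derive_eq h); rewrite /GRing.scale/= addrC [g t * a]mulrC.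
Qed.

Lemma is_derive1Z (c : R) (f : R -> R) t (a : R) : is_derive t 1 f a ->
  is_derive t 1 (fun x => c * f x) (c * a).
Proof. exact: is_deriveZ. Qed.

Lemma is_derive1_sum (I : finType) (P : pred I) (f : I -> R -> R) (d : I -> R) t :
  (forall x, P x -> is_derive t 1 (f x) (d x)) ->
  is_derive t 1 (fun x => \sum_(z | P z) f z x) (\sum_(x | P x) d x).
Proof.
move=> Ff; have -> : (fun x => \sum_(z | P z) f z x) = \sum_(z | P z) f z.
  by apply/funext => z; rewrite fct_sumE.
elim/big_ind2 : _ => //; first exact: is_derive_cst.
by move=> G a H b Ga Hb; exact: is_deriveD.
Qed.

Lemma is_derive1_chain (f g : R -> R) t (a b : R) : is_derive (g t) 1 f a ->
  is_derive t 1 g b -> is_derive t 1 (fun x => f (g x)) (a * b).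
Proof. exact: is_derive1_comp. Qed.

(** The pair potential as a function of the squared distance, which is polynomial in the
    configuration; square roots are confined to one variable. *)
Definition spring (A B s : R) : R := A / Num.sqrt s + B / Num.sqrt s ^+ 3.

Definition spring' (A B s : R) : R :=
  - 2^-1 * ((Num.sqrt s)^-1 ^+ 3 * (A + 3 * B * (Num.sqrt s)^-1 ^+ 2)).

(** The cofactor of s - s0 in [spring'], where s0 is the critical squared distance; at s0 it is the
    second derivative. It is positive for A < 0 and s > 0. *)
Definition stiffness (A s : R) : R := - 2^-1 * A * (Num.sqrt s)^-1 ^+ 5.

Lemma is_derive_isqrt s : 0 < s ->
  is_derive s 1 (fun x => (Num.sqrt x)^-1) (- 2^-1 * (Num.sqrt s)^-1 ^+ 3).
Proof.
move=> s0; have u0 : Num.sqrt s != 0 by rewrite gt_eqF// sqrtr_gt0.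
apply: (is_derive_eq (is_deriveV u0 (is_derive1_sqrt s0))).
by rewrite /GRing.scale/=; field.
Qed.

Lemma is_derive_powr (n : nat) (f : R -> R) t (a : R) : is_derive t 1 f a ->
  is_derive t 1 (fun x => f x ^+ n) (n%:R * f t ^+ n.-1 * a).
Proof.
move=> fa; have -> : (fun x => f x ^+ n) = f ^+ n by apply/funext => x; rewrite exprfctE.
exact: is_deriveX.
Qed.

Lemma is_derive_spring (A B s : R) : 0 < s -> is_derive s 1 (spring A B) (spring' A B s).
Proof.
move=> s0; have h := is_derive_isqrt s0.
have -> : spring A B = fun x => A * (Num.sqrt x)^-1 + B * (Num.sqrt x)^-1 ^+ 3.
  by apply/funext => x; rewrite /spring exprVn.
apply: (is_derive_eq (is_derive1D (is_derive1Z A h) (is_derive1Z B (is_derive_powr 3 h)))).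
by rewrite /spring' /=; ring.
Qed.

Lemma spring'_factor (A B s s0 : R) : 0 < s -> A * s0 = - (3 * B) ->
  spring' A B s = stiffness A s * (s - s0).
Proof.
move=> sp h; rewrite /spring' /stiffness.
have u0 : Num.sqrt s != 0 by rewrite gt_eqF// sqrtr_gt0.
have us : s = Num.sqrt s ^+ 2 by rewrite sqr_sqrtr// ltW.
have -> : - 2^-1 * A * (Num.sqrt s)^-1 ^+ 5 * (s - s0) =
  - 2^-1 * (Num.sqrt s)^-1 ^+ 5 * (A * s - A * s0) by ring.
rewrite h; have -> : A * s = A * Num.sqrt s ^+ 2 by rewrite -us.
by field.
Qed.

Lemma is_derive_spring' (A B s : R) : 0 < s -> A * s = - (3 * B) ->
  is_derive s 1 (spring' A B) (stiffness A s).
Proof.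
move=> sp h; have u0 : Num.sqrt s != 0 by rewrite gt_eqF// sqrtr_gt0.
have d := is_derive_isqrt sp.
have us : s = Num.sqrt s ^+ 2 by rewrite sqr_sqrtr// ltW.
have d2 := is_derive1D (is_derive_cst A s 1) (is_derive1Z (3 * B) (is_derive_powr 2 d)).
apply: (is_derive_eq (is_derive1Z (- 2^-1) (is_derive1M (is_derive_powr 3 d) d2))).
rewrite /stiffness /=; have eA : A = - (3 * B) * (Num.sqrt s)^-1 ^+ 2.
  have -> : - (3 * B) = A * Num.sqrt s ^+ 2 by rewrite -us -h.
  by field.
by rewrite eA; field.
Qed.

Definition pdiff q i j (k : 'I_2) : R := q i k - q j k.

(** Polarisation of the squared distance between the points i and j. *)
Definition pdot q e i j : R := \sum_k pdiff q i j k * pdiff e i j k.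

Lemma pdotC q e i j : pdot q e i j = pdot e q i j.
Proof. by apply: eq_bigr => k _; rewrite mulrC. Qed.

Lemma pdotDl q u e i j : pdot (q + u) e i j = pdot q e i j + pdot u e i j.
Proof. by rewrite -big_split; apply: eq_bigr => k _; rewrite /pdiff !mxE /=; ring. Qed.

Lemma pdotZl (c : R) q e i j : pdot (c *: q) e i j = c * pdot q e i j.
Proof. by rewrite mulr_sumr; apply: eq_bigr => k _; rewrite /pdiff !mxE; ring. Qed.

Lemma pdotDr q u e i j : pdot e (q + u) i j = pdot e q i j + pdot e u i j.
Proof. by rewrite pdotC pdotDl !(pdotC e). Qed.

Lemma pdotZr (c : R) q e i j : pdot e (c *: q) i j = c * pdot e q i j.
Proof. by rewrite pdotC pdotZl pdotC. Qed.

Lemma pdot0r e i j : pdot e 0 i j = 0.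
Proof. by rewrite -(scale0r 0) pdotZr mul0r. Qed.

Lemma pdot_sumr (I : finType) e (f : I -> config R) i j :
  pdot e (\sum_x f x) i j = \sum_x pdot e (f x) i j.
Proof. by elim/big_ind2 : _ => [|u a v b <- <-|//]; [exact: pdot0r|exact: pdotDr]. Qed.

Lemma dist_pdot q i j : Defs.dist q i j = Num.sqrt (pdot q q i j).
Proof.
rewrite /Defs.dist /norm2; congr Num.sqrt; apply: eq_bigr => k _.
by rewrite /pdiff !mxE expr2.
Qed.

Lemma pdot_ge0 q i j : 0 <= pdot q q i j.
Proof. by apply: sumr_ge0 => k _; rewrite -expr2 sqr_ge0. Qed.

Lemma Omega_pdot q i j : Omega R q -> (i < j)%N -> 0 < pdot q q i j.
Proof.
move=> qO ij; have nij : i != j by apply: contraTneq ij => ->; rewrite ltnn.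
rewrite lt0r pdot_ge0 andbT; apply: contraNneq (qO i j nij) => /eqP.
rewrite psumr_eq0; last by move=> k _; rewrite -expr2 sqr_ge0.
move=> /allP h; apply/eqP/rowP => k; have := h k; rewrite mem_index_enum => /(_ isT) /=.
by rewrite -expr2 sqrf_eq0 /pdiff subr_eq0 => /eqP; rewrite !mxE.
Qed.

Variables A B : 'I_3 -> 'I_3 -> R.
Local Notation U := (schwarzschild A B).

Definition dU q e : R := \sum_(i < 3) \sum_(j < 3 | (i < j)%N)
  spring' (A i j) (B i j) (pdot q q i j) * (2 * pdot q e i j).

Lemma schwarzschildE q :
  U q = \sum_(i < 3) \sum_(j < 3 | (i < j)%N) spring (A i j) (B i j) (pdot q q i j).
Proof. by apply: eq_bigr => i _; apply: eq_bigr => j _; rewrite dist_pdot. Qed.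

Lemma is_derive_pdot_line q e u i j t :
  is_derive t 1 (fun t => pdot (q + t *: e) u i j) (pdot e u i j).
Proof.
have -> : (fun t => pdot (q + t *: e) u i j) = (fun t => pdot q u i j + pdot e u i j * t).
  by apply/funext => z; rewrite pdotDl pdotZl mulrC.
apply: (is_derive_eq (is_derive1D (is_derive_cst _ t 1)
  (is_derive1Z _ (is_derive_id t 1)))); ring.
Qed.

Lemma is_derive_sq_line q e i j t :
  is_derive t 1 (fun t => pdot (q + t *: e) (q + t *: e) i j)
                (2 * pdot (q + t *: e) e i j).
Proof.
have -> : (fun t => pdot (q + t *: e) (q + t *: e) i j) =
  (fun t => pdot (q + t *: e) q i j + t * pdot (q + t *: e) e i j).
  by apply/funext => z; rewrite pdotDr pdotZr.
have h := is_derive1D (is_derive_pdot_line q e q i j t)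
  (is_derive1M (is_derive_id t 1) (is_derive_pdot_line q e e i j t)).
apply: (is_derive_eq h); rewrite pdotDl pdotZl (pdotC e q) /=; ring.
Qed.

Lemma is_derive_U_line q e t : (forall i j, (i < j)%N ->
    0 < pdot (q + t *: e) (q + t *: e) i j) ->
  is_derive t 1 (fun t => U (q + t *: e)) (dU (q + t *: e) e).
Proof.
move=> pos.
have -> : (fun t => U (q + t *: e)) = (fun t => \sum_(i < 3) \sum_(j < 3 | (i < j)%N)
   spring (A i j) (B i j) (pdot (q + t *: e) (q + t *: e) i j)).
  by apply/funext => z; exact: schwarzschildE.
apply: is_derive1_sum => i _; apply: is_derive1_sum => j ij.
exact: is_derive1_chain (is_derive_spring _ _ (pos i j ij)) (is_derive_sq_line q e i j t).
Qed.

(** A directional derivative looks along one line only, so one-variable calculus suffices for the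
    gradient and the Hessian. *)
Lemma is_derive_line (f : config R -> R) q e (d : R) :
  is_derive (0 : R) 1 (fun t => f (q + t *: e)) d -> is_derive q e f d.
Proof.
have E : (fun h : R => h^-1 *: ((f \o shift q) (h *: e) - f q)) =
    (fun h => h^-1 *: (((fun t => f (q + t *: e)) \o shift (0 : R)) (h *: (1 : R))
       - f (q + 0 *: e))).
  apply/funext => h /=; rewrite addr0 scale0r addr0 [q + _]addrC.
  by rewrite /(_ *: 1) /= mulr1.
by move=> [h1 h2]; apply: DeriveDef; rewrite /derivable /derive E.
Qed.

Lemma is_derive_U q e : Omega R q -> is_derive q e U (dU q e).
Proof.
move=> qO; apply: is_derive_line.
have := @is_derive_U_line q e 0; rewrite scale0r addr0; apply => i j.
exact: Omega_pdot.
Qed.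

Lemma grad_dU q i k : Omega R q -> grad U q i k = dU q (delta_mx i k).
Proof. by move=> qO; rewrite mxE; have [_ ->] := is_derive_U (delta_mx i k) qO. Qed.

Lemma dU_D q e u : dU q (e + u) = dU q e + dU q u.
Proof.
rewrite -big_split; apply: eq_bigr => i _; rewrite -big_split; apply: eq_bigr => j _.
by rewrite pdotDr /=; ring.
Qed.

Lemma dU_Z (c : R) q e : dU q (c *: e) = c * dU q e.
Proof.
rewrite mulr_sumr; apply: eq_bigr => i _; rewrite mulr_sumr; apply: eq_bigr => j _.
by rewrite pdotZr; ring.
Qed.

Lemma dU_sum (I : finType) q (f : I -> config R) :
  dU q (\sum_x f x) = \sum_x dU q (f x).
Proof.
elim/big_ind2 : _ => [|u a v b <- <-|//]; last exact: dU_D.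
by rewrite -(scale0r 0) dU_Z mul0r.
Qed.

Variable q0 : config R.
Hypothesis q0_near : \forall q \near q0, Omega R q.
Hypothesis AB_crit : forall i j, (i < j)%N -> A i j * pdot q0 q0 i j = - (3 * B i j).

(** The Hessian as a bilinear form. Since [spring'] vanishes at the critical distances, second
    derivatives of the squared distances drop out and a weighted sum of products of the linear forms
    [pdot q0] remains; its sign and kernel can be read off. *)
Definition quad e u : R := \sum_(i < 3) \sum_(j < 3 | (i < j)%N)
  4 * stiffness (A i j) (pdot q0 q0 i j) * pdot q0 e i j * pdot q0 u i j.

Lemma quadC e u : quad e u = quad u e.
Proof. by apply: eq_bigr => i _; apply: eq_bigr => j _; rewrite mulrAC. Qed.

Lemma quadDl e u v : quad (e + u) v = quad e v + quad u v.
Proof.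
rewrite -big_split; apply: eq_bigr => i _ /=.
by rewrite -big_split; apply: eq_bigr => j _; rewrite pdotDr /=; ring.
Qed.

Lemma quadZl (c : R) e u : quad (c *: e) u = c * quad e u.
Proof.
rewrite mulr_sumr; apply: eq_bigr => i _; rewrite mulr_sumr.
by apply: eq_bigr => j _; rewrite pdotZr; ring.
Qed.

Lemma quad_suml (I : finType) (f : I -> config R) u :
  quad (\sum_x f x) u = \sum_x quad (f x) u.
Proof.
elim/big_ind2 : _ => [|v a w b <- <-|//]; last exact: quadDl.
by rewrite -(scale0r 0) quadZl mul0r.
Qed.

Lemma hessian_quad (a b : 'I_(3 * 2)) : hessian U q0 a b = quad (basis_vec R a) (basis_vec R b).
Proof.
rewrite mxE; set e := basis_vec R a; set u := basis_vec R b.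
have q0O : Omega R q0 := nbhs_singleton q0_near.
have -> : 'D_e ('D_u U) q0 = 'D_e (fun q => dU q u) q0.
  apply: near_eq_derive; apply: filterS q0_near => q qO.
  by have [_ ->] := is_derive_U u qO.
suff [_ ->] : is_derive q0 e (fun q => dU q u) (quad e u) by [].
apply: is_derive_line; apply: is_derive1_sum => i _; apply: is_derive1_sum => j ij.
have pos := Omega_pdot q0O ij.
have e0 : q0 + 0 *: e = q0 by rewrite scale0r addr0.
have d1 := is_derive_sq_line q0 e i j 0.
have d2 : is_derive (pdot (q0 + 0 *: e) (q0 + 0 *: e) i j) 1 (spring' (A i j) (B i j))
    (stiffness (A i j) (pdot q0 q0 i j)).
  by rewrite e0; apply: is_derive_spring' => //; exact: AB_crit.
have d3 := is_derive1Z 2 (is_derive_pdot_line q0 e u i j 0).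
apply: (is_derive_eq (is_derive1M (is_derive1_chain d2 d1) d3)).
rewrite /= !e0 (spring'_factor pos (AB_crit ij)) subrr mulr0 mul0r addr0; ring.
Qed.

End Potential.

(** * A calculus of Lipschitz maps vanishing to first or second order *)

Section Remainders.
Variables (R : realType) (n : nat) (rho : R).
Notation vec := ('I_n -> R).
Hypothesis rho0 : 0 < rho.
Hypothesis rho1 : rho <= 1.
Implicit Types (f g : vec -> R).

Definition in_ball (x : vec) (e : R) := forall a, `|x a| <= e.

Definition lip_on f := exists2 C : R, 0 <= C & forall (x x' : vec) (d : R),
  in_ball x rho -> in_ball x' rho -> 0 <= d -> (forall a, `|x a - x' a| <= d) ->
  `|f x| <= C /\ `|f x - f x'| <= C * d.

Definition vanishing f := lip_on f /\ f (fun=> 0) = 0.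

(** Second-order vanishing expressed through differences: on the ball of radius e the Lipschitz
    constant is at most C e, as [force_lip] demands. *)
Definition quadratic f := f (fun=> 0) = 0 /\
  exists2 C : R, 0 <= C & forall (x x' : vec) (e d : R), e <= rho ->
    in_ball x e -> in_ball x' e -> 0 <= e -> 0 <= d -> (forall a, `|x a - x' a| <= d) ->
    `|f x - f x'| <= C * e * d.

Lemma in_ball0 e : 0 <= e -> in_ball (fun=> 0) e.
Proof. by move=> e0 a; rewrite normr0. Qed.

Lemma in_ballW x e e' : e <= e' -> in_ball x e -> in_ball x e'.
Proof. by move=> ee xe a; exact: le_trans (xe a) ee. Qed.

Lemma lipschitz_cst (c : R) : lip_on (fun=> c).
Proof.
exists `|c| => // x x' d _ _ d0 _; split => //.
by rewrite subrr normr0 mulr_ge0.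
Qed.

Lemma lipschitzD f g : lip_on f -> lip_on g -> lip_on (fun x => f x + g x).
Proof.
move=> [C C0 hf] [D D0 hg]; exists (C + D); first exact: addr_ge0.
move=> x x' d xr xr' d0 xd.
have [f1 f2] := hf x x' d xr xr' d0 xd; have [g1 g2] := hg x x' d xr xr' d0 xd.
split; first by rewrite (le_trans (ler_normD _ _))// lerD.
by rewrite opprD addrACA mulrDl (le_trans (ler_normD _ _))// lerD.
Qed.

Lemma lipschitzM f g : lip_on f -> lip_on g -> lip_on (fun x => f x * g x).
Proof.
move=> [C C0 hf] [D D0 hg]; exists (C * D + D * C); first by rewrite addr_ge0 ?mulr_ge0.
move=> x x' d xr xr' d0 xd.
have [f1 f2] := hf x x' d xr xr' d0 xd; have [g1 g2] := hg x x' d xr xr' d0 xd.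
have xd' a : `|x' a - x a| <= d by rewrite distrC.
have [f3 _] := hf x' x d xr' xr d0 xd'.
split; first by rewrite normrM (le_trans (ler_pM _ _ f1 g1))// lerDl mulr_ge0.
have -> : f x * g x - f x' * g x' = f x' * (g x - g x') + g x * (f x - f x') by ring.
rewrite (le_trans (ler_normD _ _))// mulrDl !normrM.
by apply: lerD; rewrite -mulrA; apply: ler_pM.
Qed.

Lemma lipschitzZ (c : R) f : lip_on f -> lip_on (fun x => c * f x).
Proof. by apply: lipschitzM; exact: lipschitz_cst. Qed.

Lemma lipschitzX k f : lip_on f -> lip_on (fun x => f x ^+ k).
Proof.
move=> lf; elim: k => [|k IH]; first exact: (lipschitz_cst 1).
have -> : (fun x => f x ^+ k.+1) = (fun x => f x * f x ^+ k).
  by apply/funext => x; rewrite exprS.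
exact: lipschitzM.
Qed.

Lemma lipschitz_isqrt f (m : R) : 0 < m -> lip_on f ->
  (forall x, in_ball x rho -> m <= f x) ->
  lip_on (fun x => (Num.sqrt (f x))^-1).
Proof.
move=> m0 [C C0 hf] fm; pose k := Num.sqrt m.
have k0 : 0 < k by rewrite sqrtr_gt0.
have k3 : 0 < k ^+ 3 by rewrite exprn_gt0.
have ki0 : 0 <= k^-1 by rewrite invr_ge0 ltW.
exists (k^-1 + C * k^-1 ^+ 3); first by rewrite addr_ge0// mulr_ge0// exprn_ge0.
move=> x x' d xr xr' d0 xd; have [_ f2] := hf x x' d xr xr' d0 xd.
have low y : in_ball y rho -> k <= Num.sqrt (f y) by move=> yr; rewrite ler_wsqrtr// fm.
have [u1 u2] := (low x xr, low x' xr').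
have fx0 : 0 <= f x by rewrite (le_trans (ltW m0))// fm.
have fx0' : 0 <= f x' by rewrite (le_trans (ltW m0))// fm.
set u := Num.sqrt (f x); set u' := Num.sqrt (f x').
have up : 0 < u by exact: lt_le_trans u1.
have up' : 0 < u' by exact: lt_le_trans u2.
have iu : u^-1 <= k^-1 by rewrite lef_pV2.
have iu' : u'^-1 <= k^-1 by rewrite lef_pV2.
split.
  rewrite ger0_norm ?invr_ge0 ?(ltW up)//; apply: le_trans iu _.
  by rewrite lerDl mulr_ge0// exprn_ge0.
have -> : u^-1 - u'^-1 = (f x' - f x) * (u^-1 * (u'^-1 * (u + u')^-1)).
  rewrite -[f x]sqr_sqrtr// -[f x']sqr_sqrtr// -/u -/u'.
  by field; rewrite !gt_eqF// addr_gt0.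
have iuu : (u + u')^-1 <= k^-1.
  by rewrite lef_pV2 ?posrE ?addr_gt0// (le_trans u1)// lerDl ltW.
rewrite normrM distrC mulrDl.
apply: (@le_trans _ _ (C * d * k^-1 ^+ 3)).
  apply: ler_pM => //.
  have p0 : 0 <= u'^-1 * (u + u')^-1.
    by rewrite mulr_ge0// invr_ge0 ltW// addr_gt0.
  have p1 : 0 <= u^-1 by rewrite invr_ge0 ltW.
  have -> : k^-1 ^+ 3 = k^-1 * (k^-1 * k^-1) by ring.
  rewrite ger0_norm; last exact: mulr_ge0.
  apply: ler_pM => //; apply: ler_pM => //; first by rewrite invr_ge0 ltW.
  by rewrite invr_ge0 ltW// addr_gt0.
by rewrite mulrAC lerDr mulr_ge0.
Qed.

Lemma vanishing_linear (c : vec) : vanishing (fun x => \sum_a x a * c a).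
Proof.
split; last by rewrite big1// => a _; rewrite mul0r.
exists (\sum_a `|c a|); first exact: sumr_ge0.
have key (x : vec) e : in_ball x e -> `|\sum_a x a * c a| <= (\sum_a `|c a|) * e.
  move=> xe; rewrite mulr_suml (le_trans (ler_norm_sum _ _ _))//; apply: ler_sum => a _.
  by rewrite normrM mulrC ler_wpM2l.
move=> x x' d xr xr' d0 xd; split.
  by rewrite (le_trans (key x rho xr))// ler_piMr// sumr_ge0.
rewrite -sumrB; rewrite (eq_bigr (fun a => (x a - x' a) * c a)); first exact: key.
by move=> a _; rewrite mulrBl.
Qed.

Lemma vanishingD f g : vanishing f -> vanishing g -> vanishing (fun x => f x + g x).
Proof.
by move=> [lf f0] [lg g0]; split; [exact: lipschitzD|rewrite f0 g0 addr0].
Qed.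

Lemma vanishingM f g : vanishing f -> lip_on g -> vanishing (fun x => f x * g x).
Proof. by move=> [lf f0] lg; split; [exact: lipschitzM|rewrite f0 mul0r]. Qed.

Lemma vanishing_sub f : lip_on f -> vanishing (fun x => f x - f (fun=> 0)).
Proof.
by move=> lf; split; [apply: lipschitzD => //; exact: lipschitz_cst|rewrite subrr].
Qed.

Lemma quadratic_vanishingM f g : vanishing f -> vanishing g -> quadratic (fun x => f x * g x).
Proof.
move=> [[C C0 hf] f0] [[D D0 hg] g0]; split; first by rewrite f0 mul0r.
exists (C * D + D * C); first by rewrite addr_ge0 ?mulr_ge0.
move=> x x' e d er xe xe' e0 d0 xd.
have [xr xr'] := (in_ballW er xe, in_ballW er xe').
have [_ f2] := hf x x' d xr xr' d0 xd; have [_ g2] := hg x x' d xr xr' d0 xd.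
have z y : in_ball y e -> forall a, `|y a - 0| <= e by move=> ye a; rewrite subr0.
have [_ f3] := hf x' (fun=> 0) e xr' (in_ball0 (ltW rho0)) e0 (z _ xe').
have [_ g3] := hg x (fun=> 0) e xr (in_ball0 (ltW rho0)) e0 (z _ xe).
rewrite f0 subr0 in f3; rewrite g0 subr0 in g3.
have -> : f x * g x - f x' * g x' = f x' * (g x - g x') + g x * (f x - f x') by ring.
rewrite (le_trans (ler_normD _ _))// !normrM.
have -> : (C * D + D * C) * e * d = C * e * (D * d) + D * e * (C * d) by ring.
by apply: lerD; apply: ler_pM.
Qed.

Lemma quadratic_lipschitzM f g : quadratic f -> lip_on g -> quadratic (fun x => f x * g x).
Proof.
move=> [f0 [C C0 hf]] [D D0 hg]; split; first by rewrite f0 mul0r.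
exists (C * D + C * D); first by rewrite addr_ge0 ?mulr_ge0.
move=> x x' e d er xe xe' e0 d0 xd.
have [xr xr'] := (in_ballW er xe, in_ballW er xe').
have f2 := hf x x' e d er xe xe' e0 d0 xd; have [g1 g2] := hg x x' d xr xr' d0 xd.
have z a : `|x' a - 0| <= e by rewrite subr0.
have f3 := hf x' (fun=> 0) e e er xe' (in_ball0 e0) e0 e0 z.
rewrite f0 subr0 in f3.
have {}f3 : `|f x'| <= C * e.
  by rewrite (le_trans f3)// ler_piMr ?mulr_ge0// (le_trans er).
have -> : f x * g x - f x' * g x' = (f x - f x') * g x + f x' * (g x - g x') by ring.
rewrite (le_trans (ler_normD _ _))// !normrM.
have -> : (C * D + C * D) * e * d = (C * e * d) * D + C * e * (D * d) by ring.
by apply: lerD; apply: ler_pM.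
Qed.

Lemma quadraticD f g : quadratic f -> quadratic g -> quadratic (fun x => f x + g x).
Proof.
move=> [f0 [C C0 hf]] [g0 [D D0 hg]]; split; first by rewrite f0 g0 addr0.
exists (C + D); first exact: addr_ge0.
move=> x x' e d er xe xe' e0 d0 xd.
rewrite opprD addrACA !mulrDl (le_trans (ler_normD _ _))//.
by apply: lerD; [exact: hf|exact: hg].
Qed.

Lemma quadratic0 : quadratic (fun=> 0).
Proof.
by split => //; exists 0 => // x x' e d _ _ _ _ _ _; rewrite subrr normr0 !mul0r.
Qed.

Lemma quadraticZ (c : R) f : quadratic f -> quadratic (fun x => c * f x).
Proof.
move=> qf; have -> : (fun x => c * f x) = (fun x => f x * c).
  by apply/funext => x; rewrite mulrC.
by apply: quadratic_lipschitzM => //; exact: lipschitz_cst.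
Qed.

Lemma quadratic_sum (I : finType) (P : pred I) (f : I -> vec -> R) :
  (forall i, P i -> quadratic (f i)) -> quadratic (fun x => \sum_(i | P i) f i x).
Proof.
move=> qf; have -> : (fun x => \sum_(i | P i) f i x) = \sum_(i | P i) f i.
  by apply/funext => x; rewrite fct_sumE.
elim/big_ind : _ => //; first exact: quadratic0.
by move=> g h; exact: quadraticD.
Qed.

Lemma quadratic_unif (f : 'I_n -> vec -> R) : (forall a, quadratic (f a)) ->
  exists2 C : R, 0 <= C & forall a (x x' : vec) (e d : R), e <= rho ->
    in_ball x e -> in_ball x' e -> 0 <= e -> 0 <= d -> (forall a, `|x a - x' a| <= d) ->
    `|f a x - f a x'| <= C * e * d.
Proof.
move=> qf; have /choice[C hC] : forall a, exists C : R, 0 <= C /\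
    forall (x x' : vec) (e d : R), e <= rho ->
    in_ball x e -> in_ball x' e -> 0 <= e -> 0 <= d -> (forall a, `|x a - x' a| <= d) ->
    `|f a x - f a x'| <= C * e * d.
  by move=> a; have [_ [C C0 h]] := qf a; exists C.
exists (\sum_a C a); first by apply: sumr_ge0 => a _; case: (hC a).
move=> a x x' e d er xe xe' e0 d0 xd.
have [_ /(_ x x' e d er xe xe' e0 d0 xd) h] := hC a.
rewrite (le_trans h)// -!mulrA ler_wpM2r ?mulr_ge0// (bigD1 a)//= lerDl.
by apply: sumr_ge0 => b _; case: (hC b).
Qed.

End Remainders.

(** * The three-body potential in eigencoordinates as a perturbation *)

Section SpringPerturbation.
Variables (R : realType) (A B : 'I_3 -> 'I_3 -> R) (q0 : config R).
Variables (n : nat) (E : 'I_n -> config R) (d : 'I_n -> R) (beta rho m : R).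
Notation vec := ('I_n -> R).
Local Notation U := (schwarzschild A B).

Implicit Types (i j : 'I_3) (e : config R).

Hypothesis AB_crit : forall i j : 'I_3, (i < j)%N -> A i j * pdot q0 q0 i j = - (3 * B i j).
Hypothesis quad_E : forall a b, quad A q0 (E a) (E b) = d b * (a == b)%:R.
Hypothesis beta0 : 0 < beta.
Hypothesis rho0 : 0 < rho.
Hypothesis rho1 : rho <= 1.
Hypothesis m0 : 0 < m.

Definition shift_by (x : vec) : config R := \sum_a x a *: E a.
Definition conf (x : vec) : config R := q0 + shift_by x.

Hypothesis conf_pos : forall x, in_ball x rho ->
  forall i j : 'I_3, (i < j)%N -> m <= pdot (conf x) (conf x) i j.

Lemma shift_by0 : shift_by (fun=> 0) = 0.
Proof. by rewrite /shift_by big1// => a _; rewrite scale0r. Qed.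

Lemma conf0 : conf (fun=> 0) = q0.
Proof. by rewrite /conf shift_by0 addr0. Qed.

Lemma vanishing_pdot_shift e i j : vanishing rho (fun x => pdot (shift_by x) e i j).
Proof.
have -> : (fun x => pdot (shift_by x) e i j) = (fun x => \sum_a x a * pdot (E a) e i j).
  by apply/funext => x; rewrite pdotC pdot_sumr; apply: eq_bigr => a _; rewrite pdotZr pdotC.
exact: vanishing_linear.
Qed.

Lemma quadratic_pdot_shift2 i j : quadratic rho (fun x => pdot (shift_by x) (shift_by x) i j).
Proof.
have -> : (fun x => pdot (shift_by x) (shift_by x) i j) =
    (fun x => \sum_(k < 2) pdiff (shift_by x) i j k * pdiff (shift_by x) i j k) by [].
apply: quadratic_sum => k _.
have v : vanishing rho (fun x => pdiff (shift_by x) i j k).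
  have -> : (fun x => pdiff (shift_by x) i j k) = (fun x => \sum_a x a * pdiff (E a) i j k).
    apply/funext => x; rewrite /pdiff /shift_by !summxE -sumrB; apply: eq_bigr => a _.
    by rewrite !mxE mulrBr.
  exact: vanishing_linear.
exact: quadratic_vanishingM.
Qed.

Lemma lipschitz_pdot_conf e i j : lip_on rho (fun x => pdot (conf x) e i j).
Proof.
have -> : (fun x => pdot (conf x) e i j) =
    (fun x => pdot q0 e i j + pdot (shift_by x) e i j).
  by apply/funext => x; rewrite pdotDl.
apply: lipschitzD; first exact: lipschitz_cst.
by case: (vanishing_pdot_shift e i j).
Qed.

Lemma vanishing_pdot_shift2 i j : vanishing rho (fun x => pdot (shift_by x) (shift_by x) i j).
Proof.
have -> : (fun x => pdot (shift_by x) (shift_by x) i j) =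
    (fun x => \sum_a x a * pdot (E a) (shift_by x) i j).
  apply/funext => x; rewrite {1}/shift_by pdotC pdot_sumr.
  by apply: eq_bigr => a _; rewrite pdotZr pdotC.
have v a : vanishing rho (fun x : vec => x a).
  have -> : (fun x : vec => x a) = (fun x => \sum_b x b * (b == a)%:R).
    apply/funext => x; rewrite (bigD1 a)//= eqxx mulr1 big1 ?addr0// => b /negbTE ->.
    by rewrite mulr0.
  exact: vanishing_linear.
split; last by rewrite big1// => a _; rewrite mul0r.
have -> : (fun x => \sum_a x a * pdot (E a) (shift_by x) i j) =
    \sum_a (fun x : vec => x a * pdot (E a) (shift_by x) i j).
  by apply/funext => x; rewrite fct_sumE.
elim/big_ind : _ => //; first exact: (@lipschitz_cst R n rho 0).
  by move=> f g; exact: lipschitzD.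
move=> a _; apply: lipschitzM; first by case: (v a).
have -> : (fun x => pdot (E a) (shift_by x) i j) = (fun x => pdot (shift_by x) (E a) i j).
  by apply/funext => x; exact: pdotC.
by case: (vanishing_pdot_shift (E a) i j).
Qed.

Lemma lipschitz_sq_conf i j : lip_on rho (fun x => pdot (conf x) (conf x) i j).
Proof.
have -> : (fun x => pdot (conf x) (conf x) i j) = (fun x => pdot q0 q0 i j +
    (2 * pdot (shift_by x) q0 i j + pdot (shift_by x) (shift_by x) i j)).
  apply/funext => x; rewrite /conf !(pdotDl, pdotDr) (pdotC q0 (shift_by x)); ring.
apply: lipschitzD; first exact: lipschitz_cst.
apply: lipschitzD; last by case: (vanishing_pdot_shift2 i j).
by apply: lipschitzZ; case: (vanishing_pdot_shift q0 i j).
Qed.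

Lemma lipschitz_stiffness (c : R) i j : (i < j)%N ->
  lip_on rho (fun x => stiffness c (pdot (conf x) (conf x) i j)).
Proof.
move=> ij; apply: lipschitzZ; apply: lipschitzX.
apply: (@lipschitz_isqrt _ _ _ _ m) => //; first exact: lipschitz_sq_conf.
by move=> x xr; exact: conf_pos.
Qed.

(** One pair contributes 2 c (s - s0) [pdot (conf x) (E a)], where s - s0 is 2
    [pdot (shift_by x) q0] plus a square. Subtracting the linear part and freezing c at the origin
    step by step leaves three summands, each visibly of second order. *)
Definition spring_rem i j a (x : vec) : R :=
  let c x := stiffness (A i j) (pdot (conf x) (conf x) i j) in
  2 * ((c x - c (fun=> 0)) * ((pdot (shift_by x) q0 i j * 2
      + pdot (shift_by x) (shift_by x) i j) * pdot (conf x) (E a) i j))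
  + (2 * c (fun=> 0) * (pdot (shift_by x) (shift_by x) i j * pdot (conf x) (E a) i j)
  + 4 * c (fun=> 0) * (pdot (shift_by x) q0 i j * pdot (shift_by x) (E a) i j)).

Lemma quadratic_spring_rem i j a : (i < j)%N -> quadratic rho (spring_rem i j a).
Proof.
move=> ij; apply: quadraticD; last apply: quadraticD.
- apply: quadraticZ => //; apply: quadratic_vanishingM => //.
    exact: (vanishing_sub (lipschitz_stiffness (A i j) ij)).
  apply: vanishingM; last exact: lipschitz_pdot_conf.
  apply: vanishingD; last exact: vanishing_pdot_shift2.
  by apply: vanishingM; [exact: vanishing_pdot_shift|exact: lipschitz_cst].
- apply: quadraticZ => //; apply: quadratic_lipschitzM => //.
    exact: quadratic_pdot_shift2.
  exact: lipschitz_pdot_conf.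
- by apply: quadraticZ => //; apply: quadratic_vanishingM => //; exact: vanishing_pdot_shift.
Qed.

Lemma quad_shift x a : quad A q0 (shift_by x) (E a) = d a * x a.
Proof.
rewrite /shift_by quad_suml; under eq_bigr do rewrite quadZl.
rewrite (bigD1 a)//= quad_E eqxx big1 ?addr0; first by rewrite mulr1 mulrC.
by move=> b /negbTE ba; rewrite quad_E ba !mulr0.
Qed.

Lemma dU_conf x a : in_ball x rho -> dU A B (conf x) (E a) =
  d a * x a + \sum_(i < 3) \sum_(j < 3 | (i < j)%N) spring_rem i j a x.
Proof.
move=> xr; rewrite -quad_shift /quad -big_split; apply: eq_bigr => i _ /=.
rewrite -big_split; apply: eq_bigr => j ij /=.
have pos : 0 < pdot (conf x) (conf x) i j by apply: lt_le_trans (conf_pos xr ij).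
rewrite (spring'_factor pos (AB_crit ij)) /spring_rem conf0.
set c := stiffness _ _; set c0 := stiffness _ _.
rewrite /conf !(pdotDl, pdotDr) (pdotC q0 (shift_by x)); ring.
Qed.

(** The nonlinear part of the force in eigencoordinates. The factor beta^-2 comes from rescaling
    time so that the resonant frequency becomes 1. *)
Definition rem_force (x : vec) a : R := beta ^- 2 * (dU A B (conf x) (E a) - d a * x a).

Definition rem_pot (x : vec) : R :=
  beta ^- 2 * (U (conf x) - U q0 - 2^-1 * \sum_a d a * x a ^+ 2).

Lemma rem_force_lipschitz : exists2 C : R, 0 <= C &
  forall a (x x' : vec) (e h : R), e <= rho ->
    in_ball x e -> in_ball x' e -> 0 <= e -> 0 <= h -> (forall a, `|x a - x' a| <= h) ->
    `|rem_force x a - rem_force x' a| <= C * e * h.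
Proof.
have [C C0 hC] := @quadratic_unif _ _ rho
  (fun a x => beta ^- 2 * \sum_(i < 3) \sum_(j < 3 | (i < j)%N) spring_rem i j a x)
  (fun a => quadraticZ rho1 _ (quadratic_sum (fun i _ => quadratic_sum
     (fun j ij => quadratic_spring_rem a ij)))).
exists C => // a x x' e h er xe xe' e0 h0 xh.
have := hC a x x' e h er xe xe' e0 h0 xh.
by rewrite /rem_force !dU_conf ?(addrC (d a * _)) ?addrK//; exact: in_ballW er _.
Qed.

Lemma rem_force0 a : rem_force (fun=> 0) a = 0.
Proof.
have r0 : @in_ball R n (fun=> 0) rho by exact: in_ball0 (ltW rho0).
rewrite /rem_force (dU_conf a r0) mulr0 add0r subr0 big1 ?mulr0// => i _.
by rewrite big1// => j ij; have [] := quadratic_spring_rem a ij.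
Qed.

Lemma is_derive_rem_pot (x z : vec) (t : R) : in_ball (fun a => x a + t * z a) rho ->
  is_derive t 1 (fun t => rem_pot (fun a => x a + t * z a))
    (\sum_a rem_force (fun a => x a + t * z a) a * z a).
Proof.
move=> xr; pose Z := shift_by z.
have confE (s : R) : conf (fun a => x a + s * z a) = conf x + s *: Z.
  rewrite /conf -addrA; congr (_ + _); rewrite /Z /shift_by scaler_sumr -big_split.
  by apply: eq_bigr => a _; rewrite scalerDl scalerA.
have dUt : is_derive t 1 (fun s => U (conf (fun a => x a + s * z a)))
    (dU A B (conf (fun a => x a + t * z a)) Z).
  have -> : (fun s => U (conf (fun a => x a + s * z a))) = (fun s => U (conf x + s *: Z)).
    by apply/funext => s; rewrite confE.
  rewrite confE; apply: is_derive_U_line => i j ij; rewrite -confE.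
  exact: lt_le_trans (conf_pos xr ij).
have dQ : is_derive t 1 (fun s => \sum_a d a * (x a + s * z a) ^+ 2)
    (\sum_a 2 * (d a * (x a + t * z a) * z a)).
  apply: is_derive1_sum => a _.
  have h := is_derive_powr 2 (is_derive1D (is_derive_cst (x a) t 1)
     (is_derive1M (is_derive_id t 1) (is_derive_cst (z a) t 1))).
  by apply: (is_derive_eq (is_derive1Z (d a) h)) => /=; ring.
have h := is_derive1Z (beta ^- 2) (is_derive1D (is_derive1D dUt (is_derive_cst (- U q0) t 1))
  (is_derive1Z (- 2^-1) dQ)).
have -> : (fun t0 => rem_pot (fun a => x a + t0 * z a)) = (fun s => beta ^- 2 *
   (U (conf (fun a => x a + s * z a)) + cst (- U q0) s
     + - 2^-1 * \sum_a d a * (x a + s * z a) ^+ 2)).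
  by apply/funext => s; rewrite /rem_pot mulNr.
apply: (is_derive_eq h); rewrite /Z /shift_by dU_sum addr0.
rewrite mulr_sumr -big_split mulr_sumr; apply: eq_bigr => a _ /=.
by rewrite dU_Z /rem_force; field; rewrite gt_eqF.
Qed.

(** The mean value theorem on the segment from x to x' turns the remainder into the difference of
    [rem_force] at an intermediate point and at x, which [rem_force_lipschitz] bounds by C e h in
    each coordinate. *)
Lemma rem_pot_taylor : exists2 C : R, 0 <= C &
  forall (x x' : vec) (e h : R), e <= rho -> in_ball x e -> in_ball x' e ->
    0 <= e -> 0 <= h -> (forall a, `|x' a - x a| <= h) ->
    `|rem_pot x' - rem_pot x - \sum_a rem_force x a * (x' a - x a)| <= C * e * h ^+ 2.
Proof.
have [C C0 hC] := rem_force_lipschitz.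
exists (\sum_(a < n) C); first exact: sumr_ge0.
move=> x x' e h er xe xe' e0 h0 xh; pose z a := x' a - x a.
pose y (t : R) a := x a + t * z a.
have ye (t : R) : 0 <= t <= 1 -> in_ball (y t) e.
  move=> /andP[t0 t1] a; have := xe a; have := xe' a; rewrite !ler_norml /y /z.
  by move=> /andP[h1 h2] /andP[h3 h4]; apply/andP; split; nra.
have dy (t : R) : 0 <= t <= 1 -> is_derive t 1 (fun t => rem_pot (y t))
    (\sum_a rem_force (y t) a * z a).
  by move=> t01; apply: is_derive_rem_pot; apply: in_ballW er (ye t t01).
have [t||t] := @MVT_segment _ (fun t => rem_pot (y t))
    (fun t => \sum_a rem_force (y t) a * z a) 0 1 ler01.
- by rewrite in_itv/= => /andP[t0 t1]; apply: dy; rewrite !ltW.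
- apply: derivable_within_continuous => t; rewrite in_itv/= => t01.
  by have [] := dy t t01.
rewrite in_itv/= => t01; rewrite subr0 mulr1.
have -> : y 1 = x' by apply/funext => a; rewrite /y /z; ring.
have -> : y 0 = x by apply/funext => a; rewrite /y /z; ring.
move=> ->; rewrite -sumrB mulr_suml mulr_suml (le_trans (ler_norm_sum _ _ _))//.
apply: ler_sum => a _; rewrite -mulrBl normrM expr2 mulrA.
have yx b : `|y t b - x b| <= h.
  rewrite /y addrAC subrr add0r normrM (le_trans _ (xh b))//.
  by have /andP[t0 t1] := t01; rewrite ler_piMl// ger0_norm.
apply: ler_pM => //; last exact: xh.
exact: (hC a (y t) x e h er (ye t t01) xe e0 h0 yx).
Qed.

Hypothesis freq_nonres : forall a,
  resonant (Num.sqrt (d a) / beta) \/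
  (Num.sqrt (d a) / beta) ^+ 2 * sinw (Num.sqrt (d a) / beta) pi != 0.

Lemma spring_perturbation (n0 : 'I_n) : exists p : perturbation R n,
  [/\ freq p = (fun a => Num.sqrt (d a) / beta), force p = rem_force & pert_radius p = rho].
Proof.
have [C C0 hC] := rem_force_lipschitz; have [D D0 hD] := rem_pot_taylor.
have p0 : rem_pot (fun=> 0) = 0.
  rewrite /rem_pot conf0 subrr big1 ?mulr0 ?subrr ?mulr0// => a _.
  by rewrite expr0n mulr0.
have CD : 0 <= C + D by exact: addr_ge0.
(* The index [n0] turns the coordinatewise bounds into 0 <= e; with no coordinates they would say
   nothing about the sign. *)
have pos (x : vec) (e : R) : (forall a, `|x a| <= e) -> 0 <= e by move=> /(_ n0); exact: le_trans.
have f1 (x x' : vec) (e h : R) : e <= rho ->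
    (forall a, `|x a| <= e) -> (forall a, `|x' a| <= e) ->
    (forall a, `|x a - x' a| <= h) ->
    forall a, `|rem_force x a - rem_force x' a| <= (C + D) * e * h.
  move=> er xe xe' xh a; have e0 := pos x e xe; have h0 := pos (fun a => x a - x' a) h xh.
  rewrite (le_trans (hC a x x' e h er xe xe' e0 h0 xh))//.
  by rewrite ler_wpM2r// ler_wpM2r// lerDl.
have f2 (x x' : vec) (e h : R) : e <= rho ->
    (forall a, `|x a| <= e) -> (forall a, `|x' a| <= e) ->
    (forall a, `|x' a - x a| <= h) ->
    `|rem_pot x' - rem_pot x - \sum_a rem_force x a * (x' a - x a)| <= (C + D) * e * h ^+ 2.
  move=> er xe xe' xh; have e0 := pos x e xe; have h0 := pos (fun a => x' a - x a) h xh.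
  rewrite (le_trans (hD x x' e h er xe xe' e0 h0 xh))//.
  by rewrite ler_wpM2r ?sqr_ge0// ler_wpM2r// lerDr.
by exists (Perturbation CD rho0 freq_nonres p0 rem_force0 f1 f2).
Qed.

End SpringPerturbation.

(** * Minimal period, rigidity and conservation laws *)

Section MinimalPeriod.
Variables (R : realType) (n : nat).

(** The target interval has length pi, so steps of length at most pi cannot jump over it; the first
    multiple beyond pi / 2 lands inside. *)
Lemma half_turn_multiple (S : R) : 0 < S <= pi ->
  exists k : nat, pi / 2 <= k%:R * S <= 3 * pi / 2.
Proof.
move=> /andP[S0 Sp]; have p0 := pi_gt0 R.
have h0 : 0 <= pi / 2 / S by rewrite divr_ge0 ?divr_ge0 ?ltW.
have := truncn_le (pi / 2 / S); have := truncnS_gt (pi / 2 / S).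
set k := Num.truncn _; rewrite h0 ler_pdivlMr// ltr_pdivrMr// -(natr1 k) => h1 h2.
exists k.+1; rewrite -(natr1 k).
by apply/andP; split; lra.
Qed.

Lemma cos_half_turn_le0 (u : R) : pi / 2 <= u <= 3 * pi / 2 -> cos u <= 0.
Proof.
move=> /andP[h1 h2]; have -> : u = (u - pi) + pi by ring.
rewrite cosDpi oppr_le0; apply: cos_ge0_pihalf.
by rewrite -mulNr; apply/andP; split; lra.
Qed.

(* Some multiple of a shorter period would fall in [pi/2, 3 pi/2] modulo
   [2 pi], where the leading term [v cos t] points away from [v]. *)
Lemma near_cosine_period (x : 'I_n -> R -> R) (v : 'I_n -> R) (e eta S : R) :
  (forall a, even_periodic (x a)) -> \sum_a v a * v a = 1 -> 0 < e ->
  (forall a t, `|x a t - e * (v a * cos t)| <= eta * e) -> 2 * n%:R * eta < 1 ->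
  0 < S -> (forall a t, x a (t + S) = x a t) -> 2 * pi <= S.
Proof.
move=> ex v1 e0 xv eta1 S0 xS; rewrite leNgt; apply/negP => S2.
have p0 := pi_gt0 R.
have key S' : 0 < S' <= pi -> (forall a t, x a (t + S') = x a t) -> False.
  move=> hS' xS'; have [k hk] := half_turn_multiple hS'.
  have ck := cos_half_turn_le0 hk; set u := k%:R * S' in hk ck.
  have xk a : x a u = x a 0.
    rewrite /u; elim: k {hk ck u} => [|k IH]; first by rewrite mul0r.
    by rewrite -IH -natr1 mulrDl mul1r xS'.
  have va a : `|v a| <= 1.
    rewrite -(expr_le1 (n := 2)) ?normr_ge0// -normrX ger0_norm ?sqr_ge0// -v1.
    rewrite (bigD1 a)//= expr2 lerDl; apply: sumr_ge0 => b _.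
    by rewrite -expr2 sqr_ge0.
  have close t : `|\sum_a v a * x a t - e * cos t| <= n%:R * (eta * e).
    have -> : e * cos t = \sum_a v a * (e * (v a * cos t)).
      rewrite -[LHS]mul1r -v1 mulr_suml; apply: eq_bigr => a _; ring.
    rewrite -sumrB (le_trans (ler_norm_sum _ _ _))//.
    have -> : n%:R * (eta * e) = \sum_(a < n) eta * e.
      by rewrite sumr_const card_ord mulr_natl.
    apply: ler_sum => a _; rewrite -mulrBr normrM -[leRHS]mul1r.
    by apply: ler_pM => //; exact: va.
  have := close 0; have := close u; rewrite cos0.
  have -> : \sum_a v a * x a u = \sum_a v a * x a 0 by apply: eq_bigr => a _; rewrite xk.
  (* The pairing with v is at least e - n eta e at time 0 and at most n eta e at time u. The
     smallness of eta makes these incompatible with equality. *)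
  set s := \sum_a _; rewrite !ler_norml => /andP[_ h1] /andP[h2 _].
  have h3 : e * cos u <= 0 by rewrite pmulr_rle0.
  have h4 : 2 * n%:R * eta * e < 1 * e by rewrite ltr_pM2r.
  lra.
have [Sp|pS] := leP S pi; first by apply: (key S) => //; rewrite S0.
(* A period strictly between pi and 2 pi yields the period 2 pi - S, which is below pi. *)
apply: (key (2 * pi - S)); first by apply/andP; split; lra.
move=> a t; rewrite -(xS a (t + (2 * pi - S))).
have -> : t + (2 * pi - S) + S = t + 2 * pi by ring.
exact: even_periodicP.
Qed.

End MinimalPeriod.

Section Rigidity.
Variable R : realType.
Implicit Types q N X : config R.

Let i0 : 'I_3 := ord0.
Let i1 : 'I_3 := lift ord0 ord0.
Let i2 : 'I_3 := ord_max.
Let k0 : 'I_2 := ord0.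
Let k1 : 'I_2 := ord_max.

Lemma sum3 (f : 'I_3 -> R) : \sum_i f i = f i0 + f i1 + f i2.
Proof.
rewrite !big_ord_recr big_ord0 /= add0r.
by congr (f _ + f _ + f _); apply: val_inj.
Qed.

Lemma sum2 (f : 'I_2 -> R) : \sum_k f k = f k0 + f k1.
Proof.
rewrite !big_ord_recr big_ord0 /= add0r.
by congr (f _ + f _); apply: val_inj.
Qed.

(** Twice the signed area of the triangle. *)
Definition wedge q : R := (q i0 k0 - q i1 k0) * (q i0 k1 - q i2 k1)
  - (q i0 k1 - q i1 k1) * (q i0 k0 - q i2 k0).

Lemma wedge_neq0 q : Omega R q -> ~ collinear q -> wedge q != 0.
Proof.
move=> qO nc; apply/eqP => w0; apply: nc.
have n01 : row i0 q != row i1 q by apply: qO.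
pose r := row i1 q - row i0 q; pose p := row i2 q - row i0 q.
have r0 : r != 0 by rewrite subr_eq0 eq_sym.
pose rr := r 0 k0 ^+ 2 + r 0 k1 ^+ 2.
have rr0 : rr != 0.
  apply: contraNneq r0 => /eqP; rewrite paddr_eq0 ?sqr_ge0// !sqrf_eq0 => /andP[h0 h1].
  apply/eqP/rowP => k; rewrite [RHS]mxE.
  have [->|->] : k = k0 \/ k = k1; [|exact/eqP|exact/eqP].
  by case: k => [[|[|//]] h]; [left|right]; exact: val_inj.
exists (row i0 q), r; split => // i.
have cs : i = i0 \/ i = i1 \/ i = i2.
  by case: i => [[|[|[|//]]] h]; [left|right; left|right; right]; exact: val_inj.
case: cs => [->|[->|->]].
- by exists 0; rewrite scale0r addr0.
- by exists 1; rewrite scale1r /r addrC subrK.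
exists ((p 0 k0 * r 0 k0 + p 0 k1 * r 0 k1) / rr).
have w0' : r 0 k0 * p 0 k1 = r 0 k1 * p 0 k0.
  by move: w0; rewrite /wedge /r /p !mxE; lra.
suff -> : ((p 0 k0 * r 0 k0 + p 0 k1 * r 0 k1) / rr) *: r = p by rewrite /p addrC subrK.
apply/rowP => k; rewrite mxE; apply: (mulfI rr0).
rewrite mulrA mulrCA divff// mulr1.
have [->|->] : k = k0 \/ k = k1.
  by case: k => [[|[|//]] h]; [left|right]; exact: val_inj.
- rewrite /rr; transitivity (p 0 k0 * r 0 k0 ^+ 2 + r 0 k0 * p 0 k1 * r 0 k1); first by ring.
  by rewrite w0'; ring.
- rewrite /rr; transitivity ((r 0 k1 * p 0 k0) * r 0 k0 + p 0 k1 * r 0 k1 ^+ 2); first by ring.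
  by rewrite -w0'; ring.
Qed.

Lemma perp_multiple (r0 r1 n0 n1 : R) : r0 ^+ 2 + r1 ^+ 2 != 0 ->
  r0 * n0 + r1 * n1 = 0 -> exists al, n0 = - (al * r1) /\ n1 = al * r0.
Proof.
move=> rr /eqP; rewrite addr_eq0 => /eqP h.
exists ((r0 * n1 - r1 * n0) / (r0 ^+ 2 + r1 ^+ 2)); split; apply: (mulIf rr).
  have -> : - ((r0 * n1 - r1 * n0) / (r0 ^+ 2 + r1 ^+ 2) * r1) * (r0 ^+ 2 + r1 ^+ 2) =
    r1 ^+ 2 * n0 - r0 * (r1 * n1) by field.
  have -> : n0 * (r0 ^+ 2 + r1 ^+ 2) = r1 ^+ 2 * n0 + r0 * (r0 * n0) by ring.
  by rewrite h; ring.
have -> : (r0 * n1 - r1 * n0) / (r0 ^+ 2 + r1 ^+ 2) * r0 * (r0 ^+ 2 + r1 ^+ 2) =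
  r0 ^+ 2 * n1 - r1 * (r0 * n0) by field.
by rewrite h; ring.
Qed.

(* [N] preserves the three lengths to first order, hence is an infinitesimal
   rigid motion; it has no translation part, and a rotation would exert a
   torque. *)
Lemma residual_force_eq0 q : Omega R q -> ~ collinear q ->
  exists2 kappa : R, 0 < kappa & forall N X,
    (forall i j : 'I_3, (i < j)%N -> pdot q N i j = 0) ->
    (forall k, \sum_i N i k = 0) ->
    (forall i k, `|X i k - q i k| <= kappa) ->
    \sum_i (X i k0 * N i k1 - X i k1 * N i k0) = 0 -> N = 0.
Proof.
move=> qO nc; have w0 := wedge_neq0 qO nc.
set r0 := q i0 k0 - q i1 k0; set r1 := q i0 k1 - q i1 k1.
set p0 := q i0 k0 - q i2 k0; set p1 := q i0 k1 - q i2 k1.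
have wE : wedge q = r0 * p1 - r1 * p0 by [].
pose M := `|r0| + `|r1| + `|p0| + `|p1|.
pose D := r0 ^+ 2 + r1 ^+ 2 + p0 ^+ 2 + p1 ^+ 2.
have D0 : 0 < D.
  have : D != 0.
    rewrite /D !paddr_eq0 ?addr_ge0 ?sqr_ge0// !sqrf_eq0.
    by apply: contraNN w0 => /andP[/andP[/andP[/eqP a /eqP b] _] _]; rewrite wE a b !mul0r subrr.
  by rewrite lt0r => ->; rewrite !addr_ge0 ?sqr_ge0.
have M0 : 0 <= M by rewrite !addr_ge0.
have M1 : 0 < 12 * (M + 1) by lra.
(* At X = q the torque per unit of angular velocity, in the normalisation of [torE], is at least D.
   Displacing X by kappa changes it by at most 6 kappa M, which this choice keeps below D. *)
exists (D / (12 * (M + 1))); first exact: divr_gt0.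
set kappa := D / _; have kE : kappa * (12 * (M + 1)) = D by rewrite divfK// gt_eqF.
have kp : 0 < kappa by exact: divr_gt0.
move=> N X Nq NS Xq tor.
have e01 := Nq i0 i1 isT; have e02 := Nq i0 i2 isT; have e12 := Nq i1 i2 isT.
move: e01 e02 e12; rewrite /pdot !sum2 /pdiff -/r0 -/r1 -/p0 -/p1.
set n0 := N i0 k0 - N i1 k0; set n1 := N i0 k1 - N i1 k1.
set m0 := N i0 k0 - N i2 k0; set m1 := N i0 k1 - N i2 k1.
move=> e01 e02 e12.
have {}e12 : (p0 - r0) * (m0 - n0) + (p1 - r1) * (m1 - n1) = 0.
  by rewrite -[RHS]e12 /p0 /r0 /m0 /n0 /p1 /r1 /m1 /n1; ring.
have rr : r0 ^+ 2 + r1 ^+ 2 != 0.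
  rewrite paddr_eq0 ?sqr_ge0// !sqrf_eq0.
  by apply: contraNN w0 => /andP[/eqP a /eqP b]; rewrite wE a b !mul0r subrr.
have pp : p0 ^+ 2 + p1 ^+ 2 != 0.
  rewrite paddr_eq0 ?sqr_ge0// !sqrf_eq0.
  by apply: contraNN w0 => /andP[/eqP a /eqP b]; rewrite wE a b !mulr0 subrr.
have [al [n0E n1E]] := perp_multiple rr e01.
have [be [m0E m1E]] := perp_multiple pp e02.
(* Two sides rotate with angular velocities al and be; preservation of the third side equates them
   because the triangle has nonzero area. *)
have alE : al = be.
  have : (al - be) * wedge q = 0.
    rewrite wE; rewrite n0E n1E m0E m1E in e12; apply: oppr_inj; rewrite oppr0 -[RHS]e12; ring.
  by move/eqP; rewrite mulf_eq0 (negbTE w0) orbF subr_eq0 => /eqP.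
have S0 := NS k0; have S1 := NS k1; rewrite !sum3 in S0 S1 tor.
pose x0 := X i0 k0 - X i1 k0; pose x1 := X i0 k1 - X i1 k1.
pose y0 := X i0 k0 - X i2 k0; pose y1 := X i0 k1 - X i2 k1.
(* Three times the torque, written in differences from the first point: the zero sum of N eliminates
   its third row and the position of the centroid. *)
have torE : al * ((2 * x0 - y0) * r0 + (2 * x1 - y1) * r1
                + (2 * y0 - x0) * p0 + (2 * y1 - x1) * p1) = 0.
  have h : (2 * x0 - y0) * n1 - (2 * x1 - y1) * n0
         + (2 * y0 - x0) * m1 - (2 * y1 - x1) * m0 = 0.
    have N2 k : \sum_i N i k = 0 -> N i2 k = - N i0 k - N i1 k by rewrite sum3; lra.
    have a0 := N2 _ (NS k0); have a1 := N2 _ (NS k1).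
    rewrite a0 a1 in tor.
    rewrite -[RHS](mulr0 3) -tor /x0 /y0 /x1 /y1 /n0 /n1 /m0 /m1 a0 a1; ring.
  rewrite n0E n1E m0E m1E -alE in h; rewrite -[RHS]h; ring.
have bnd i j k : `|(X i k - X j k) - (q i k - q j k)| <= 2 * kappa.
  have -> : (X i k - X j k) - (q i k - q j k) = (X i k - q i k) - (X j k - q j k) by ring.
  by rewrite (le_trans (ler_normB _ _))//; have := Xq i k; have := Xq j k; lra.
have bx0 := bnd i0 i1 k0; have bx1 := bnd i0 i1 k1.
have by0 := bnd i0 i2 k0; have by1 := bnd i0 i2 k1.
rewrite -/x0 -/r0 in bx0; rewrite -/x1 -/r1 in bx1.
rewrite -/y0 -/p0 in by0; rewrite -/y1 -/p1 in by1.
(* With X replaced by q this is D plus two squares; the rest is linear in the displacements and is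
   absorbed by the choice of kappa. *)
have pos : 0 < (2 * x0 - y0) * r0 + (2 * x1 - y1) * r1
                + (2 * y0 - x0) * p0 + (2 * y1 - x1) * p1.
  set dx0 := x0 - r0 in bx0; set dx1 := x1 - r1 in bx1.
  set dy0 := y0 - p0 in by0; set dy1 := y1 - p1 in by1.
  have -> : (2 * x0 - y0) * r0 + (2 * x1 - y1) * r1
                + (2 * y0 - x0) * p0 + (2 * y1 - x1) * p1 =
     D + (r0 - p0) ^+ 2 + (r1 - p1) ^+ 2 + ((2 * dx0 - dy0) * r0 + (2 * dx1 - dy1) * r1
       + (2 * dy0 - dx0) * p0 + (2 * dy1 - dx1) * p1).
    by rewrite /D /dx0 /dx1 /dy0 /dy1; ring.
  have small (u v z : R) : `|u| <= 2 * kappa -> `|v| <= 2 * kappa ->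
      - (6 * kappa * `|z|) <= (2 * u - v) * z.
    move=> hu hv; have : `|(2 * u - v) * z| <= 6 * kappa * `|z|.
      rewrite normrM ler_wpM2r// (le_trans (ler_normB _ _))// normrM ger0_norm//; lra.
    by rewrite ler_norml => /andP[].
  have s1 := small _ _ r0 bx0 by0; have s2 := small _ _ r1 bx1 by1.
  have s3 := small _ _ p0 by0 bx0; have s4 := small _ _ p1 by1 bx1.
  have sq1 := sqr_ge0 (r0 - p0); have sq2 := sqr_ge0 (r1 - p1).
  have MM : 6 * kappa * `|r0| + 6 * kappa * `|r1| + 6 * kappa * `|p0| + 6 * kappa * `|p1|
     = 6 * kappa * M by rewrite /M; ring.
  have : 6 * kappa * M < D.
    rewrite -kE; have : 0 <= kappa * M by rewrite mulr_ge0// ltW.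
    lra.
  lra.
have al0 : al = 0.
  by move/eqP : torE; rewrite mulf_eq0 [X in _ || X]gt_eqF// orbF => /eqP.
rewrite -alE al0 !mul0r ?oppr0 in n0E n1E m0E m1E.
have c0 : N i0 k0 = N i1 k0 /\ N i0 k0 = N i2 k0 by move: n0E m0E; rewrite /n0 /m0; lra.
have c1 : N i0 k1 = N i1 k1 /\ N i0 k1 = N i2 k1 by move: n1E m1E; rewrite /n1 /m1; lra.
apply/matrixP => i k; rewrite mxE.
have ck : k = k0 \/ k = k1.
  by case: k => [[|[|//]] h]; [left|right]; exact: val_inj.
have ci : i = i0 \/ i = i1 \/ i = i2.
  by case: i => [[|[|[|//]]] h]; [left|right; left|right; right]; exact: val_inj.
by case: ck => ->; case: ci => [->|[->|->]]; lra.
Qed.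

End Rigidity.

(** * Eigenframe of the Hessian and good neighbourhoods of the triangle *)

Section Assembly.
Variable R : realType.

Lemma sin_pi_neq0 (u : R) : 0 < u -> (forall k : nat, u != k%:R) -> sin (u * pi) != 0.
Proof.
move=> u0 uk; have p0 := pi_gt0 R; pose k := Num.truncn u; pose f := u - k%:R.
have f0 : 0 < f.
  by rewrite subr_gt0 lt_neqAle eq_sym uk truncn_le ltW.
have f1 : f < 1 by rewrite ltrBlDl natr1 truncnS_gt.
have sf : sin (f * pi) != 0.
  by rewrite gt_eqF// sin_gt0_pi// mulr_gt0//= -[ltRHS]mul1r ltr_pM2r.
have -> : u * pi = f * pi + k%:R * pi by rewrite /f; ring.
elim: k {f0 f1} f sf => [|k IH] f sf; first by rewrite mul0r addr0.
have -> : f * pi + k.+1%:R * pi = (f * pi + k%:R * pi) + pi by rewrite -natr1; ring.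
by rewrite sinDpi oppr_eq0; exact: IH.
Qed.

Lemma matrix_derive1 (m n : nat) (M M1 : R -> 'M[R]_(m, n)) :
  (forall i j, is_primitive (fun t => M t i j) (fun t => M1 t i j)) ->
  (forall t, derivable M t 1) /\ (M^`())%classic = M1.
Proof.
move=> MM1; have dM t : derivable M t 1.
  by apply/derivable_mxP => i j; have [] := MM1 i j t.
split => //; apply/funext => t; rewrite derive1E derive_mx//.
by apply/matrixP => i j; rewrite mxE; have [] := MM1 i j t.
Qed.

Lemma conf_near (n : nat) (q0 : config R) (E : 'I_n -> config R) (W : set (config R)) :
  nbhs q0 W -> exists2 rho : R, 0 < rho <= 1 & forall x, in_ball x rho -> W (conf q0 E x).
Proof.
move=> /nbhs_ballP[r /= r0 rW]; pose S := \sum_a `|E a|.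
have S0 : 0 <= S by apply: sumr_ge0.
have S1 : 0 < S + 1 by rewrite ltr_wpDl.
exists (Num.min 1 (r / 2 / (S + 1))).
  by rewrite ge_min lexx lt_min ltr01 /= andbT !divr_gt0.
move=> x xr; apply: rW; rewrite -ball_normE /= /conf opprD addrA subrr add0r normrN.
have : `|shift_by E x| <= r / 2.
  rewrite /shift_by (le_trans (ler_norm_sum _ _ _))//.
  apply: (@le_trans _ _ (r / 2 / (S + 1) * S)).
    rewrite mulr_sumr; apply: ler_sum => a _; rewrite normrZ ler_wpM2r//.
    by rewrite (le_trans (xr a))// ge_min lexx orbT.
  by rewrite mulrAC ler_pdivrMr// ler_wpM2l ?divr_ge0 ?(ltW r0)// lerDl.
by move=> h; apply: le_lt_trans h _; lra.
Qed.

Lemma continuous_pdot2 (i j : 'I_3) : continuous (fun q : config R => pdot q q i j).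
Proof.
have cp k : continuous (fun q : config R => pdiff q i j k).
  have h (q : config R) : {for q, continuous (fun q : config R => q i k)} ->
      {for q, continuous (fun q : config R => q j k)} ->
      {for q, continuous (fun q : config R => pdiff q i j k)} by exact: continuousB.
  by move=> q; apply: h; exact: coord_continuous.
have cm k : continuous (fun q : config R => pdiff q i j k * pdiff q i j k).
  have h (q : config R) : {for q, continuous (fun q : config R => pdiff q i j k)} ->
      {for q, continuous (fun q : config R => pdiff q i j k * pdiff q i j k)}.
    by move=> c; exact: continuousM.
  by move=> q; apply: h; exact: cp.
have -> : (fun q : config R => pdot q q i j) =
    \sum_k (fun q : config R => pdiff q i j k * pdiff q i j k).
  by apply/funext => q; rewrite fct_sumE.
elim/big_ind : _ => //; first by move=> x; exact: cst_continuous.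
by move=> g h cg ch x; apply: continuousD; [exact: cg|exact: ch].
Qed.

Lemma mx_entry_le (m n : nat) (M : 'M[R]_(m, n)) i j : `|M i j| <= `|M|.
Proof.
rewrite [leRHS]/Num.norm/= mx_normrE.
exact: (le_bigmax _ (fun ij : 'I_m * 'I_n => `|M ij.1 ij.2|) (i, j)).
Qed.

Lemma good_neighbourhood (q0 : config R) (V : set (config R)) (kappa : R) :
  Omega R q0 -> nbhs q0 V -> 0 < kappa ->
  exists2 m : R, 0 < m & \forall q \near q0, [/\ V q,
    forall i j : 'I_3, (i < j)%N -> m <= pdot q q i j &
    forall i k, `|q i k - q0 i k| <= kappa].
Proof.
move=> qO nV k0.
(* The inverse of 1 plus the sum of reciprocals lies strictly below every squared distance, which
   saves taking a minimum over pairs. *)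
pose S := \sum_(i < 3) \sum_(j < 3 | (i < j)%N) (pdot q0 q0 i j)^-1.
have pos (i j : 'I_3) : (i < j)%N -> 0 < pdot q0 q0 i j by exact: Omega_pdot.
have S0 : 0 <= S.
  apply: sumr_ge0 => i _; apply: sumr_ge0 => j ij.
  by rewrite invr_ge0 ltW// pos.
have S1 : 0 < S + 1 by rewrite ltr_wpDl.
pose m := (S + 1)^-1; have m0 : 0 < m by rewrite invr_gt0.
have mlt (i j : 'I_3) : (i < j)%N -> m < pdot q0 q0 i j.
  move=> ij; rewrite -[ltRHS]invrK ltf_pV2 ?posrE ?invr_gt0 ?pos//.
  apply: (@le_lt_trans _ _ S); last by rewrite ltrDl.
  rewrite /S (bigD1 i)//= (bigD1 j)//= -addrA lerDl addr_ge0//.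
    by apply: sumr_ge0 => b /andP[ib _]; rewrite invr_ge0 ltW// pos.
  by apply: sumr_ge0 => a _; apply: sumr_ge0 => b ab; rewrite invr_ge0 ltW// pos.
exists m => //.
have n1 : \forall q \near q0, forall ij : 'I_3 * 'I_3, (ij.1 < ij.2)%N -> m <= pdot q q ij.1 ij.2.
  apply: (@filter_forall _ _ (fun (ij : 'I_3 * 'I_3) q => (ij.1 < ij.2)%N ->
     m <= pdot q q ij.1 ij.2) (nbhs q0)) => -[i j] /=.
  have [ij|nij] := boolP (i < j)%N; last by apply: filterE.
  have : \forall q \near q0, m <= pdot q q i j.
    have c : (fun q : config R => pdot q q i j) q @[q --> q0] --> pdot q0 q0 i j.
      exact: continuous_pdot2.
    by apply: (cvgr_ge _ c); exact: mlt.
  by apply: filterS.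
have n2 : \forall q \near q0, `|q0 - q| <= kappa.
  have h : (fun q : config R => q) q @[q --> q0] --> q0 by exact: cvg_id.
  by move/cvgrPdist_le : h; exact.
apply: filterS3 nV n1 n2 => q Vq hq kq; split => //.
  by move=> i j ij; exact: (hq (i, j)).
move=> i k; have := mx_entry_le (q0 - q) i k; rewrite !mxE distrC => h.
exact: le_trans h kq.
Qed.

Lemma vec_mx_basis (x : 'rV[R]_(3 * 2)) : vec_mx x = \sum_b x 0 b *: basis_vec R b.
Proof.
rewrite {1}[x]row_sum_delta linear_sum; apply: eq_bigr => b _.
by rewrite linearZ.
Qed.

Section Frame.
Variables (A B : 'I_3 -> 'I_3 -> R) (q0 : config R).
Hypothesis q0_near : \forall q \near q0, Omega R q.
Hypothesis AB_crit : forall i j : 'I_3, (i < j)%N -> A i j * pdot q0 q0 i j = - (3 * B i j).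
Local Notation U := (schwarzschild A B).
Local Notation H := (hessian U q0).

Lemma hessian_sym : H^T = H.
Proof. by apply/matrixP => a b; rewrite mxE !hessian_quad// quadC. Qed.

Lemma quad_vec_mx (x y : 'rV[R]_(3 * 2)) :
  quad A q0 (vec_mx x) (vec_mx y) = dot (x *m H) y.
Proof.
transitivity (\sum_b \sum_a x 0 b * (y 0 a * H b a)).
  rewrite !vec_mx_basis quad_suml; apply: eq_bigr => b _.
  rewrite quadZl quadC quad_suml mulr_sumr; apply: eq_bigr => a _.
  by rewrite quadZl quadC hessian_quad.
rewrite exchange_big dotE; apply: eq_bigr => a _; rewrite mxE mulr_suml.
by apply: eq_bigr => b _; ring.
Qed.

Variables (E : 'M[R]_(3 * 2)) (d : 'rV[R]_(3 * 2)).
Hypothesis EE : E *m E^T = 1%:M.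
Hypothesis EH : E *m H = diag_mx d *m E.

Definition frame (a : 'I_(3 * 2)) : config R := vec_mx (row a E).

Lemma frame_dot a b : dot (row a E) (row b E) = (a == b)%:R.
Proof.
have := congr1 (fun M : 'M[R]_(3 * 2) => M a b) EE; rewrite !mxE => <-.
by rewrite dotE; apply: eq_bigr => k _; rewrite !mxE.
Qed.

Lemma row_frame_hessian a : row a E *m H = d 0 a *: row a E.
Proof. by rewrite -row_mul EH; apply/rowP => k; rewrite mul_diag_mx !mxE. Qed.

Lemma quad_frame a b : quad A q0 (frame a) (frame b) = d 0 b * (a == b)%:R.
Proof.
rewrite quad_vec_mx row_frame_hessian dotZl frame_dot.
by case: eqVneq => [->//|_]; rewrite !mulr0.
Qed.

(** Expand an eigenvector in the rows of [E]: any nonzero coordinate identifies the eigenvalue with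
    a diagonal entry. The spectral hypotheses can then be read on [d]. *)
Lemma eigenvalue_frame l : eigenvalue H l <-> exists a, d 0 a = l.
Proof.
split=> [/eigenvalueP[v vH v0]|[a <-]]; last first.
  apply/eigenvalueP; exists (row a E); first exact: row_frame_hessian.
  apply/eqP => r0; have := frame_dot a a; rewrite r0 eqxx dotE big1 => [/esym/eqP|].
    by rewrite oner_eq0.
  by move=> k _; rewrite mxE mul0r.
have E1 : E^T *m E = 1%:M by apply: mulmx1C.
pose u := v *m E^T.
have vE : v = u *m E by rewrite -mulmxA E1 mulmx1.
have ud : u *m diag_mx d = l *: u.
  by rewrite -[LHS]mulmx1 -EE mulmxA -(mulmxA u) -EH mulmxA -vE vH -scalemxAl.
have [a ua] : exists a, u 0 a != 0.
  apply/existsP; apply: contraNT v0 => /existsPn h.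
  rewrite vE (_ : u = 0) ?mul0mx//; apply/rowP => a; rewrite [RHS]mxE.
  by have := h a; rewrite negbK => /eqP.
exists a; have := congr1 (fun M : 'rV_ _ => M 0 a) ud.
rewrite mul_mx_diag [LHS]mxE [RHS]mxE => h; apply: (mulfI ua).
by rewrite h mulrC.
Qed.

Lemma grad_frame q : Omega R q -> \sum_a dU A B q (frame a) *: frame a = grad U q.
Proof.
move=> qO; have E1 : E^T *m E = 1%:M by apply: mulmx1C.
pose g : 'rV[R]_(3 * 2) := \row_b dU A B q (basis_vec R b).
have dUf a : dU A B q (frame a) = (g *m E^T) 0 a.
  rewrite /frame vec_mx_basis dU_sum mxE; apply: eq_bigr => b _.
  by rewrite dU_Z !mxE mulrC.
have -> : \sum_a dU A B q (frame a) *: frame a = vec_mx ((g *m E^T) *m E).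
  rewrite mulmx_sum_row linear_sum; apply: eq_bigr => a _.
  by rewrite linearZ /= dUf.
rewrite -mulmxA E1 mulmx1; apply/matrixP => i k.
rewrite grad_dU// mxE [LHS]mxE /basis_vec vec_mx_delta //.
Qed.

(** Turns a period of the configuration into a period of every eigencoordinate, where the minimal
    period is tested. *)
Lemma shift_frame_inj (x y : 'I_(3 * 2) -> R) :
  shift_by frame x = shift_by frame y -> x =1 y.
Proof.
have sE z : shift_by frame z = vec_mx ((\row_a z a) *m E).
  rewrite mulmx_sum_row linear_sum; apply: eq_bigr => a _.
  by rewrite linearZ /= mxE.
rewrite !sE => /(can_inj vec_mxK)/(congr1 (fun M => M *m E^T)).
rewrite -!mulmxA EE !mulmx1 => h a.
by have := congr1 (fun M : 'rV_ _ => M 0 a) h; rewrite !mxE.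
Qed.

End Frame.
End Assembly.

(** * Momentum and angular momentum between the brake times *)

Section Conservation.
Variables (R : realType) (A B : 'I_3 -> 'I_3 -> R).
Local Notation U := (schwarzschild A B).

Let k0 : 'I_2 := ord0.
Let k1 : 'I_2 := ord_max.

Lemma dU_grad (q M : config R) : Omega R q ->
  dU A B q M = \sum_i \sum_k M i k * grad U q i k.
Proof.
move=> qO; rewrite {1}[M]matrix_sum_delta dU_sum; apply: eq_bigr => i _.
by rewrite dU_sum; apply: eq_bigr => k _; rewrite dU_Z grad_dU.
Qed.

(** The infinitesimal form of invariance under rigid motions: it is applied to a translation field
    for the momentum and to the rotation field for the torque. *)
Lemma dU_eq0 (q M : config R) : (forall i j : 'I_3, pdot q M i j = 0) -> dU A B q M = 0.
Proof.
by move=> h; rewrite /dU big1// => i _; rewrite big1// => j _; rewrite h !mulr0.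
Qed.

Lemma sum_grad_eq0 (q : config R) k : Omega R q -> \sum_i grad U q i k = 0.
Proof.
move=> qO; pose M : config R := \matrix_(i, l) (l == k)%:R.
have <- : dU A B q M = \sum_i grad U q i k.
  rewrite dU_grad//; apply: eq_bigr => i _; rewrite (bigD1 k)//= big1 ?addr0.
    by rewrite mxE eqxx mul1r.
  by move=> l /negbTE lk; rewrite mxE lk mul0r.
apply: dU_eq0 => i j; rewrite /pdot big1// => l _.
by rewrite /pdiff !mxE subrr mulr0.
Qed.

Lemma torque_grad_eq0 (q : config R) : Omega R q ->
  \sum_i (q i k0 * grad U q i k1 - q i k1 * grad U q i k0) = 0.
Proof.
move=> qO; pose M : config R := \matrix_(i, l) (if l == k0 then - q i k1 else q i k0).
have <- : dU A B q M = \sum_i (q i k0 * grad U q i k1 - q i k1 * grad U q i k0).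
  rewrite dU_grad//; apply: eq_bigr => i _; rewrite sum2 [M i _]mxE [M i ord_max]mxE /=.
  by rewrite /k0 /k1; ring.
apply: dU_eq0 => i j; rewrite /pdot sum2 /pdiff !mxE /= /k0 /k1; ring.
Qed.

(** Momentum and angular momentum vanish at 0 and at pi, so by Rolle each has zero derivative at an
    intermediate time. The potential contributes nothing to these derivatives, which leaves the
    total force and the torque of N; the torque depends on the position and is known to vanish at
    one time only. *)
Lemma torque_free (X X1 : R -> config R) (L : R) (N : config R) :
  (forall t, Omega R (X t)) ->
  (forall i k, even_periodic (fun t => X t i k)) ->
  (forall i k, is_primitive (fun t => X t i k) (fun t => X1 t i k)) ->
  (forall i k, is_primitive (fun t => X1 t i k) (fun t => - L * grad U (X t) i k + N i k)) ->
  (forall k, \sum_i N i k = 0) /\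
  exists t, \sum_i (X t i k0 * N i k1 - X t i k1 * N i k0) = 0.
Proof.
move=> XO eX dX dX1; have p0 := pi_gt0 R.
have v0 i k : X1 0 i k = 0 by have [] := even_periodic_derive0 (dX i k) (eX i k).
have vp i k : X1 pi i k = 0 by have [] := even_periodic_derive0 (dX i k) (eX i k).
split.
  move=> k; have h := is_primitive_sum (fun i (_ : true) => dX1 i k).
  have [|c _ e] := primitive_rolle h p0; first by rewrite !big1.
  by move: e; rewrite big_split/= -mulr_sumr sum_grad_eq0// mulr0 add0r.
have h := is_primitive_sum (fun i (_ : true) => is_primitiveB
  (is_primitiveM (dX i k0) (dX1 i k1)) (is_primitiveM (dX i k1) (dX1 i k0))).
have [|c _ e] := primitive_rolle h p0.
  by rewrite !big1// => i _; rewrite ?v0 ?vp !mulr0 subrr.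
exists c; rewrite -[RHS]e.
transitivity (- L * \sum_i (X c i k0 * grad U (X c) i k1 - X c i k1 * grad U (X c) i k0)
   + \sum_i (X c i k0 * N i k1 - X c i k1 * N i k0)).
  by rewrite torque_grad_eq0// mulr0 add0r.
by rewrite mulr_sumr -big_split; apply: eq_bigr => i _ /=; ring.
Qed.

End Conservation.

Lemma SO2_orbit_self (R : realType) (q : config R) : SO2_orbit q q.
Proof.
exists 1%:M; first by split; rewrite ?trmx1 ?mulmx1 ?det1.
by rewrite /act trmx1 mulmx1.
Qed.

Section CriticalDistances.
Variables (R : realType) (A B : 'I_3 -> 'I_3 -> R) (q0 : config R).
Hypothesis AB_sign : forall i j : 'I_3, (i < j)%N -> A i j < 0 < B i j.
Hypothesis q0_dist : forall i j : 'I_3, (i < j)%N ->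
  Defs.dist q0 i j = Num.sqrt (- 3%:R * B i j / A i j).

Lemma critical_distance (i j : 'I_3) : (i < j)%N ->
  A i j * pdot q0 q0 i j = - (3 * B i j).
Proof.
move=> ij; have /andP[a0 b0] := AB_sign ij.
have := q0_dist ij; rewrite dist_pdot => h.
have e : pdot q0 q0 i j = - 3 * B i j / A i j.
  rewrite -[LHS]sqr_sqrtr ?pdot_ge0// h sqr_sqrtr//.
  by rewrite mulNr mulNr -mulrN -invrN divr_ge0 ?mulr_ge0 ?oppr_ge0 ?ltW.
by rewrite e; field; rewrite lt_eqF.
Qed.

Lemma stiffness_gt0 (i j : 'I_3) : Omega R q0 -> (i < j)%N ->
  0 < stiffness (A i j) (pdot q0 q0 i j).
Proof.
move=> qO ij; have /andP[a0 _] := AB_sign ij.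
rewrite /stiffness mulr_gt0 ?exprn_gt0 ?invr_gt0 ?sqrtr_gt0 ?Omega_pdot//.
by rewrite mulNr -mulrN mulr_gt0 ?invr_gt0 ?oppr_gt0.
Qed.

Lemma quad_term_ge0 (u : config R) (i j : 'I_3) : Omega R q0 -> (i < j)%N ->
  0 <= 4 * stiffness (A i j) (pdot q0 q0 i j) * pdot q0 u i j * pdot q0 u i j.
Proof.
move=> qO ij; rewrite -mulrA; apply: mulr_ge0; last by rewrite -expr2 sqr_ge0.
by apply: mulr_ge0 => //; exact: ltW (stiffness_gt0 qO ij).
Qed.

Lemma quad_ge0 (u : config R) : Omega R q0 -> 0 <= quad A q0 u u.
Proof.
by move=> qO; apply: sumr_ge0 => i _; apply: sumr_ge0 => j; exact: quad_term_ge0.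
Qed.

Lemma quad_eq0 (u : config R) : Omega R q0 -> quad A q0 u u = 0 ->
  forall i j : 'I_3, (i < j)%N -> pdot q0 u i j = 0.
Proof.
move=> qO; have term0 i j := quad_term_ge0 (i := i) (j := j) u qO.
move=> /eqP; rewrite psumr_eq0; last by move=> i _; apply: sumr_ge0 => j; exact: term0.
move=> /allP h i j ij; have := h i; rewrite mem_index_enum => /(_ isT) /=.
rewrite psumr_eq0; last by move=> l; exact: term0.
move=> /allP /(_ j); rewrite mem_index_enum ij => /(_ isT) /=.
rewrite -mulrA mulf_eq0 mulf_eq0 (gt_eqF (stiffness_gt0 qO ij)) pnatr_eq0 /=.
by rewrite -expr2 sqrf_eq0 => /eqP.
Qed.

End CriticalDistances.

Lemma nonresonant_sqrt (R : realType) (l b : R) : 0 < b -> 0 <= l ->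
  (l != 0 -> l != b ^+ 2 -> forall k : nat, (0 < k)%N -> Num.sqrt l / b <> k%:R) ->
  resonant (Num.sqrt l / b) \/
  (Num.sqrt l / b) ^+ 2 * sinw (Num.sqrt l / b) pi != 0.
Proof.
move=> b0 l0 h; have [->|ln0] := eqVneq l 0; first by left; rewrite sqrtr0 mul0r /resonant eqxx.
have [->|lb] := eqVneq l (b ^+ 2).
  by left; rewrite sqrtr_sqr gtr0_norm// divff ?gt_eqF// /resonant eqxx orbT.
right; set u := Num.sqrt l / b.
have u0 : 0 < u by rewrite divr_gt0// sqrtr_gt0 lt0r ln0.
have s0 : sin (u * pi) != 0.
  apply: sin_pi_neq0 => // -[|k]; first by rewrite gt_eqF.
  by apply/eqP; exact: h.
rewrite /sinw (gt_eqF u0); apply: mulf_neq0; first by rewrite expf_neq0// gt_eqF.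
by apply: mulf_neq0 => //; rewrite invr_eq0 gt_eqF.
Qed.

Lemma sqrt_near1 (R : realType) (L : R) : 0 < L -> `|Num.sqrt L - 1| <= `|L - 1|.
Proof.
move=> L0; have s0 : 0 < Num.sqrt L by rewrite sqrtr_gt0.
have -> : L - 1 = (Num.sqrt L - 1) * (Num.sqrt L + 1).
  by rewrite -{1}[L]sqr_sqrtr ?ltW//; ring.
rewrite normrM ler_peMr// ger0_norm ?lerDr ?ltW// addr_gt0//.
Qed.

(** * Construction of the orbit and return to physical time *)

Section Orbit.
Variables (R : realType) (A B : 'I_3 -> 'I_3 -> R) (q0 : config R).
Local Notation U := (schwarzschild A B).
Hypothesis q0_Omega : Omega R q0.
Hypothesis q0_noncollinear : ~ collinear q0.
Hypothesis AB_sign : forall i j : 'I_3, (i < j)%N -> A i j < 0 < B i j.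
Hypothesis q0_dist : forall i j : 'I_3, (i < j)%N ->
  Defs.dist q0 i j = Num.sqrt (- 3%:R * B i j / A i j).
Variable (V : set (config R)).
Hypothesis V_open : open V.
Hypothesis V_Omega : V `<=` Omega R.
Hypothesis V_q0 : V q0.
Variable b : R.
Hypothesis b_gt0 : 0 < b.
Hypothesis b_eigen : eigenvalue (hessian U q0) (b ^+ 2).
Hypothesis b_nonres : forall l, eigenvalue (hessian U q0) l -> 0 < l -> l != b ^+ 2 ->
  forall k : nat, (0 < k)%N -> Num.sqrt l / b <> k%:R.

(* [X] is the orbit in the time scale where its period is [2 pi]. *)
Lemma scaled_orbit (eta : R) : 0 < eta -> exists (L : R) (X X1 : R -> config R),
  [/\ `|L - 1| < eta, forall t, V (X t),
      forall i k, even_periodic (fun t => X t i k) &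
      [/\ forall i k, is_primitive (fun t => X t i k) (fun t => X1 t i k),
          forall i k, is_primitive (fun t => X1 t i k)
            (fun t => - (L / b ^+ 2) * grad U (X t) i k) &
          forall S, 0 < S -> (forall t, X (t + S) = X t) -> 2 * pi <= S]].
Proof.
move=> eta0.
have AB_crit := critical_distance AB_sign q0_dist.
have nV : nbhs q0 V by apply: open_nbhs_nbhs.
have near0 : \forall q \near q0, Omega R q by apply: filterS nV.
have [E [d [EE EH]]] := symmetric_spectral (hessian_sym near0 AB_crit).
have dE a b' := quad_frame near0 AB_crit EE EH a b'.
have eig l := eigenvalue_frame (B := B) EE EH l.
have [kappa k0 rigid] := residual_force_eq0 q0_Omega q0_noncollinear.
have [m m0 nW] := good_neighbourhood q0_Omega nV k0.
have [rho /andP[rho0 rho1] hW] := conf_near (frame E) nW.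
have d_ge0 a : 0 <= d 0 a.
  by have := quad_ge0 AB_sign (frame E a) q0_Omega; rewrite dE eqxx mulr1.
have nonres a : resonant (Num.sqrt (d 0 a) / b) \/
    (Num.sqrt (d 0 a) / b) ^+ 2 * sinw (Num.sqrt (d 0 a) / b) pi != 0.
  apply: nonresonant_sqrt => // dn0 db.
  by apply: b_nonres => //; [apply/eig; exists a|rewrite lt0r dn0 d_ge0].
have [p [pf pF pr]] := spring_perturbation AB_crit dE b_gt0 rho0 rho1 m0
  (fun x xr => (let: And3 _ h _ := hW x xr in h)) nonres (ord0 : 'I_(3 * 2)).
(* rho / 2 keeps the orbit where the perturbation is controlled; 1 / 24 gives 2 * 6 * eta' < 1, as
   the period argument requires in six coordinates. *)
pose eta' := Num.min eta (Num.min (rho / 2) (1 / 24)).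
have eta'0 : 0 < eta' by rewrite lt_min eta0 lt_min !divr_gt0.
have eta'1 : eta' <= eta by rewrite ge_min lexx.
have eta'2 : eta' <= rho / 2 by rewrite /eta' !ge_min lexx !orbT.
have eta'3 : eta' <= 1 / 24 by rewrite /eta' !ge_min lexx !orbT.
have [|e [L [x [v [c [/andP[e0 ee] L1 v1 xa]]]]]] := @brake_orbits R _ p eta' _ eta'0.
  have [a da] := (eig (b ^+ 2)).1 b_eigen; exists a.
  by rewrite pf da sqrtr_sqr gtr0_norm// divff// gt_eqF.
have ex a : even_periodic (x a) by have [] := xa a.
have va a : `|v a| <= 1.
  rewrite -(expr_le1 (n := 2)) ?normr_ge0// -normrX ger0_norm ?sqr_ge0// -v1.
  rewrite (bigD1 a)//= expr2 lerDl; apply: sumr_ge0 => a' _.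
  by rewrite -expr2 sqr_ge0.
(* Each coordinate is at most e + eta' e <= 2 e, and e < eta' <= rho / 2. *)
have xr t : in_ball (fun a => x a t) rho.
  move=> a; have [_ _ _ h] := xa a.
  have -> : x a t = (x a t - e * (v a * cos t)) + e * (v a * cos t) by ring.
  rewrite (le_trans (ler_normD _ _))//.
  have h1 : `|e * (v a * cos t)| <= e.
    rewrite normrM gtr0_norm// ler_piMr ?(ltW e0)// normrM mulr_ile1//.
    by rewrite ler_norml cos_geN1 cos_le1.
  have h2 : eta' * e <= e by rewrite ler_piMl ?(ltW e0)// (le_trans eta'3)//; lra.
  have := h t; lra.
pose X t := conf q0 (frame E) (fun a => x a t).
have XW t := hW _ (xr t).
have XV t : V (X t) by have [] := XW t.
have XO t : Omega R (X t) by exact: V_Omega.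
have /choice[x1 hx1] : forall a, exists x1, is_primitive (x a) x1 /\
    is_primitive x1 (fun t => - (L / b ^+ 2) * dU A B (X t) (frame E a) + c a).
  move=> a; have [_ [x1 h1 h2] _ _] := xa a; exists x1; split => //.
  apply: is_primitive_eq h2 _ => t; rewrite pf pF /rem_force -/(X t).
  rewrite exprMn sqr_sqrtr// exprVn; field; rewrite gt_eqF//.
pose X1 t : config R := \sum_a x1 a t *: frame E a.
pose N : config R := \sum_a c a *: frame E a.
have XE i k t : X t i k = q0 i k + \sum_a x a t * frame E a i k.
  by rewrite /X /conf /shift_by mxE summxE; congr (_ + _); apply: eq_bigr => a _; rewrite mxE.
have X1E i k t : X1 t i k = \sum_a x1 a t * frame E a i k.
  by rewrite /X1 summxE; apply: eq_bigr => a _; rewrite mxE.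
have eX i k : even_periodic (fun t => X t i k).
  have -> : (fun t => X t i k) = (fun t => q0 i k + \sum_a frame E a i k * x a t).
    by apply/funext => t; rewrite XE; congr (_ + _); apply: eq_bigr => a _; rewrite mulrC.
  apply: even_periodicD; first exact: even_periodic_cst.
  by apply: even_periodic_sum => a _; exact: even_periodicZ.
have dX i k : is_primitive (fun t => X t i k) (fun t => X1 t i k).
  have -> : (fun t => X t i k) = (fun t => q0 i k + \sum_a frame E a i k * x a t).
    by apply/funext => t; rewrite XE; congr (_ + _); apply: eq_bigr => a _; rewrite mulrC.
  apply: is_primitive_eq (is_primitiveD (is_primitive_cst (q0 i k))
    (is_primitive_sum (fun a (_ : true) => is_primitiveZ (frame E a i k) (hx1 a).1))) _ => t.
  by rewrite add0r X1E; apply: eq_bigr => a _; rewrite mulrC.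
have dX1 i k : is_primitive (fun t => X1 t i k)
    (fun t => - (L / b ^+ 2) * grad U (X t) i k + N i k).
  have -> : (fun t => X1 t i k) = (fun t => \sum_a frame E a i k * x1 a t).
    by apply/funext => t; rewrite X1E; apply: eq_bigr => a _; rewrite mulrC.
  apply: is_primitive_eq (is_primitive_sum (fun a (_ : true) =>
    is_primitiveZ (frame E a i k) (hx1 a).2)) _ => t.
  rewrite -(grad_frame A B EE (XO t)) /N !summxE mulr_sumr -big_split.
  by apply: eq_bigr => a _; rewrite !mxE /=; ring.
have N0 : N = 0.
  have [Nsum [t tor]] := torque_free XO eX dX dX1.
  apply: (rigid N (X t)) => //; last by have [] := XW t.
  (* The coefficients of N are nonzero only where the eigenvalue is zero, so the Hessian form
     vanishes on N and N preserves the three distances to first order. *)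
  apply: (quad_eq0 AB_sign q0_Omega).
  rewrite {1}/N quad_suml big1// => a _; rewrite quadZl quadC /N quad_suml big1 ?mulr0//.
  move=> a' _; rewrite quadZl dE; have [->|] := eqVneq a' a; last by rewrite !mulr0.
  have [da|da] := eqVneq (d 0 a) 0; first by rewrite da mul0r mulr0.
  have [_ _ ca _] := xa a; rewrite ca ?mul0r// pf mulf_neq0 ?invr_eq0 ?gt_eqF//.
  by rewrite sqrtr_gt0 lt0r da d_ge0.
exists L, X, X1; split => //; first exact: lt_le_trans L1 _.
split => // [i k|S S0 XS].
  apply: is_primitive_eq (dX1 i k) _ => t.
  by have -> : N i k = 0; [rewrite N0 mxE|rewrite addr0].
apply: (@near_cosine_period R _ x v e eta' S) => //.
- by move=> a t; have [_ _ _] := xa a.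
- by lra.
- move=> a t; have := XS t; rewrite /X /conf => /addrI/(shift_frame_inj EE).
  exact.
Qed.

End Orbit.

Theorem mainTheorem4 (R : realType) (q0 : 'M[R]_(3, 2))
    (A B : 'I_3 -> 'I_3 -> R)
    (m : nat) (beta : 'I_m -> R) (j0 : 'I_m)
    (q0_Omega : Omega R q0)
    (q0_noncollinear : ~ collinear q0)
    (AB_sign : forall i j : 'I_3, (i < j)%N -> A i j < 0 < B i j)
    (q0_dist : forall i j : 'I_3, (i < j)%N ->
       dist q0 i j = Num.sqrt (- 3%:R * B i j / A i j))
    (beta_inj : injective beta)
    (beta_pos : forall j, 0 < beta j)
    (beta_spec : spectrum (hessian (schwarzschild A B) q0) `&` [set x | 0 < x]
                 = [set beta j ^+ 2 | j in [set: 'I_m]])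
    (beta_nonres : forall j, j != j0 ->
       ~ exists n : nat, (0 < n)%N /\ beta j / beta j0 = n%:R)
    (V : set 'M[R]_(3, 2)) (V_open : open V) (V_Omega : V `<=` Omega R)
    (V_orbit : SO2_orbit q0 `<=` V)
    (delta : R) (delta_pos : 0 < delta) :
  exists (q : R -> 'M[R]_(3, 2)) (T : R),
    [/\ newton_solution (schwarzschild A B) q,
        ~ stationary q,
        forall t, V (q t),
        minimal_period q T
      & `|T - 2%:R * pi / beta j0| < delta].
Proof.
set b := beta j0; have b0 : 0 < b := beta_pos j0.
have V_q0 : V q0 by apply: V_orbit; exact: SO2_orbit_self.
have b_eigen : eigenvalue (hessian (schwarzschild A B) q0) (b ^+ 2).
  have : [set beta j ^+ 2 | j in [set: 'I_m]] (b ^+ 2) by exists j0.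
  by rewrite -beta_spec => -[].
have b_nonres l : eigenvalue (hessian (schwarzschild A B) q0) l -> 0 < l ->
    l != b ^+ 2 -> forall k : nat, (0 < k)%N -> Num.sqrt l / b <> k%:R.
  move=> le l0 lb k k0 e.
  have : [set beta j ^+ 2 | j in [set: 'I_m]] l by rewrite -beta_spec.
  move=> [j _ jl]; rewrite -jl sqrtr_sqr gtr0_norm// in e.
  apply: (beta_nonres j); last by exists k.
  by apply: contraNneq lb => jj; rewrite -jl jj.
have p0 := pi_gt0 R; have pp0 : 0 < 2 * pi :> R by rewrite mulr_gt0.
(* The bound 1 / 2 keeps L positive. The other one gives the period estimate, since T = 2 pi sqrt(L)
   / b and |sqrt(L) - 1| <= |L - 1|. *)
have eta0 : 0 < Num.min (1 / 2) (delta * b / (2 * pi)).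
  by rewrite lt_min !divr_gt0// mulr_gt0.
have [L [X [X1 [L1 XV eX [dX dX1 Xmin]]]]] := scaled_orbit q0_Omega q0_noncollinear
  AB_sign q0_dist V_open V_Omega V_q0 b0 b_eigen b_nonres eta0.
move: L1; rewrite lt_min => /andP[L1 L2].
have L0 : 0 < L by move: L1; rewrite ltr_norml => /andP[]; lra.
have sL : 0 < Num.sqrt L by rewrite sqrtr_gt0.
(* Accelerations scale by c^2, and c^2 L / b^2 = 1 restores Newton's equation. *)
pose c := b / Num.sqrt L; have c0 : 0 < c by rewrite divr_gt0.
have c2 : c ^+ 2 * (L / b ^+ 2) = 1.
  rewrite /c exprMn exprVn sqr_sqrtr ?ltW//.
  by field; rewrite !gt_eqF.
pose q t := X (c * t); pose q1 t := c *: X1 (c * t).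
pose q2 t := - grad (schwarzschild A B) (q t).
have lin : is_primitive (fun t => c * t) (fun=> c).
  by apply: is_primitive_eq (is_primitiveZ c (@is_primitive_id R)) _ => t; rewrite mulr1.
have [dq eq1] : (forall t, derivable q t 1) /\ (q^`())%classic = q1.
  apply: matrix_derive1 => i k.
  by apply: is_primitive_eq (is_primitive_comp (dX i k) lin) _ => t; rewrite mxE mulrC.
have [dq1 eq2] : (forall t, derivable q1 t 1) /\ (q1^`())%classic = q2.
  apply: matrix_derive1 => i k.
  have -> : (fun t => q1 t i k) = (fun t => c * X1 (c * t) i k).
    by apply/funext => t; rewrite mxE.
  apply: is_primitive_eq (is_primitiveZ c (is_primitive_comp (dX1 i k) lin)) _ => t.
  rewrite /q2 [RHS]mxE -[X in _ = - X]mul1r -c2 /q; ring.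
have T0 : 0 < 2 * pi / c by rewrite divr_gt0.
have qT t : q (t + 2 * pi / c) = q t.
  rewrite /q mulrDr [c * (2 * pi / c)]mulrC divfK ?gt_eqF//.
  by apply/matrixP => i k; exact: (even_periodicP (eX i k)).
have qmin S : period q S -> 2 * pi / c <= S.
  move=> [S0 qS]; rewrite ler_pdivrMr// (mulrC S); apply: Xmin; first exact: mulr_gt0.
  move=> t; have := qS (t / c).
  by rewrite /q mulrDr [c * (t / c)]mulrC divfK ?gt_eqF.
exists q, (2 * pi / c); split.
- move=> t; split; first by apply: V_Omega; exact: XV.
  + exact: dq.
  + by rewrite eq1.
  + by rewrite eq1 eq2.
(* A stationary solution would have half of the minimal period as a period. *)
- move=> st; have : 2 * pi / c <= 2 * pi / c / 2.
    by apply: qmin; split; [rewrite divr_gt0|move=> t; exact: st].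
  by move: T0; lra.
- by move=> t; exact: XV.
- by split; first by split.
- have -> : 2 * pi / c - 2 * pi / b = 2 * pi / b * (Num.sqrt L - 1).
    by rewrite /c; field; rewrite !gt_eqF.
  rewrite normrM gtr0_norm ?divr_gt0//.
  have h := le_lt_trans (sqrt_near1 L0) L2.
  have dE (x : R) : x != 0 -> delta = 2 * x / b * (delta * b / (2 * x)).
    by move=> x0; field; rewrite x0 gt_eqF.
  by rewrite [ltRHS](dE pi) ?gt_eqF// ltr_pM2l ?divr_gt0.
Qed.
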